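(* The conjugacy class of a closed abelian subgroup $F$ of $G=\mathrm{Sp}(n)/\langle -I\rangle$ satisfying $\dim\mathfrak g_0^F=\dim F$ is determined by the integer $k=\frac12\mathrm{rank}(F/\ker m)$, the conjugacy class of the subgroup $B_F$, and the linear structure $(m,\mu_1,\dots,\mu_{s_0})$ on $F/\ker m$.
   Context: Let $\mathrm{Sp}(n)=\{X\in M_n(\mathbb H):XX^*=I\}$, $G=\mathrm{Sp}(n)/\langle -I\rangle$ with Lie algebra $\mathfrak g_0$, and let $\pi:\mathrm{Sp}(n)\to G$ be the projection; $[A]=\pi(A)$. $\mathfrak g_0^F$ is the fixed space of $F$ under the adjoint action. For a closed abelian subgroup $F\subset G$, define $m:F\times F\to\{\pm1\}$ by $m([A],[B])=\lambda$ where $ABA^{-1}B^{-1}=\lambda I$; let $\ker m=\{x\in F:m(x,y)=1\ \forall y\in F\}$. Then $F/\ker m$ is an elementary abelian 2-group, i.e. an $\mathbb F_2$-vector space, to which $m$ descends; rank means its dimension. Let $B_F=\{x\in\ker m: A^2=I\ \forall A\in\pi^{-1}(x)\}$. Assume $\dim\mathfrak g_0^F=\dim F$. Let $\mathbb H^n=V_1\oplus\cdots\oplus V_s$ be the decomposition of the right $\mathbb H$-module $\mathbb H^n$ into the distinct nonzero simultaneous eigenspaces (eigenvalues $\pm1$) of the commutative group $\pi^{-1}(B_F)$, so that the centralizer of $\pi^{-1}(B_F)$ in $\mathrm{Sp}(n)$ is $\mathrm{Sp}(V_1)\times\cdots\times\mathrm{Sp}(V_s)$. If $F$ is not a maximal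 torus, then with $k=\frac12\mathrm{rank}(F/\ker m)\ge1$ each $\dim_{\mathbb H}V_i$ is $2^{k-1}$ or $2^{k}$; order them so that $\dim_{\mathbb H} V_i=2^{k-1}$ for $1\le i\le s_0$ and $2^{k}$ for $s_0<i\le s$. (The case of $F$ a maximal torus is regarded as $k=0$, $s_0=0$, $s=n$.) Every $A\in\pi^{-1}(F)$ preserves each $V_i$, and for $1\le i\le s_0$ one has $(A|_{V_i})^2=\mu_i([A])\,\mathrm{id}$ with $\mu_i([A])\in\{\pm1\}$; $\mu_i$ descends to a map $F/\ker m\to\{\pm1\}$ with $m(x,y)=\mu_i(x)\mu_i(y)\mu_i(xy)$. The linear structure $(m,\mu_1,\dots,\mu_{s_0})$ is considered as a multi-symplectic metric space, in which the order among the $\mu_i$ is overlooked: two such structures $(V,m,\mu_1,\dots,\mu_{s_0})$ and $(V',m',\mu_1',\dots,\mu_{s_0}')$ are isomorphic if there is a linear isomorphism $V\to V'$ transferring $(m,\mu_1,\dots,\mu_{s_0})$ to $(m',\mu'_{i_1},\dots,\mu'_{i_{s_0}})$ for some permutation $i_1,\dots,i_{s_0}$ of $1,\dots,s_0$.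
   Formalization: With an arbitrary permutation of the μ_i the claim is false (a counterexample exists for n=12, k=2); the formal statement requires the permutation of the μ_i to be the matching V_i ↦ aV_i given by an element a conjugating B_F to B_F'. *)

(* Defs.v *)
From HB Require Import structures.
From mathcomp Require Import all_boot all_order all_algebra ring.
From mathcomp Require Import all_classical all_reals all_analysis.

Set Implicit Arguments.
Unset Strict Implicit.
Unset Printing Implicit Defensive.

Import Order.TTheory GRing.Theory Num.Theory.
Import numFieldNormedType.Exports.

Local Open Scope classical_set_scope.
Local Open Scope ring_scope.

(* The quaternions a + b i + c j + d k, stored as the row vector (a, b, c, d),
   from which they inherit their real vector space structure and topology. *)
Definition quat (R : realType) : Type := 'rV[R]_4.
HB.instance Definition _ (R : realType) := NormedModule.copy (quat R) 'rV[R]_4.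

Section Quaternions.
Variable R : realType.
Implicit Types p q r : quat R.

Definition mkquat (a b c d : R) : quat R :=
  \row_(i < 4) [:: a; b; c; d]`_i.

Definition qre q : R := (q : 'rV[R]_4) 0 0.
Definition qi q : R := (q : 'rV[R]_4) 0 1.
Definition qj q : R := (q : 'rV[R]_4) 0 2%:R.
Definition qk q : R := (q : 'rV[R]_4) 0 3%:R.

Definition qmul p q : quat R :=
  mkquat (qre p * qre q - qi p * qi q - qj p * qj q - qk p * qk q)
         (qre p * qi q + qi p * qre q + qj p * qk q - qk p * qj q)
         (qre p * qj q - qi p * qk q + qj p * qre q + qk p * qi q)
         (qre p * qk q + qi p * qj q - qj p * qi q + qk p * qre q).

Definition qconj q : quat R := mkquat (qre q) (- qi q) (- qj q) (- qk q).

Lemma quatP p q :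
  qre p = qre q -> qi p = qi q -> qj p = qj q -> qk p = qk q -> p = q.
Proof.
move=> h0 h1 h2 h3; apply/rowP => i.
by case: i => [[|[|[|[|m]]]] hm] //;
  [move: h0 | move: h1 | move: h2 | move: h3];
  rewrite /qre /qi /qj /qk => h; apply: etrans (etrans h _);
  congr (_ _ _); apply: val_inj.
Qed.

Lemma mkquatE a b c d :
  (qre (mkquat a b c d) = a) * (qi (mkquat a b c d) = b) *
  (qj (mkquat a b c d) = c) * (qk (mkquat a b c d) = d).
Proof. by rewrite /qre /qi /qj /qk /mkquat !mxE. Qed.

Lemma quatDE p q :
  (qre (p + q) = qre p + qre q) * (qi (p + q) = qi p + qi q) *
  (qj (p + q) = qj p + qj q) * (qk (p + q) = qk p + qk q).
Proof. by rewrite /qre /qi /qj /qk !mxE. Qed.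

Lemma quatZE a q :
  (qre (a *: q) = a * qre q) * (qi (a *: q) = a * qi q) *
  (qj (a *: q) = a * qj q) * (qk (a *: q) = a * qk q).
Proof. by rewrite /qre /qi /qj /qk !mxE. Qed.

Lemma quat0E :
  (qre (0 : quat R) = 0) * (qi (0 : quat R) = 0) *
  (qj (0 : quat R) = 0) * (qk (0 : quat R) = 0).
Proof. by rewrite /qre /qi /qj /qk !mxE. Qed.

Let qsimp := (mkquatE, quatDE, quat0E).

Fact qmulA : associative qmul.
Proof. by move=> p q r; apply: quatP; rewrite /qmul !qsimp; ring. Qed.
Fact qmul1q : left_id (mkquat 1 0 0 0) qmul.
Proof. by move=> q; apply: quatP; rewrite /qmul !qsimp; ring. Qed.
Fact qmulq1 : right_id (mkquat 1 0 0 0) qmul.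
Proof. by move=> q; apply: quatP; rewrite /qmul !qsimp; ring. Qed.
Fact qmulDl : left_distributive qmul +%R.
Proof. by move=> p q r; apply: quatP; rewrite /qmul !qsimp; ring. Qed.
Fact qmulDr : right_distributive qmul +%R.
Proof. by move=> p q r; apply: quatP; rewrite /qmul !qsimp; ring. Qed.
Fact qone_neq0 : mkquat 1 0 0 0 != 0.
Proof.
apply/eqP => /(congr1 qre); rewrite !qsimp => /eqP.
by rewrite oner_eq0.
Qed.

HB.instance Definition _ := GRing.Zmodule_isNzRing.Build (quat R)
  qmulA qmul1q qmulq1 qmulDl qmulDr qone_neq0.

Lemma quat1E :
  (qre (1 : quat R) = 1) * (qi (1 : quat R) = 0) *
  (qj (1 : quat R) = 0) * (qk (1 : quat R) = 0).
Proof. exact: mkquatE. Qed.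

Lemma quatME p q : p * q = qmul p q. Proof. by []. Qed.

Lemma qconjK : involutive qconj.
Proof. by move=> q; apply: quatP; rewrite /qconj !qsimp ?opprK. Qed.

Lemma qconjD p q : qconj (p + q) = qconj p + qconj q.
Proof. by apply: quatP; rewrite /qconj !qsimp ?opprD. Qed.

Lemma qconjM p q : qconj (p * q) = qconj q * qconj p.
Proof. by apply: quatP; rewrite quatME /qconj /qmul !qsimp; ring. Qed.

Lemma qconj0 : qconj 0 = 0.
Proof. by apply: quatP; rewrite /qconj !qsimp ?oppr0. Qed.

Lemma qconj1 : qconj 1 = 1.
Proof. by apply: quatP; rewrite /qconj !(quat1E, mkquatE) ?oppr0. Qed.

Lemma scaler_qmull (a : R) p q : (a *: p) * q = a *: (p * q).
Proof. by apply: quatP; rewrite !quatME /qmul !(qsimp, quatZE); ring. Qed.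

Lemma scaler_qmulr (a : R) p q : p * (a *: q) = a *: (p * q).
Proof. by apply: quatP; rewrite !quatME /qmul !(qsimp, quatZE); ring. Qed.

End Quaternions.

Section QuaternionMatrices.
Variable R : realType.
Local Notation H := (quat R).

Definition qadj m n (A : 'M[H]_(m, n)) : 'M[H]_(n, m) := (map_mx (@qconj R) A)^T.

Lemma qadjK m n : cancel (@qadj m n) (@qadj n m).
Proof. by move=> A; apply/matrixP => i j; rewrite !mxE qconjK. Qed.

Lemma qadjM m n p (A : 'M[H]_(m, n)) (B : 'M[H]_(n, p)) :
  qadj (A *m B) = qadj B *m qadj A.
Proof.
apply/matrixP => i j; rewrite !mxE.
rewrite (big_morph (@qconj R) (@qconjD R) (@qconj0 R)).
by apply: eq_bigr => k _; rewrite !mxE qconjM.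
Qed.

Lemma qadj1 n : qadj (1%:M : 'M[H]_n) = 1%:M.
Proof.
apply/matrixP => i j; rewrite !mxE eq_sym.
by case: eqP => _; rewrite ?qconj1 ?qconj0.
Qed.

(* Left multiplication by A on the column vectors H^n, seen as the real linear
   endomorphism of 'M[R]_(n, 4). *)
Let to_cV n (u : 'M[R]_(n, 4)) : 'cV[H]_n := \col_i (row i u : quat R).
Let of_cV n (v : 'cV[H]_n) : 'M[R]_(n, 4) :=
  \matrix_(i, j) (v i 0 : 'rV[R]_4) 0 j.
Let actR n (A : 'M[H]_n) (u : 'M[R]_(n, 4)) := of_cV (A *m to_cV u).

Let to_cVK n : cancel (@to_cV n) (@of_cV n).
Proof. by move=> u; apply/matrixP => i j; rewrite !mxE. Qed.

Let of_cVK n : cancel (@of_cV n) (@to_cV n).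
Proof.
move=> v; apply/matrixP => i j; rewrite !mxE (ord1 j).
by apply/rowP => k; rewrite !mxE.
Qed.

Let actR_linear n A : linear (@actR n A).
Proof.
move=> a u v; apply/matrixP => i j.
rewrite !mxE -[RHS](_ : ((a *: (\sum_k A i k * to_cV u k 0)
  + (\sum_k A i k * to_cV v k 0) : quat R) : 'rV[R]_4) 0 j = _); last first.
  by rewrite !mxE.
congr ((_ : 'rV[R]_4) 0 j); rewrite scaler_sumr -big_split /=.
apply: eq_bigr => k _; rewrite -scaler_qmulr -mulrDr.
congr (@GRing.mul H _ _); rewrite !mxE.
by apply/rowP => l; rewrite !mxE.
Qed.

Let actRM n (A B : 'M[H]_n) u : actR (A *m B) u = actR A (actR B u).
Proof. by rewrite /actR of_cVK mulmxA. Qed.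

Lemma qmulmx1C n (A B : 'M[H]_n) : A *m B = 1%:M -> B *m A = 1%:M.
Proof.
pose L (C : 'M[H]_n) : {linear 'M[R]_(n, 4) -> 'M[R]_(n, 4)} :=
  HB.pack (actR C) (GRing.isLinear.Build R 'M[R]_(n, 4) 'M[R]_(n, 4) _ (actR C) (actR_linear C)).
pose rho C := lin_mx (L C).
have rhoM C D : rho (C *m D) = rho D *m rho C.
  apply/row_matrixP => i; rewrite !rowE.
  rewrite -[delta_mx 0 i]vec_mxK mulmxA !mul_vec_lin /=.
  by rewrite actRM.
have rho1 : rho 1%:M = 1%:M.
  apply/row_matrixP => i; rewrite !rowE mulmx1.
  by rewrite -[delta_mx 0 i]vec_mxK mul_vec_lin /= /actR mul1mx to_cVK.
have rho_inj C D : rho C = rho D -> C = D.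
  move=> eCD.
  have eL (v : 'cV[H]_n) : C *m v = D *m v.
    have := congr1 (fun M => vec_mx (mxvec (of_cV v) *m M)) eCD.
    rewrite !mul_vec_lin !mxvecK /= /actR of_cVK.
    by move/(congr1 (@to_cV n)); rewrite !of_cVK.
  apply/matrixP => i j.
  have := congr1 (fun v : 'cV[H]_n => v i 0) (eL (delta_mx j 0)).
  by rewrite -!colE !mxE.
move=> AB1; apply: rho_inj; rewrite rhoM rho1.
by apply: mulmx1C; rewrite -rhoM AB1 rho1.
Qed.

(* Multiplication of a quaternionic matrix by a real number. *)
Definition rscale m n (t : R) (X : 'M[H]_(m, n)) : 'M[H]_(m, n) :=
  map_mx (fun q : H => t *: q) X.

(* H^n is a right module over H. *)
Definition qscale n (q : H) (v : 'cV[H]_n) : 'cV[H]_n := v *m q%:M.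

Definition mxexp n (X : 'M[H]_n) : 'M[H]_n :=
  lim (series (fun k => rscale (k`!%:R^-1) (X ^+ k)) @ \oo).

End QuaternionMatrices.

(* W is a free submodule of rank d for the action sc of the scalars K, given by
   a basis.  The action sc need not be the canonical scaling of V: below it is
   either rscale (real dimension) or qscale (dimension over H). *)
Definition has_dim (K : nzRingType) (V : zmodType) (sc : K -> V -> V)
    (W : set V) (d : nat) : Prop :=
  exists b : 'I_d -> V,
    (forall v, W v <-> exists c : 'I_d -> K, v = \sum_i sc (c i) (b i)) /\
    (forall c : 'I_d -> K, \sum_i sc (c i) (b i) = 0 -> forall i, c i = 0).

Record Sp (R : realType) (n : nat) : Type := MkSp {
  spval : 'M[quat R]_n;
  spvalP : spval *m qadj spval == 1%:M
}.

Section SymplecticGroup.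
Variables (R : realType) (n : nat).
Implicit Types A B C : Sp R n.

HB.instance Definition _ := [isSub for @spval R n].
HB.instance Definition _ := [Choice of Sp R n by <:].

Lemma Sp_one_subproof : (1%:M : 'M[quat R]_n) *m qadj 1%:M == 1%:M.
Proof. by rewrite qadj1 mulmx1. Qed.
Lemma Sp_mul_subproof A B :
  (spval A *m spval B) *m qadj (spval A *m spval B) == 1%:M.
Proof.
rewrite qadjM mulmxA -(mulmxA (spval A)) (eqP (spvalP B)) mulmx1.
exact: (spvalP A).
Qed.
Lemma Sp_inv_subproof A : qadj (spval A) *m qadj (qadj (spval A)) == 1%:M.
Proof. by rewrite qadjK; apply/eqP/qmulmx1C/eqP; exact: (spvalP A). Qed.
Lemma Sp_opp_subproof A : (- spval A) *m qadj (- spval A) == 1%:M.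
Proof.
have -> : qadj (- spval A) = - qadj (spval A).
  apply/matrixP => i j; rewrite !mxE; apply/quatP;
  by rewrite /qconj /qre /qi /qj /qk !mxE ?opprK.
by rewrite mulmxN mulNmx opprK; exact: (spvalP A).
Qed.

Definition Sp_one : Sp R n := MkSp Sp_one_subproof.
Definition Sp_mul A B : Sp R n := MkSp (Sp_mul_subproof A B).
Definition Sp_inv A : Sp R n := MkSp (Sp_inv_subproof A).
Definition Sp_opp A : Sp R n := MkSp (Sp_opp_subproof A).

Fact Sp_mulA : associative Sp_mul.
Proof. by move=> A B C; apply: val_inj; exact: mulmxA. Qed.
Fact Sp_mul1g : left_id Sp_one Sp_mul.
Proof. by move=> A; apply: val_inj; exact: mul1mx. Qed.
Fact Sp_mulg1 : right_id Sp_one Sp_mul.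
Proof. by move=> A; apply: val_inj; exact: mulmx1. Qed.
Fact Sp_mulgV : right_inverse Sp_one Sp_inv Sp_mul.
Proof. by move=> A; apply: val_inj; exact/eqP/(spvalP A). Qed.
Fact Sp_mulVg : left_inverse Sp_one Sp_inv Sp_mul.
Proof. by move=> A; apply: val_inj; apply/qmulmx1C/eqP/(spvalP A). Qed.

HB.instance Definition _ := isGroup.Build (Sp R n)
  Sp_mulA Sp_mul1g Sp_mulg1 Sp_mulVg Sp_mulgV.

HB.instance Definition _ :=
  Topological.copy (Sp R n) (initial_topology (@spval R n)).

Definition eq_pm A B : bool := (B == A) || (B == Sp_opp A).

Lemma Sp_oppK : involutive Sp_opp.
Proof. by move=> A; apply: val_inj; rewrite /= opprK. Qed.
Lemma Sp_oppMl A B : Sp_opp (A * B)%g = (Sp_opp A * B)%g.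
Proof. by apply: val_inj => /=; rewrite mulNmx. Qed.
Lemma Sp_oppMr A B : Sp_opp (A * B)%g = (A * Sp_opp B)%g.
Proof. by apply: val_inj => /=; rewrite mulmxN. Qed.
Lemma Sp_oppV A : Sp_opp A^-1%g = ((Sp_opp A)^-1)%g.
Proof.
apply: (mulgI (Sp_opp A)).
by rewrite -Sp_oppMl -Sp_oppMr Sp_oppK mulgV mulgV.
Qed.

Lemma eq_pm_refl : reflexive eq_pm.
Proof. by move=> A; rewrite /eq_pm eqxx. Qed.
Lemma eq_pm_sym : symmetric eq_pm.
Proof.
move=> A B; rewrite /eq_pm [A == B]eq_sym; congr (_ || _).
by apply/eqP/eqP => ->; rewrite Sp_oppK.
Qed.
Lemma eq_pm_trans : transitive eq_pm.
Proof.
move=> B A C /orP[]/eqP-> /orP[]/eqP->;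
by rewrite /eq_pm ?Sp_oppK eqxx ?orbT.
Qed.

Canonical eq_pm_equiv := EquivRel eq_pm eq_pm_refl eq_pm_sym eq_pm_trans.

End SymplecticGroup.

Definition PSp (R : realType) (n : nat) : Type :=
  quotient_topology {eq_quot (@eq_pm_equiv R n)}%qT.

Section ProjectiveSymplecticGroup.
Variables (R : realType) (n : nat).
Local Open Scope quotient_scope.
Local Notation G := (PSp R n).

HB.instance Definition _ := Topological.copy G
  (quotient_topology {eq_quot (@eq_pm_equiv R n)}%qT).

Definition pi_Sp (A : Sp R n) : G := \pi_{eq_quot (@eq_pm_equiv R n)} A.
Definition lift_Sp (x : G) : Sp R n :=
  repr (x : {eq_quot (@eq_pm_equiv R n)}).

Lemma lift_SpK : cancel lift_Sp pi_Sp.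
Proof. by move=> x; exact: reprK. Qed.

Lemma pi_SpP A B : reflect (pi_Sp A = pi_Sp B) (eq_pm A B).
Proof. exact: eqmodP. Qed.

Lemma lift_pi_Sp A : eq_pm A (lift_Sp (pi_Sp A)).
Proof. by apply/pi_SpP; rewrite lift_SpK. Qed.

Definition PSp_one : G := pi_Sp 1%g.
Definition PSp_mul (x y : G) : G := pi_Sp (lift_Sp x * lift_Sp y)%g.
Definition PSp_inv (x : G) : G := pi_Sp (lift_Sp x)^-1%g.

Lemma pi_SpM A B : pi_Sp (A * B)%g = PSp_mul (pi_Sp A) (pi_Sp B).
Proof.
apply/pi_SpP; have := lift_pi_Sp A; have := lift_pi_Sp B.
rewrite /eq_pm => /orP[]/eqP-> /orP[]/eqP->; rewrite -?Sp_oppMl -?Sp_oppMr;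
by rewrite ?Sp_oppK eqxx ?orbT.
Qed.

Lemma pi_SpV A : pi_Sp A^-1%g = PSp_inv (pi_Sp A).
Proof.
apply/pi_SpP; have := lift_pi_Sp A.
by rewrite /eq_pm => /orP[]/eqP->; rewrite -?Sp_oppV eqxx ?orbT.
Qed.

Fact PSp_mulA : associative PSp_mul.
Proof.
by move=> x y z; rewrite -[x]lift_SpK -[y]lift_SpK -[z]lift_SpK -!pi_SpM mulgA.
Qed.
Fact PSp_mul1g : left_id PSp_one PSp_mul.
Proof. by move=> x; rewrite -[x]lift_SpK -pi_SpM mul1g. Qed.
Fact PSp_mulg1 : right_id PSp_one PSp_mul.
Proof. by move=> x; rewrite -[x]lift_SpK -pi_SpM mulg1. Qed.
Fact PSp_mulVg : left_inverse PSp_one PSp_inv PSp_mul.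
Proof. by move=> x; rewrite -[x]lift_SpK -pi_SpV -pi_SpM mulVg. Qed.
Fact PSp_mulgV : right_inverse PSp_one PSp_inv PSp_mul.
Proof. by move=> x; rewrite -[x]lift_SpK -pi_SpV -pi_SpM mulgV. Qed.

HB.instance Definition _ := isGroup.Build G
  PSp_mulA PSp_mul1g PSp_mulg1 PSp_mulVg PSp_mulgV.

End ProjectiveSymplecticGroup.

Section Invariants.
Variables (R : realType) (n : nat).
Local Notation G := (PSp R n).
Implicit Types (F : set G) (x y : G) (W : set 'cV[quat R]_n).

Definition closed_abelian_subgroup F : Prop :=
  [/\ [/\ F 1%g, (forall x y, F x -> F y -> F (x * y)%g)
        & (forall x, F x -> F (x^-1)%g)],
      (forall x y, F x -> F y -> (x * y = y * x)%g)
    & closed F].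

Definition conj_set (g : G) F : set G := [set (g * x * g^-1)%g | x in F].

(* The Lie algebra of G is that of its double cover Sp(n). *)
Definition lie_G : set 'M[quat R]_n := [set X | X + qadj X = 0].

(* Ad([A]) X = A X A^-1 *)
Definition lie_fixed F : set 'M[quat R]_n :=
  [set X | lie_G X /\ forall A : Sp R n, F (pi_Sp A) ->
     spval A *m X *m spval A^-1%g = X].

(* The Lie algebra of the closed subgroup F; [exp X] is the exponential of X
   in G. *)
Definition lie_subgroup F : set 'M[quat R]_n :=
  [set X | lie_G X /\ forall t : R, exists A : Sp R n,
     spval A = mxexp (rscale t X) /\ F (pi_Sp A)].

(* dim g_0^F = dim F *)
Definition dim_condition F : Prop :=
  exists d : nat, has_dim (@rscale R n n) (lie_fixed F) d /\
                  has_dim (@rscale R n n) (lie_subgroup F) d.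

(* m([A], [B]) is the sign l with A B A^-1 B^-1 = l I; the value is
   irrelevant when [A] and [B] do not commute. *)
Definition mform x y : int :=
  xget 1 [set l : int | (l = 1 \/ l = -1) /\
    forall A B : Sp R n, pi_Sp A = x -> pi_Sp B = y ->
      spval (A * B * A^-1 * B^-1)%g = (l%:~R)%:M].

Definition kerm F : set G := [set x | F x /\ forall y, F y -> mform x y = 1].

Definition kcoset F x : set G := [set (x * z)%g | z in kerm F].

(* F / ker m *)
Definition quo_kerm F : set (set G) := [set kcoset F x | x in F].

(* F / ker m has an F_2-basis of r elements. *)
Definition rank_quo F (r : nat) : Prop :=
  exists b : 'I_r -> G, (forall i, F (b i)) /\
    forall x, F x -> exists! e : {ffun 'I_r -> 'F_2},
      kcoset F x = kcoset F (\big[*%g/1%g]_(i < r) (b i ^+ e i)%g).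

Definition half_rank F (k : nat) : Prop := rank_quo F (2 * k).

Definition BF F : set G :=
  [set x | kerm F x /\ forall A : Sp R n, pi_Sp A = x -> (A * A = 1)%g].

(* The V_i: the nonzero spaces of vectors on which every A in pi^-1(B_F) acts
   by a given sign (-1) ^ chi A. *)
Definition eigenspaces F : set (set 'cV[quat R]_n) :=
  [set W | (exists chi : Sp R n -> bool,
      W = [set v | forall A : Sp R n, BF F (pi_Sp A) ->
                     spval A *m v = (-1) ^+ chi A *: v]) /\
    exists v, W v /\ v != 0].

(* The V_i with 1 <= i <= s_0; there are none for k = 0. *)
Definition small_eigenspaces (k : nat) F : set (set 'cV[quat R]_n) :=
  [set W | [/\ eigenspaces F W, (0 < k)%N
             & has_dim (@qscale R n) W (2 ^ k.-1)]].

(* For W = V_i, this is mu_i. *)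
Definition mu W x : int :=
  xget 1 [set l : int | (l = 1 \/ l = -1) /\
    forall A : Sp R n, pi_Sp A = x -> forall v, W v ->
      spval A *m (spval A *m v) = l%:~R *: v].

(* Conjugating B_F by [a] moves the V_i by a.  The indices i of the mu_i are
   those of the V_i, so that the matching of the mu_i has to be this one: with
   a permutation of the mu_i unrelated to B_F, the data would not determine F
   (two copies of one form and four of another, say, can be distributed in
   inequivalent ways over six V_i satisfying one relation of length four). *)
Definition translate (a : Sp R n) W : set 'cV[quat R]_n :=
  [set spval a *m v | v in W].

(* Isomorphism of multi-symplectic metric spaces
   (F / ker m, m, mu_1, ..., mu_s0) -> (F' / ker m', m', mu'_1, ..., mu'_s0):
   f is a linear isomorphism, and the bijection sigma between the index sets,
   which are here the sets of the V_i (i <= s_0) and of the V'_i (i <= s_0),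
   is the permutation of the mu_i.  Linear maps of F_2-spaces are morphisms of
   groups; m and mu_i are evaluated on representatives of the cosets. *)
Definition multi_symplectic_iso (k : nat) F F'
    (f : set G -> set G) (sigma : set 'cV[quat R]_n -> set 'cV[quat R]_n) :
    Prop :=
  [/\ set_bij (quo_kerm F) (quo_kerm F') f,
      set_bij (small_eigenspaces k F) (small_eigenspaces k F') sigma,
      (forall x y x' y', F x -> F y -> F' x' -> F' y' ->
         f (kcoset F x) = kcoset F' x' -> f (kcoset F y) = kcoset F' y' ->
         f (kcoset F (x * y)%g) = kcoset F' (x' * y')%g /\
         mform x' y' = mform x y)
    & (forall W x x', small_eigenspaces k F W -> F x -> F' x' ->
         f (kcoset F x) = kcoset F' x' -> mu (sigma W) x' = mu W x)].

End Invariants.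

(* Main.v *)
Require Import Defs.
From HB Require Import structures.
From mathcomp Require Import all_boot all_order all_algebra ring lra.
From mathcomp Require Import all_classical all_reals all_analysis.
From mathcomp Require Import complex spectral.

(** Let K be the preimage of F in Sp(n), as a set of quaternionic matrices, and C
    its commutant in M_n(H). The condition on dimensions says that every skew
    element of C generates a one-parameter group inside K (preim_thick). Such
    elements are therefore central in C, and a trace argument extends this to
    Hermitian ones: C is commutative (commutant_commute). By the spectral theorem
    C is a product of copies of the fields of real and of complex numbers, with
    minimal projections p_i and imaginary units J_i (frame_exists); p_i H^n is
    called a block, real if J_i = 0 and complex otherwise.

    The centre of K consists of the products of an involution, that is a lift of
    an element of B_F, and of a rotation exp(sum_i th_i J_i), all rotations being
    allowed (centre_split). So K is known once the involutions, the J_i and lifts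
    b_l of a basis of F / ker m are.

    The main tool replaces a nonzero matrix Y between two blocks by Y + b' Y b^-1
    or Y - b' Y b^-1, one generator at a time, until it intertwines the actions
    of all the generators up to signs (sign_intertwiner); signs are then removed
    by a factor in K, since the nondegenerate form m realizes all of them. Applied
    to K alone, it shows that the involutions separate the blocks
    (block_separation), which are thus the V_i (eigenspacesE), and that K spans
    the endomorphisms of a real block. Hence a real block has dimension 2^(k-1),
    and a complex one is larger (real_block_dim, complex_block_dim): the small
    V_i are the real blocks.

    Given F and F', conjugation by a matches their blocks (block_transport), and f
    matches bases with the same commutation signs. The squares of the b_l on real
    blocks are the mu_i; on complex blocks they become 1 after correction of the
    b_l by rotations (normalize_generators). Starting from the restriction of a to
    a block, the averaging yields an intertwiner T of the two actions on that
    block, where T^* T is scalar because it lies in C, so that T is unitary up to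
    a factor (block_intertwiner). The sum of these over the blocks conjugates
    generators, involutions and rotations (conjugating_unitary), hence F to F'. *)

Set Implicit Arguments.
Unset Strict Implicit.
Unset Printing Implicit Defensive.

Import Order.TTheory GRing.Theory Num.Theory.
Import numFieldNormedType.Exports.

Local Open Scope classical_set_scope.
Local Open Scope ring_scope.

(** * Real scalars, adjoint and real trace on quaternionic matrices *)

Lemma ord4P (c : 'I_4) : [\/ c = 0, c = 1, c = 2%:R | c = 3%:R].
Proof.
case: c => [[|[|[|[|//]]]] cP];
[constructor 1|constructor 2|constructor 3|constructor 4]; exact: val_inj.
Qed.

Section RealScalars.
Variable R : realType.
Local Notation H := (quat R).
Implicit Types (p q : H) (s t : R).

(** Matrices over H form a left module over the noncommutative ring H; scaling by
    the central element rq t is the multiplication by the real number t, and it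
    commutes with products on both sides. *)
Definition rq t : H := mkquat t 0 0 0.

Let qsimp := (mkquatE, quatDE, quatZE, quat0E, quat1E).

Lemma rq_is_additive : {morph rq : s t / s - t}.
Proof.
move=> s t; apply/quatP; rewrite /rq;
by rewrite /qre /qi /qj /qk !mxE /= ?subr0.
Qed.
HB.instance Definition _ := GRing.isZmodMorphism.Build R H rq rq_is_additive.

Lemma rq_is_multiplicative : monoid_morphism rq.
Proof.
split=> [|s t]; first by apply/quatP; rewrite /rq !qsimp.
by apply/quatP; rewrite quatME /qmul /rq !qsimp; ring.
Qed.
HB.instance Definition _ := GRing.isMonoidMorphism.Build R H rq rq_is_multiplicative.

Lemma rqC t q : rq t * q = q * rq t.
Proof. by apply/quatP; rewrite !quatME /qmul /rq !qsimp; ring. Qed.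

Lemma rqZ t q : t *: q = rq t * q.
Proof. by apply/quatP; rewrite !quatME /qmul /rq !qsimp; ring. Qed.

Lemma qre_rqM t q : qre (rq t * q) = t * qre q.
Proof. by rewrite -rqZ !quatZE. Qed.

Lemma qreC p q : qre (p * q) = qre (q * p).
Proof. by rewrite !quatME /qmul !qsimp; ring. Qed.

Lemma qre_conj q : qre (qconj q) = qre q.
Proof. by rewrite /qconj !qsimp. Qed.

Lemma qconj_rq t : qconj (rq t) = rq t.
Proof. by apply/quatP; rewrite /qconj /rq !qsimp ?oppr0. Qed.

Definition qnormsq q : R := qre q ^+ 2 + qi q ^+ 2 + qj q ^+ 2 + qk q ^+ 2.

Lemma qmul_conj q : q * qconj q = rq (qnormsq q).
Proof. by apply/quatP; rewrite !quatME /qmul /qconj /rq /qnormsq !qsimp; ring. Qed.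

Lemma qnormsq_ge0 q : 0 <= qnormsq q.
Proof. by rewrite /qnormsq !addr_ge0 ?sqr_ge0. Qed.

Lemma qnormsq_eq0 q : (qnormsq q == 0) = (q == 0).
Proof.
apply/idP/eqP => [|->]; last by rewrite /qnormsq !qsimp expr0n /= !addr0.
rewrite /qnormsq !paddr_eq0 ?addr_ge0 ?sqr_ge0 // !sqrf_eq0.
by move=> /andP[/andP[/andP[/eqP a /eqP b] /eqP c] /eqP d]; apply/quatP; rewrite !qsimp.
Qed.

Lemma qmul_eq0 p q : p * q = 0 -> p = 0 \/ q = 0.
Proof.
move=> pq0; have [->|p0] := eqVneq p 0; [by left | right].
have: qconj p * (p * q) = 0 by rewrite pq0 mulr0.
have -> : qconj p * (p * q) = rq (qnormsq p) * q.
  rewrite mulrA; congr (_ * _).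
  by apply/quatP; rewrite !quatME /qmul /qconj /rq /qnormsq !qsimp; ring.
move=> /(congr1 (GRing.mul (rq (qnormsq p)^-1))).
by rewrite mulr0 mulrA -rmorphM /= mulVf ?qnormsq_eq0 // rmorph1 mul1r.
Qed.

End RealScalars.

Section AdjointTrace.
Variable R : realType.
Local Notation H := (quat R).

Lemma rscaleE m n t (X : 'M[H]_(m, n)) : rscale t X = rq t *: X.
Proof. by apply/matrixP => i j; rewrite !mxE rqZ. Qed.

Lemma rqmxAr m n p t (A : 'M[H]_(m, n)) (B : 'M[H]_(n, p)) :
  A *m (rq t *: B) = rq t *: (A *m B).
Proof.
apply/matrixP => i j; rewrite !mxE mulr_sumr; apply: eq_bigr => k _.
by rewrite !mxE !mulrA rqC.
Qed.

Lemma signmxAr m n p (b : bool) (A : 'M[H]_(m, n)) (B : 'M[H]_(n, p)) :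
  A *m ((-1) ^+ b *: B) = (-1) ^+ b *: (A *m B).
Proof. by case: b; rewrite /= ?expr0 ?expr1 !(scale1r, scaleN1r) ?mulmxN. Qed.

Lemma qadj_is_additive m n : {morph @qadj R m n : X Y / X - Y}.
Proof.
move=> X Y; apply/matrixP => i j; rewrite !mxE.
by apply/quatP; rewrite /qconj !(mkquatE, quatDE) /qre /qi /qj /qk !mxE /= ?opprD ?opprK.
Qed.
HB.instance Definition _ m n := GRing.isZmodMorphism.Build
  'M[H]_(m, n) 'M[H]_(n, m) (@qadj R m n) (@qadj_is_additive m n).

Lemma qadjZ m n t (X : 'M[H]_(m, n)) : qadj (rq t *: X) = rq t *: qadj X.
Proof. by apply/matrixP => i j; rewrite !mxE qconjM qconj_rq rqC. Qed.

Lemma qadj_sign m n (b : bool) (X : 'M[H]_(m, n)) :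
  qadj ((-1) ^+ b *: X) = (-1) ^+ b *: qadj X.
Proof. by case: b; rewrite /= ?expr0 ?expr1 !(scale1r, scaleN1r) ?raddfN. Qed.

(** tau (X *m qadj Y) is the Euclidean inner product of X and Y. *)
Definition tau n (X : 'M[H]_n) : R := qre (\tr X).

Lemma qre_is_additive : {morph (@qre R) : p q / p - q}.
Proof. by move=> p q; rewrite /qre !mxE. Qed.
HB.instance Definition _ := GRing.isZmodMorphism.Build H R (@qre R) qre_is_additive.

Lemma tau_is_additive n : {morph @tau n : X Y / X - Y}.
Proof. by move=> X Y; rewrite /tau linearB raddfB. Qed.
HB.instance Definition _ n :=
  GRing.isZmodMorphism.Build 'M[H]_n R (@tau n) (@tau_is_additive n).

Lemma tauZ n t (X : 'M[H]_n) : tau (rq t *: X) = t * tau X.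
Proof. by rewrite /tau linearZ /= qre_rqM. Qed.

Lemma tau_sign n (b : bool) (X : 'M[H]_n) : tau ((-1) ^+ b *: X) = (-1) ^+ b * tau X.
Proof. by case: b; rewrite /= ?expr0 ?expr1 !(scale1r, mul1r, scaleN1r, mulN1r) ?raddfN. Qed.

(** Only the real part of the quaternionic trace is invariant under cyclic
    permutations. *)
Lemma tauC m n (A : 'M[H]_(m, n)) (B : 'M[H]_(n, m)) : tau (A *m B) = tau (B *m A).
Proof.
rewrite /tau /mxtrace !raddf_sum /=.
under eq_bigr do rewrite mxE raddf_sum /=.
under [RHS]eq_bigr do rewrite mxE raddf_sum /=.
rewrite exchange_big /=; apply: eq_bigr => i _; apply: eq_bigr => j _.
exact: qreC.
Qed.

Lemma tau_adj n (X : 'M[H]_n) : tau (qadj X) = tau X.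
Proof.
rewrite /tau /mxtrace !raddf_sum /=; apply: eq_bigr => i _.
by rewrite !mxE qre_conj.
Qed.

Lemma tau1 n : tau (1%:M : 'M[H]_n) = n%:R.
Proof. by rewrite /tau mxtrace1 raddfMn /= quat1E. Qed.

Lemma tau_mul_adj m n (X : 'M[H]_(m, n)) :
  tau (X *m qadj X) = \sum_i \sum_j qnormsq (X i j).
Proof.
rewrite /tau /mxtrace raddf_sum /=; apply: eq_bigr => i _.
rewrite mxE raddf_sum /=; apply: eq_bigr => j _.
by rewrite !mxE qmul_conj /rq mkquatE.
Qed.

Lemma tau_ge0 m n (X : 'M[H]_(m, n)) : 0 <= tau (X *m qadj X).
Proof.
by rewrite tau_mul_adj; do 2!apply: sumr_ge0 => ? _; exact: qnormsq_ge0.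
Qed.

Lemma tau_eq0 m n (X : 'M[H]_(m, n)) : tau (X *m qadj X) = 0 -> X = 0.
Proof.
rewrite tau_mul_adj => /eqP; rewrite psumr_eq0; last first.
  by move=> i _; apply: sumr_ge0 => j _; exact: qnormsq_ge0.
move=> /allP X0; apply/matrixP => i j; rewrite mxE.
have := X0 i (mem_index_enum _); rewrite psumr_eq0; last by move=> ? _; exact: qnormsq_ge0.
by move=> /allP/(_ j (mem_index_enum _)) /=; rewrite qnormsq_eq0 => /eqP.
Qed.

Lemma mul_adj_eq0 m n (X : 'M[H]_(m, n)) : X *m qadj X = 0 -> X = 0.
Proof. by move=> XX; apply: tau_eq0; rewrite XX raddf0. Qed.

Lemma qmx_double_eq0 m n (X : 'M[H]_(m, n)) : X + X = 0 -> X = 0.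
Proof.
move=> XX; have := congr1 (fun Y => rq 2^-1 *: Y) XX.
rewrite scaler0 scalerDr -scalerDl -rmorphD.
by rewrite (_ : 2^-1 + 2^-1 = 1 :> R) ?rmorph1 ?scale1r //; field.
Qed.

End AdjointTrace.

(** * The exponential of quaternionic matrices *)

Section Coordinates.
Variables (R : realType) (n : nat).
Local Notation H := (quat R).
Local Notation M := 'M[H]_n.

Definition qcoord (i j : 'I_n) (c : 'I_4) (X : M) : R := (X i j : 'rV[R]_4) 0 c.

Lemma qcoord_is_additive i j c : {morph qcoord i j c : X Y / X - Y}.
Proof. by move=> X Y; rewrite /qcoord !mxE. Qed.
HB.instance Definition _ i j c :=
  GRing.isZmodMorphism.Build M R (qcoord i j c) (qcoord_is_additive i j c).

Lemma qcoordZ i j c t X : qcoord i j c (rq t *: X) = t * qcoord i j c X.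
Proof. by rewrite /qcoord mxE -rqZ mxE. Qed.

Lemma qcoord_inj (X Y : M) : (forall i j c, qcoord i j c X = qcoord i j c Y) -> X = Y.
Proof. by move=> XY; apply/matrixP => i j; apply/rowP => c; exact: XY. Qed.

Lemma continuous_qcoord i j c : continuous (qcoord i j c).
Proof.
move=> /= X s /= /(nbhs_ballP (qcoord i j c X)) [e e0 es].
by apply/nbhs_ballP; exists e => //= N [_ /(_ i j) [_ MN]]; exact/es/MN.
Qed.

Lemma cvg_qcoord (u : nat -> M) (L : M) :
  (forall i j c, (qcoord i j c (u k) @[k --> \oo] --> qcoord i j c L)) ->
  u @ \oo --> L.
Proof.
move=> uL; apply/cvg_ballP => e e0.
have : \forall k \near \oo, forall x : ('I_n * 'I_n) * 'I_4,
    ball (qcoord x.1.1 x.1.2 x.2 L) e (qcoord x.1.1 x.1.2 x.2 (u k)).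
  apply: filter_forall => -[[i j] c] /=.
  by have /cvg_ballP := uL i j c; apply.
apply: filterS => k ue; split=> // i j; split=> // r c.
by rewrite (ord1 r); exact: (ue ((i, j), c)).
Qed.

Lemma qmx_hausdorff : hausdorff_space M.
Proof.
move=> p q pq; apply: qcoord_inj => i j c; apply: (@Rhausdorff R) => A B Ap Bq.
have [X [XA XB]] := pq _ _ (continuous_qcoord Ap) (continuous_qcoord Bq).
by exists (qcoord i j c X).
Qed.

Definition exp_term (X : M) (k : nat) : M := rscale (k`!%:R^-1) (X ^+ k).

Lemma mxexp_lim (X L : M) :
  (forall i j c, series (fun k => qcoord i j c (exp_term X k)) @ \oo --> qcoord i j c L) ->
  mxexp X = L.
Proof.
move=> XL; apply: (cvg_lim qmx_hausdorff); apply: cvg_qcoord => i j c.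
suff -> : (fun k => qcoord i j c (series (exp_term X) k)) =
          series (fun k => qcoord i j c (exp_term X k)) by exact: XL.
by apply/funext => k; rewrite /series /= raddf_sum.
Qed.

End Coordinates.

Section Rotation.
Variables (R : realType) (n : nat).
Local Notation H := (quat R).
Local Notation M := 'M[H]_n.
Variables (s : nat) (J : 'I_s -> M).

(** The exponential of sum_i th_i J_i when the J_i are complex structures of
    mutually orthogonal subspaces. *)
Definition rotation (th : 'I_s -> R) : M :=
  1%:M + \sum_i (rq (sin (th i)) *: J i + rq (1 - cos (th i)) *: (J i *m J i)).

Hypothesis J_orth : forall i j, i != j -> J i *m J j = 0.
Hypothesis J_cube : forall i, J i *m J i *m J i = - J i.

Lemma J_pow i k : J i ^+ k.+1 =
  if odd k then (-1) ^+ k./2 *: (J i *m J i) else (-1) ^+ k./2 *: J i.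
Proof.
elim: k => [|k IH]; first by rewrite expr1 /= scale1r.
rewrite exprSr IH -mulmxE /= uphalf_half; case: (odd k) => /=.
  by rewrite -scalemxAl J_cube add1n exprSr scalerN -scaleNr mulrN1.
by rewrite -scalemxAl.
Qed.

Lemma sum_J_pow th k : (\sum_i rq (th i) *: J i) ^+ k.+1 =
  \sum_i rq (th i ^+ k.+1) *: J i ^+ k.+1.
Proof.
elim: k => [|k IH]; first by rewrite expr1.
rewrite exprS IH -mulmxE [LHS]mulmx_suml; apply: eq_bigr => i _.
rewrite mulmx_sumr (bigD1 i) //= big1 ?addr0 => [|j ji].
  by rewrite -scalemxAl rqmxAr scalerA -rmorphM mulmxE -!exprS.
by rewrite -scalemxAl rqmxAr [J _ ^+ _]exprS -mulmxE mulmxA J_orth ?mul0mx ?scaler0 1?eq_sym.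
Qed.

(** Powers of the sum reduce to J_i and J_i^2 with alternating signs, so that the
    exponential series splits into the sine and cosine series. *)
Lemma exp_rotation th : mxexp (\sum_i rq (th i) *: J i) = rotation th.
Proof.
apply: mxexp_lim => a b c.
have termE k : qcoord a b c (exp_term (\sum_i rq (th i) *: J i) k) =
   (k == 0)%:R * qcoord a b c 1%:M +
   \sum_i (sin_coeff (th i) k * qcoord a b c (J i) +
           ((k == 0)%:R - cos_coeff (th i) k) * qcoord a b c (J i *m J i)).
  rewrite /exp_term rscaleE; case: k => [|k].
    rewrite expr0 fact0 invr1 rmorph1 scale1r mul1r big1 ?addr0 // => i _.
    by rewrite sin_coeffE cos_coeffE /= expr0 !mul0r add0r expr0 fact0 invr1 !mulr1 subrr mul0r.
  rewrite /= mul0r add0r sum_J_pow scaler_sumr raddf_sum /=; apply: eq_bigr => i _.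
  rewrite scalerA -rmorphM qcoordZ J_pow sin_coeffE cos_coeffE /= negbK sub0r.
  have sE m : (-1) ^+ m = rq ((-1) ^+ m) :> H by rewrite rmorphXn /= rmorphN1.
  rewrite !sE; case: (boolP (odd k)) => k_odd /=; rewrite qcoordZ ?uphalf_half ?k_odd ?add1n;
    move: (_^-1) (th i ^+ k.+1) => u v; rewrite ?[(-1) ^+ _.+1]exprS;
    by move: ((-1) ^+ k./2) => w; ring.
rewrite (eq_fun termE).
have -> : series (fun k => (k == 0)%:R * qcoord a b c 1%:M +
   \sum_i (sin_coeff (th i) k * qcoord a b c (J i) +
           ((k == 0)%:R - cos_coeff (th i) k) * qcoord a b c (J i *m J i))) =
  (fun N => (series (fun k => (k == 0)%:R) N) * qcoord a b c 1%:M +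
   \sum_i (series (sin_coeff (th i)) N * qcoord a b c (J i) +
     (series (fun k => (k == 0)%:R) N - series (cos_coeff (th i)) N) * qcoord a b c (J i *m J i))).
  apply/funext => N; rewrite /series /= big_split /= -mulr_suml; congr (_ + _).
  rewrite exchange_big /=; apply: eq_bigr => i _.
  by rewrite big_split /= -!mulr_suml sumrB.
have cvg1 : series (fun k => (k == 0)%:R : R) @ \oo --> (1 : R).
  rewrite -(cvg_shiftn 1) /=; apply: cvg_near_cst; apply: nearW => N.
  by rewrite /series /= addn1 big_nat_recl //= big1 ?addr0.
rewrite /rotation raddfD raddf_sum /=; apply: cvgD.
  by rewrite -[X in _ --> X]mul1r; apply: cvgM => //; exact: cvg_cst.
apply: cvg_big => [|i _]; first exact: add_continuous.
 rewrite raddfD /= !qcoordZ; apply: cvgD.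
  apply: cvgM; last exact: cvg_cst.
  by rewrite sin.unlock; exact: is_cvg_series_sin_coeff.
apply: cvgM; last exact: cvg_cst.
by apply: cvgB => //; rewrite cos.unlock; exact: is_cvg_series_cos_coeff.
Qed.

End Rotation.

Section ExponentialGrowth.
Variables (R : realType) (n : nat).
Local Notation H := (quat R).
Local Notation M := 'M[H]_n.

Definition qnorm1 (q : H) : R := `|qre q| + `|qi q| + `|qj q| + `|qk q|.

(** Any submultiplicative norm would do; this one needs no inequality of
    Cauchy-Schwarz type. *)
Definition mxnorm1 (X : M) : R := \sum_i \sum_j qnorm1 (X i j).

Lemma qnorm1_ge0 q : 0 <= qnorm1 q.
Proof. by rewrite /qnorm1 !addr_ge0. Qed.

Lemma qnorm1D p q : qnorm1 (p + q) <= qnorm1 p + qnorm1 q.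
Proof.
rewrite /qnorm1 !quatDE.
have := ler_normD (qre p) (qre q); have := ler_normD (qi p) (qi q).
have := ler_normD (qj p) (qj q); have := ler_normD (qk p) (qk q).
lra.
Qed.

Lemma qnorm1M p q : qnorm1 (p * q) <= qnorm1 p * qnorm1 q.
Proof.
have n4 (x y z w : R) : `|x + y + z + w| <= `|x| + `|y| + `|z| + `|w|.
  apply: (le_trans (ler_normD _ _)); rewrite lerD2r.
  by apply: (le_trans (ler_normD _ _)); rewrite lerD2r; exact: ler_normD.
rewrite /qnorm1 quatME /qmul !mkquatE.
have := n4 (qre p * qre q) (- (qi p * qi q)) (- (qj p * qj q)) (- (qk p * qk q)).
have := n4 (qre p * qi q) (qi p * qre q) (qj p * qk q) (- (qk p * qj q)).
have := n4 (qre p * qj q) (- (qi p * qk q)) (qj p * qre q) (qk p * qi q).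
have := n4 (qre p * qk q) (qi p * qj q) (- (qj p * qi q)) (qk p * qre q).
rewrite !normrN !normrM => h1 h2 h3 h4.
apply: (le_trans (lerD (lerD (lerD h4 h3) h2) h1)).
by rewrite le_eqVlt; apply/orP; left; apply/eqP; ring.
Qed.

Lemma qnorm1_sum (I : finType) (f : I -> H) : qnorm1 (\sum_i f i) <= \sum_i qnorm1 (f i).
Proof.
elim/big_ind2: _ => [|x a y b xa yb|//]; first by rewrite /qnorm1 !quat0E normr0 !addr0.
by apply: (le_trans (qnorm1D _ _)); exact: lerD.
Qed.

Lemma mxnorm1_ge0 X : 0 <= mxnorm1 X.
Proof. by do 2!apply: sumr_ge0 => ? _; exact: qnorm1_ge0. Qed.

Lemma mxnorm1_eq0 X : mxnorm1 X = 0 -> X = 0.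
Proof.
move=> /eqP; rewrite psumr_eq0 => [|i _]; last by apply: sumr_ge0 => j _; exact: qnorm1_ge0.
move=> /allP X0; apply/matrixP => i j; rewrite mxE.
have := X0 i (mem_index_enum _); rewrite psumr_eq0 => [|? _]; last exact: qnorm1_ge0.
move=> /allP/(_ j (mem_index_enum _)) /=.
rewrite /qnorm1 !paddr_eq0 ?addr_ge0 // !normr_eq0.
by move=> /andP[/andP[/andP[/eqP a /eqP b] /eqP c] /eqP d]; apply/quatP; rewrite !quat0E.
Qed.

Lemma mxnorm1D X Y : mxnorm1 (X + Y) <= mxnorm1 X + mxnorm1 Y.
Proof.
rewrite /mxnorm1 -big_split /=; apply: ler_sum => i _.
by rewrite -big_split /=; apply: ler_sum => j _; rewrite mxE; exact: qnorm1D.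
Qed.

Lemma mxnorm1N X : mxnorm1 (- X) = mxnorm1 X.
Proof.
apply: eq_bigr => i _; apply: eq_bigr => j _.
by rewrite mxE /qnorm1 /qre /qi /qj /qk !mxE !normrN.
Qed.

Lemma mxnorm1Z t X : mxnorm1 (rq t *: X) = `|t| * mxnorm1 X.
Proof.
rewrite /mxnorm1 mulr_sumr; apply: eq_bigr => i _; rewrite mulr_sumr; apply: eq_bigr => j _.
by rewrite mxE -rqZ /qnorm1 !quatZE !normrM !mulrDr.
Qed.

Lemma mxnorm1M X Y : mxnorm1 (X *m Y) <= mxnorm1 X * mxnorm1 Y.
Proof.
have step i j : qnorm1 ((X *m Y) i j) <= \sum_k qnorm1 (X i k) * qnorm1 (Y k j).
  rewrite mxE; apply: (le_trans (qnorm1_sum _)); apply: ler_sum => k _; exact: qnorm1M.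
apply: (@le_trans _ _ (\sum_i \sum_j \sum_k qnorm1 (X i k) * qnorm1 (Y k j))).
  by apply: ler_sum => i _; apply: ler_sum => j _.
rewrite /mxnorm1 mulr_suml; apply: ler_sum => i _.
rewrite exchange_big mulr_suml /=; apply: ler_sum => k _.
rewrite -mulr_sumr; apply: ler_wpM2l; first exact: qnorm1_ge0.
rewrite [leRHS](bigD1 k) //= lerDl.
by do 2!apply: sumr_ge0 => ? _; exact: qnorm1_ge0.
Qed.

Lemma qcoord_le_qnorm1 i j c (X : M) : `|qcoord i j c X| <= qnorm1 (X i j).
Proof.
rewrite /qcoord /qnorm1 /qre /qi /qj /qk.
have n0 k : 0 <= `|(X i j : 'rV[R]_4) 0 k| by [].
move: (n0 0) (n0 1) (n0 2%:R) (n0 3%:R).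
by case: (ord4P c) => ->; lra.
Qed.

Lemma qcoord_le_mxnorm1 i j c (X : M) : `|qcoord i j c X| <= mxnorm1 X.
Proof.
apply: (le_trans (qcoord_le_qnorm1 _ _ _ _)).
apply: (@le_trans _ _ (\sum_j qnorm1 (X i j))).
  by rewrite (bigD1 j) //= lerDl; apply: sumr_ge0 => ? _; exact: qnorm1_ge0.
rewrite /mxnorm1 [leRHS](bigD1 i) //= lerDl.
by do 2!apply: sumr_ge0 => ? _; exact: qnorm1_ge0.
Qed.

Lemma mxnorm1_le_qcoord (X : M) (e : R) :
  (forall i j c, `|qcoord i j c X| <= e) -> mxnorm1 X <= (n * (n * 4))%:R * e.
Proof.
move=> Xe; rewrite natrM -mulrA mulr_natl.
have -> : (n * 4)%:R * e *+ n = \sum_(i < n) (n * 4)%:R * e by rewrite sumr_const card_ord.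
apply: ler_sum => i _; rewrite natrM -mulrA mulr_natl.
have -> : 4%:R * e *+ n = \sum_(i < n) 4%:R * e by rewrite sumr_const card_ord.
apply: ler_sum => j _; rewrite /qnorm1.
by move: (Xe i j 0) (Xe i j 1) (Xe i j 2%:R) (Xe i j 3%:R); rewrite /qcoord /qre /qi /qj /qk; lra.
Qed.

Lemma qcoord_pow_le i j c (X : M) k : `|qcoord i j c (X ^+ k)| <= mxnorm1 X ^+ k.
Proof.
case: k => [|k]; last first.
  apply: (le_trans (qcoord_le_mxnorm1 _ _ _ _)).
  elim: k => [|k IH]; first by rewrite !expr1.
  rewrite exprS [_ ^+ k.+2]exprS; apply: (le_trans (mxnorm1M _ _)).
  by rewrite ler_wpM2l ?mxnorm1_ge0.
rewrite !expr0; apply: (le_trans (qcoord_le_qnorm1 _ _ _ _)); rewrite mxE.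
by case: eqP => _; rewrite /qnorm1 !(quat1E, quat0E) ?normr1 ?normr0 !addr0 ?ler01.
Qed.

Lemma exp_term_le i j c (X : M) k : `|qcoord i j c (exp_term X k)| <= exp_coeff (mxnorm1 X) k.
Proof.
rewrite /exp_term rscaleE qcoordZ normrM ger0_norm ?invr_ge0 // /exp_coeff /= mulrC.
by rewrite ler_wpM2r ?invr_ge0 // qcoord_pow_le.
Qed.

Lemma is_cvg_exp_term i j c (X : M) :
  cvgn (series (fun k => qcoord i j c (exp_term X k))).
Proof.
apply: normed_cvg; apply: (@series_le_cvg _ _ (exp_coeff (mxnorm1 X))).
- by move=> k; exact: normr_ge0.
- by move=> k; rewrite /exp_coeff /= mulr_ge0 // exprn_ge0 ?mxnorm1_ge0.
- by move=> k; exact: exp_term_le.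
- exact: is_cvg_series_exp_coeff.
Qed.

Lemma qcoord_mxexp i j c (X : M) :
  series (fun k => qcoord i j c (exp_term X k)) @ \oo --> qcoord i j c (mxexp X).
Proof.
pose L : M := \matrix_(i, j) \row_c limn (series (fun k => qcoord i j c (exp_term X k))).
have XL : mxexp X = L.
  apply: mxexp_lim => a b d; rewrite /L /qcoord !mxE; exact: is_cvg_exp_term.
by rewrite XL {2}/qcoord !mxE; exact: is_cvg_exp_term.
Qed.

Lemma power_series_tail (e : nat -> R) (b t : R) (m : nat) :
  0 <= b -> 0 <= t <= 1 -> (forall k, `|e k| <= exp_coeff b k) ->
  `|\sum_(0 <= k < m.+2) t ^+ k * e k - (e 0%N + t * e 1%N)| <= expR b * t ^+ 2.
Proof.
move=> b0 /andP[t0 t1] eb.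
have e0 k : 0 <= exp_coeff b k by rewrite /exp_coeff /= mulr_ge0 // exprn_ge0.
rewrite big_nat_recl // big_nat_recl // expr0 mul1r expr1 [X in X - _]addrA [X in `|X|]addrC addKr.
apply: (le_trans (ler_norm_sum _ _ _)).
apply: (@le_trans _ _ (\sum_(0 <= k < m) t ^+ 2 * exp_coeff b k.+2)).
  apply: ler_sum => k _; rewrite normrM; apply: ler_pM => //.
  by rewrite ger0_norm ?exprn_ge0 // -addn2 exprD ler_piMl ?exprn_ge0 // exprn_ile1.
rewrite -mulr_sumr mulrC ler_wpM2r ?exprn_ge0 //.
apply: (@le_trans _ _ (series (exp_coeff b) m.+2)).
  by rewrite seriesEnat /= big_nat_recl // big_nat_recl // addrA lerDr addr_ge0.
apply: nondecreasing_cvgn_le; last exact: is_cvg_series_exp_coeff.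
by apply: nondecreasing_series => k _ _; exact: e0.
Qed.

Lemma expZ_pow (t : R) (X : M) k : (rq t *: X) ^+ k = rq (t ^+ k) *: X ^+ k.
Proof.
elim: k => [|k IH]; first by rewrite !expr0 rmorph1 scale1r.
by rewrite !exprS IH -!mulmxE -scalemxAl rqmxAr scalerA -rmorphM.
Qed.

Lemma qcoord_exp_termZ i j c t (X : M) k :
  qcoord i j c (exp_term (rscale t X) k) = t ^+ k * qcoord i j c (exp_term X k).
Proof.
by rewrite /exp_term !rscaleE !qcoordZ expZ_pow qcoordZ; move: (_^-1) => u; ring.
Qed.

(** All terms but the first two carry a factor t^2, and the other factors add up
    to at most the exponential of the norm. *)
Lemma mxexp_taylor (X : M) : exists2 C : R, 0 <= C &
  forall t, 0 <= t <= 1 -> mxnorm1 (mxexp (rscale t X) - (1%:M + rq t *: X)) <= C * t ^+ 2.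
Proof.
exists ((n * (n * 4))%:R * expR (mxnorm1 X)); first by rewrite mulr_ge0 ?expR_ge0.
move=> t t01; rewrite -mulrA; apply: mxnorm1_le_qcoord => i j c.
pose e k := qcoord i j c (exp_term X k).
have e0 : qcoord i j c 1%:M = e 0%N.
  by rewrite /e /exp_term rscaleE fact0 invr1 rmorph1 scale1r expr0.
have e1 : qcoord i j c X = e 1%N.
  by rewrite /e /exp_term rscaleE invr1 rmorph1 scale1r expr1.
have cvgS : series (fun k => t ^+ k * e k) @ \oo --> qcoord i j c (mxexp (rscale t X)).
  rewrite (_ : (fun k => t ^+ k * e k) = fun k => qcoord i j c (exp_term (rscale t X) k)).
    exact: qcoord_mxexp.
  by apply/funext => k; rewrite qcoord_exp_termZ.
rewrite raddfB raddfD /= qcoordZ e0 e1.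
have cvgA : (fun N => `|series (fun k => t ^+ k * e k) N - (e 0%N + t * e 1%N)|) @ \oo
   --> `|qcoord i j c (mxexp (rscale t X)) - (e 0%N + t * e 1%N)|.
  by apply: cvg_norm; apply: cvgB => //; exact: cvg_cst.
rewrite -(cvg_lim (@Rhausdorff R) cvgA); apply: limr_le.
  by apply/cvg_ex; eexists; exact: cvgA.
near=> N.
have -> : N = (N - 2).+2 by rewrite -addn2 subnK //; near: N; exact: nbhs_infty_ge.
rewrite seriesEnat /=; apply: power_series_tail => //; first exact: mxnorm1_ge0.
by move=> k; exact: exp_term_le.
Unshelve. all: by end_near. Qed.

(** A matrix that commutes up to sign with the one-parameter group of X
    commutes with it near the identity, by continuity, hence with X. *)
Lemma comm_mxexp (X A : M) : A != 0 ->
  (forall t, exists b : bool,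
     A *m mxexp (rscale t X) = (-1) ^+ b *: (mxexp (rscale t X) *m A)) ->
  A *m X = X *m A.
Proof.
move=> A0 AX; have [C C0 CX] := mxexp_taylor X.
apply/eqP; rewrite -subr_eq0; apply/negPn/negP => K0.
have mxnorm1_gt0 Y : Y != 0 -> 0 < mxnorm1 Y.
  by move=> Y0; rewrite lt_def mxnorm1_ge0 andbT; apply: contra Y0 => /eqP/mxnorm1_eq0 ->.
have a0 := mxnorm1_gt0 _ A0; have k0 := mxnorm1_gt0 _ K0.
set al := mxnorm1 A in a0; set de := mxnorm1 _ in k0.
pose D := mxnorm1 (A *m X + X *m A) + 2 * al * C.
pose D' := 2 * al * C.
have D0 : 0 <= D by rewrite addr_ge0 ?mxnorm1_ge0 // !mulr_ge0 // ltW.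
have D'0 : 0 <= D' by rewrite !mulr_ge0 // ltW.
pose t := Num.min 1 (Num.min (al / (D + 1)) (de / (D' + 1) / 2)).
have t0 : 0 < t by rewrite !lt_min ltr01 !divr_gt0 // ltr_wpDl.
have t1 : t <= 1 by rewrite ge_min lexx.
have tD : t * D < 2 * al.
  have: t <= al / (D + 1) by rewrite !ge_min lexx orbT.
  rewrite ler_pdivlMr ?ltr_wpDl //; nra.
have tD' : t * D' < de.
  have: t <= de / (D' + 1) / 2 by rewrite !ge_min lexx !orbT.
  rewrite ler_pdivlMr // ler_pdivlMr ?ltr_wpDl //; nra.
have t01 : 0 <= t <= 1 by rewrite (ltW t0).
have [b] := AX t; have := CX _ t01.
set E := mxexp _ => EC.
have [r rC ->] : exists2 r, mxnorm1 r <= C * t ^+ 2 & E = 1%:M + rq t *: X + r.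
  by exists (E - (1%:M + rq t *: X)); rewrite // addrC subrK.
rewrite !mulmxDr !mulmxDl mulmx1 mul1mx rqmxAr -scalemxAl.
have Ar : mxnorm1 (A *m r) <= al * (C * t ^+ 2).
  by apply: (le_trans (mxnorm1M _ _)); rewrite ler_wpM2l ?mxnorm1_ge0.
have rA : mxnorm1 (r *m A) <= al * (C * t ^+ 2).
  by apply: (le_trans (mxnorm1M _ _)); rewrite mulrC ler_wpM2l ?mxnorm1_ge0.
have ct : al * (C * t ^+ 2) <= t * (al * C).
  rewrite expr2 (_ : al * (C * (t * t)) = t * (al * C) * t); last by ring.
  by rewrite ler_piMr // !mulr_ge0 // ltW.
case: b; rewrite /= ?expr0 ?expr1 ?scale1r ?scaleN1r => eqE.
  have e2 : rq 2 *: A = - (rq t *: (A *m X + X *m A) + (A *m r + r *m A)).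
    have -> : rq 2 *: A = A + A by rewrite -[2]/(1 + 1) rmorphD rmorph1 scalerDl scale1r.
    have /eqP : (A + rq t *: (A *m X) + A *m r) + (A + rq t *: (X *m A) + r *m A) = 0.
      by rewrite eqE addNr.
    by rewrite addrACA [X in X + _]addrACA -addrA -scalerDr addr_eq0 => /eqP.
  have := congr1 mxnorm1 e2; rewrite mxnorm1N mxnorm1Z => e3.
  have := mxnorm1D (rq t *: (A *m X + X *m A)) (A *m r + r *m A).
  rewrite -e3 mxnorm1Z => h; have := mxnorm1D (A *m r) (r *m A).
  rewrite gtr0_norm // (gtr0_norm t0) -/al in h.
  by move: tD; rewrite /D mulrDr; lra.
have e2 : rq t *: (A *m X - X *m A) = r *m A - A *m r.
  rewrite scalerBr; apply/eqP; rewrite subr_eq addrAC eq_sym subr_eq; apply/eqP.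
  by move: eqE; rewrite -!addrA => /addrI ->; rewrite addrC.
have := congr1 mxnorm1 e2; rewrite mxnorm1Z gtr0_norm // -/de => e3.
have := mxnorm1D (r *m A) (- (A *m r)); rewrite -e3 mxnorm1N => h.
have : t * de <= t * (t * D').
  have -> : t * (t * D') = al * (C * t ^+ 2) + al * (C * t ^+ 2) by rewrite /D'; ring.
  lra.
by rewrite ler_pM2l // leNgt tD'.
Qed.

End ExponentialGrowth.

(** * Hermitian quaternionic matrices *)

Lemma mul_conjmx (K : fieldType) m (P D D' : 'M[K]_m) : P \in unitmx ->
  invmx P *m D *m P *m (invmx P *m D' *m P) = invmx P *m (D *m D') *m P.
Proof. by move=> Pu; rewrite !mulmxA (mulmxK Pu). Qed.

Section ComplexRepresentation.
Variable R : realType.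
Local Notation H := (quat R).
Local Notation C := (R[i]).

Definition qc1 (q : H) : C := Complex (qre q) (qi q).
Definition qc2 (q : H) : C := Complex (qj q) (qk q).

Let csimp := (mkquatE, quatDE, quat0E, quat1E).

Lemma complexP (x y : C) : complex.Re x = complex.Re y -> complex.Im x = complex.Im y -> x = y.
Proof. by case: x => a b; case: y => c d /= -> ->. Qed.

Lemma qc1_is_additive : {morph qc1 : p q / p - q}.
Proof. by move=> p q; apply: complexP; rewrite /qc1 /= /qre /qi !mxE. Qed.
HB.instance Definition _ := GRing.isZmodMorphism.Build H C qc1 qc1_is_additive.

Lemma qc2_is_additive : {morph qc2 : p q / p - q}.
Proof. by move=> p q; apply: complexP; rewrite /qc2 /= /qj /qk !mxE. Qed.
HB.instance Definition _ := GRing.isZmodMorphism.Build H C qc2 qc2_is_additive.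

Lemma qc1M p q : qc1 (p * q) = qc1 p * qc1 q - qc2 p * (qc2 q)^*.
Proof. by apply: complexP; rewrite quatME /qmul /qc1 /qc2 /= !csimp; ring. Qed.

Lemma qc2M p q : qc2 (p * q) = qc1 p * qc2 q + qc2 p * (qc1 q)^*.
Proof. by apply: complexP; rewrite quatME /qmul /qc1 /qc2 /= !csimp; ring. Qed.

Lemma qc1_conj q : qc1 (qconj q) = (qc1 q)^*.
Proof. by apply: complexP; rewrite /qconj /qc1 /= !csimp. Qed.

Lemma qc2_conj q : qc2 (qconj q) = - qc2 q.
Proof. by apply: complexP; rewrite /qconj /qc2 /= !csimp. Qed.

Variable n : nat.
Local Notation M := 'M[H]_n.

(** A quaternion is x + y j with x and y complex, and j x = x^* j. *)
Definition crep (X : M) : 'M[C]_(n + n) :=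
  block_mx (map_mx qc1 X) (map_mx qc2 X)
           (- map_mx Num.conj (map_mx qc2 X)) (map_mx Num.conj (map_mx qc1 X)).

Lemma crep_is_additive : {morph crep : X Y / X - Y}.
Proof.
move=> X Y; rewrite /crep opp_block_mx add_block_mx.
by congr block_mx; apply/matrixP => i j; rewrite !mxE ?raddfB //= ?rmorphB /= opprB addrC opprK.
Qed.
HB.instance Definition _ := GRing.isZmodMorphism.Build M 'M[C]_(n + n) crep crep_is_additive.

Lemma crepM X Y : crep (X *m Y) = crep X *m crep Y.
Proof.
have m1 : map_mx qc1 (X *m Y) = map_mx qc1 X *m map_mx qc1 Y
    - map_mx qc2 X *m map_mx Num.conj (map_mx qc2 Y).
  apply/matrixP => i j; rewrite !mxE raddf_sum -sumrB; apply: eq_bigr => k _.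
  by rewrite !mxE /= qc1M.
have m2 : map_mx qc2 (X *m Y) = map_mx qc1 X *m map_mx qc2 Y
    + map_mx qc2 X *m map_mx Num.conj (map_mx qc1 Y).
  apply/matrixP => i j; rewrite !mxE raddf_sum -big_split; apply: eq_bigr => k _.
  by rewrite !mxE /= qc2M.
have cK m (A : 'M[C]_m) : map_mx Num.conj (map_mx Num.conj A) = A.
  by apply/matrixP => i j; rewrite !mxE conjCK.
rewrite /crep mulmx_block m1 m2.
move: (map_mx qc1 X) (map_mx qc2 X) (map_mx qc1 Y) (map_mx qc2 Y) => x1 x2 y1 y2.
rewrite !mulmxN !mulNmx map_mxD map_mxB !map_mxM /= !cK opprD.
by congr (block_mx _ _ _ _); exact: addrC.
Qed.

Lemma crep1 : crep 1%:M = 1%:M.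
Proof.
have m1 : map_mx qc1 (1%:M : M) = 1%:M.
  apply/matrixP => i j; rewrite !mxE; case: eqP => _;
  by apply: complexP; rewrite /qc1 /= !csimp.
have m2 : map_mx qc2 (1%:M : M) = 0.
  apply/matrixP => i j; rewrite !mxE; case: eqP => _;
  by apply: complexP; rewrite /qc2 /= !csimp.
by rewrite /crep m1 m2 map_mx1 map_mx0 oppr0 -scalar_mx_block.
Qed.

Lemma crepZ t X : crep (rq t *: X) = (real_complex R t) *: crep X.
Proof.
rewrite /crep scale_block_mx; congr block_mx; apply/matrixP => i j; rewrite !mxE -rqZ;
by apply: complexP; rewrite /qc1 /qc2 /= !quatZE; ring.
Qed.

Lemma crep_adj X : crep (qadj X) = map_mx Num.conj (crep X)^T.
Proof.
rewrite /crep tr_block_mx map_block_mx; congr block_mx; apply/matrixP => i j;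
by rewrite !mxE /= ?qc1_conj ?qc2_conj ?rmorphN /= ?opprK ?conjCK.
Qed.

Lemma crep_inj X : crep X = 0 -> X = 0.
Proof.
move=> /eqP; rewrite block_mx_eq0 => /and4P[/eqP X1 /eqP X2 _ _].
apply/matrixP => i j.
move: X1 X2 => /matrixP/(_ i j) + /matrixP/(_ i j).
by rewrite !mxE => -[a b] [c d]; apply/quatP; rewrite !csimp.
Qed.

(** The complex spectral theorem descends along the representation in this form:
    a diagonalizing matrix need not be quaternionic, but a polynomial relation
    with real coefficients is. *)
Lemma herm_annihilated (S : M) : qadj S = S ->
  exists ds : seq R, foldr (fun d X => (S - rq d *: 1%:M) *m X) 1%:M ds = 0.
Proof.
move=> Sh; set A := crep S.
have Ah : A \is hermsymmx.
  by apply/is_hermitianmxP; rewrite expr0 scale1r -map_trmx map_trmx -crep_adj Sh.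
have /orthomx_spectralP := hermitian_normalmx Ah.
set P := spectralmx A; set sp := spectral_diag A => AP.
have Pu : P \in unitmx := spectral_unit A.
have sp_real i : exists d : R, sp 0 i = real_complex R d.
  have /mxOverP/(_ 0 i) := hermitian_spectral_diag_real Ah.
  rewrite -/sp; case: (sp 0 i) => a b /complex_realP [x ->]; by exists x.
have [d dP] := choice sp_real.
exists (map d (enum 'I_(n + n))); apply: crep_inj.
have step ds : crep (foldr (fun d X => (S - rq d *: 1%:M) *m X) 1%:M ds) =
   invmx P *m diag_mx (\row_i \prod_(e <- ds) (sp 0 i - real_complex R e)) *m P.
  elim: ds => [|e ds IH] /=.
    rewrite crep1 [X in diag_mx X](_ : _ = const_mx 1); last first.
      by apply/rowP => i; rewrite !mxE big_nil.
    by rewrite diag_const_mx mulmx1 mulVmx.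
  rewrite crepM IH raddfB /= crepZ crep1 -/A AP.
  have -> : invmx P *m diag_mx sp *m P - real_complex R e *: 1%:M =
    invmx P *m (diag_mx (\row_i (sp 0 i - real_complex R e))) *m P.
    rewrite [in RHS](_ : diag_mx _ = diag_mx sp - (real_complex R e)%:M); last first.
      by apply/matrixP => i j; rewrite !mxE; case: eqP => [->|]; rewrite ?mulr1n ?mulr0n ?subr0.
    by rewrite mulmxBr mulmxBl mul_mx_scalar -scalemxAl mulVmx.
  have dE : diag_mx (\row_i (sp 0 i - real_complex R e)) *m
      diag_mx (\row_i \prod_(e <- ds) (sp 0 i - real_complex R e)) =
      diag_mx (\row_i \prod_(e <- e :: ds) (sp 0 i - real_complex R e)).
    by rewrite mulmx_diag; congr diag_mx; apply/rowP => i; rewrite !mxE big_cons.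
  by apply: etrans (mul_conjmx _ _ Pu) _; congr (_ *m _ *m _); exact: dE.
(* Each diagonal entry contains the factor of its own eigenvalue. *)
rewrite step [X in diag_mx X](_ : _ = 0) ?raddf0 ?mulmx0 ?mul0mx //.
apply/rowP => i; rewrite !mxE big_map big_enum (bigD1 i) //=.
by rewrite dP subrr mul0r.
Qed.

End ComplexRepresentation.

Section Projections.
Variable R : realType.
Local Notation H := (quat R).

Definition is_proj n (p : 'M[H]_n) := qadj p = p /\ p *m p = p.

Definition img n (p : 'M[H]_n) : set 'cV[H]_n := [set v | p *m v = v].

(** A product of factors S - d that is nonzero on the range of q but killed by
    one more factor is, up to a real factor, a projection onto a part of an
    eigenspace of S. *)
Lemma herm_eigenprojection n (q S : 'M[H]_n) :
  is_proj q -> q != 0 -> qadj S = S -> S *m q = q *m S ->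
  exists d : R, exists r : 'M[H]_n, [/\ is_proj r, r != 0, r *m q = r,
    S *m r = rq d *: r &
    forall Y, Y *m S = S *m Y -> Y *m q = q *m Y -> Y *m r = r *m Y].
Proof.
move=> [qh qq] q0 Sh Sq; have [ds0 W0] := herm_annihilated Sh.
pose W := foldr (fun d X => (S - rq d *: 1%:M) *m X) (1%:M : 'M[H]_n).
have facC d Y : Y *m S = S *m Y -> Y *m (S - rq d *: 1%:M) = (S - rq d *: 1%:M) *m Y.
  by move=> YS; rewrite mulmxBr mulmxBl YS rqmxAr -scalemxAl mulmx1 mul1mx.
have WC ds Y : Y *m S = S *m Y -> Y *m W ds = W ds *m Y.
  move=> YS; elim: ds => [|d ds IH] /=; first by rewrite mulmx1 mul1mx.
  by rewrite mulmxA (facC d) // -mulmxA IH mulmxA.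
have Wh ds : qadj (W ds) = W ds.
  elim: ds => [|d ds IH] /=; first by rewrite qadj1.
  rewrite qadjM IH raddfB /= Sh qadjZ qadj1; apply/esym.
  by rewrite -(WC ds) // mulmxBl mulmxBr -scalemxAl mul1mx rqmxAr mulmx1.
have [ds [d [Wq0 Wq1]]] : exists ds d, W ds *m q != 0 /\ W (d :: ds) *m q = 0.
  have: W ds0 *m q = 0 by rewrite /W W0 mul0mx.
  elim: ds0 {W0} => [|d ds IH] Wq; first by move: q0; rewrite -Wq /= mul1mx eqxx.
  by have [/IH|] := eqVneq (W ds *m q) 0; last by exists ds, d.
set T := W ds *m q in Wq0.
have ST : S *m T = rq d *: T.
  apply/eqP; rewrite -subr_eq0; move/eqP: Wq1 => /=.
  by rewrite -mulmxA mulmxBl -scalemxAl mul1mx.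
have WT : W ds *m T = rq (\prod_(e <- ds) (d - e)) *: T.
  elim: (ds) => [|e es IH] /=; first by rewrite mul1mx big_nil rmorph1 scale1r.
  rewrite -mulmxA IH rqmxAr mulmxBl ST -scalemxAl mul1mx -scalerBl -rmorphB scalerA -rmorphM.
  by rewrite big_cons mulrC.
set c := \prod_(e <- ds) _ in WT.
have Tq : T *m q = T by rewrite /T -mulmxA qq.
have qT : q *m T = T by rewrite /T mulmxA (WC ds) // -mulmxA qq.
have Th : qadj T = T by rewrite /T qadjM qh Wh WC.
have TT : T *m T = rq c *: T by rewrite {1}/T -mulmxA qT WT.
have c0 : c != 0.
  apply: contra_neq Wq0 => c0; apply: mul_adj_eq0.
  by rewrite Th TT c0 rmorph0 scale0r.
exists d, (rq c^-1 *: T); split.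
- split; first by rewrite qadjZ Th.
  by rewrite rqmxAr -scalemxAl TT 2!scalerA -!rmorphM mulfVK.
- apply: contra Wq0 => /eqP rT; apply/eqP.
  have := congr1 (fun X => rq c *: X) rT.
  by rewrite scalerA -rmorphM divff // rmorph1 scale1r scaler0.
- by rewrite -scalemxAl Tq.
- by rewrite rqmxAr ST !scalerA -!rmorphM mulrC.
- move=> Y YS Yq; rewrite rqmxAr -scalemxAl /T; congr (_ *: _).
  by rewrite mulmxA WC // -mulmxA Yq mulmxA.
Qed.

Lemma proj_sub n (q r : 'M[H]_n) : is_proj q -> is_proj r -> r *m q = r -> q *m r = r.
Proof. by move=> [qh _] [rh _] /(congr1 (@qadj _ _ _)); rewrite qadjM qh rh. Qed.

Lemma proj_diff n (q r : 'M[H]_n) : is_proj q -> is_proj r -> r *m q = r -> is_proj (q - r).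
Proof.
move=> qP rP rq; have qr := proj_sub qP rP rq; case: qP rP => [qh qq] [rh rr].
split; first by rewrite raddfB /= qh rh.
by rewrite mulmxBr !mulmxBl qq qr rq rr subrr subr0.
Qed.

Lemma tau_proj_ge0 n (p : 'M[H]_n) : is_proj p -> 0 <= tau p.
Proof. by move=> [ph pp]; rewrite -pp -{2}ph tau_ge0. Qed.

Lemma tau_proj_eq0 n (p : 'M[H]_n) : is_proj p -> tau p = 0 -> p = 0.
Proof. by move=> [ph pp] p0; apply: tau_eq0; rewrite ph pp. Qed.

(** The imaginary parts of v^* v cancel, so that v can be normalized by a real
    factor. *)
Lemma adj_mul_cV n (v : 'cV[H]_n) : qadj v *m v = rq (tau (v *m qadj v)) *: 1%:M.
Proof.
apply/matrixP => i j; rewrite !ord1 tau_mul_adj !mxE mulr1n mulr1 raddf_sum /=.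
apply: eq_bigr => k _; rewrite big_ord1 !mxE.
apply/quatP; rewrite quatME /qmul /qconj /rq /qnormsq !mkquatE; ring.
Qed.

Lemma qadj_row_mx n d1 d2 (A : 'M[H]_(n, d1)) (B : 'M[H]_(n, d2)) :
  qadj (row_mx A B) = col_mx (qadj A) (qadj B).
Proof. by rewrite /qadj map_row_mx tr_row_mx. Qed.

Lemma img_neq0 n (p : 'M[H]_n) : is_proj p -> p != 0 -> exists v, img p v /\ v != 0.
Proof.
move=> pP /negP p0; have [j v0] : exists j, col j p != 0.
  apply: contrapT => /forallNP pz; case: p0; apply/eqP/matrixP => k j.
  by have /negP := pz j; rewrite negbK => /eqP/colP/(_ k); rewrite !mxE.
by exists (col j p); split=> //; rewrite /img /= colE mulmxA pP.2.
Qed.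

(** Gram-Schmidt: split off unit vectors until the trace is exhausted. *)
Lemma proj_orthobasis n (p : 'M[H]_n) : is_proj p ->
  exists d, exists B : 'M[H]_(n, d), qadj B *m B = 1%:M /\ B *m qadj B = p.
Proof.
move=> pP; have := ltW (Num.Theory.archi_boundP (tau_proj_ge0 pP)).
move: (Num.bound _) pP => m; elim: m p => [|m IH] p pP pm; have [p0|p_neq0] := eqVneq p 0.
- exists 0%N, 0; split; first by apply/matrixP => -[].
  by rewrite mul0mx p0.
- case/negP: p_neq0; apply/eqP/tau_proj_eq0 => //.
  by apply/le_anti; rewrite pm tau_proj_ge0.
- exists 0%N, 0; split; first by apply/matrixP => -[].
  by rewrite mul0mx p0.
have [v [pv v0]] : exists v, img p v /\ v != 0 by exact: img_neq0.
set N := tau (v *m qadj v).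
have N0 : 0 < N.
  by rewrite lt_def tau_ge0 andbT; apply: contra v0 => /eqP/tau_eq0 ->.
pose w := rq (Num.sqrt N)^-1 *: v.
have ww : qadj w *m w = 1%:M.
  rewrite /w qadjZ rqmxAr -scalemxAl adj_mul_cV -/N !scalerA -!rmorphM.
  by rewrite -invfM -expr2 sqr_sqrtr ?(ltW N0) // mulVf ?gt_eqF // rmorph1 scale1r.
have pw : p *m w = w by rewrite rqmxAr pv.
have wP : is_proj (w *m qadj w).
  split; first by rewrite qadjM qadjK.
  by rewrite mulmxA -[w *m _ *m w]mulmxA ww mulmx1.
have wp : w *m qadj w *m p = w *m qadj w.
  by rewrite -mulmxA -{1}pP.1 -qadjM pw.
have p1P := proj_diff pP wP wp.
have [|d [B [BB BB']]] := IH _ p1P.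
  rewrite raddfB /= tauC ww tau1; move: pm; rewrite -natr1; lra.
have wB : qadj w *m B = 0.
  have BE : B = (p - w *m qadj w) *m B by rewrite -BB' -mulmxA BB mulmx1.
  by rewrite BE mulmxA mulmxBr -{1}pP.1 -qadjM pw mulmxA ww mul1mx subrr mul0mx.
exists (1 + d)%N, (row_mx w B); rewrite qadj_row_mx mul_row_col BB' addrC subrK; split=> //.
rewrite mul_col_row ww BB wB.
have -> : qadj B *m w = 0 by rewrite -[w]qadjK -qadjM wB raddf0.
by rewrite -scalar_mx_block.
Qed.

Lemma qscale_sum n d (b : 'I_d -> 'cV[H]_n) (c : 'I_d -> H) :
  \sum_i qscale (c i) (b i) = (\matrix_(i, j) b j i 0) *m (\col_j c j).
Proof.
apply/matrixP => i j; rewrite !ord1 summxE !mxE; apply: eq_bigr => k _.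
by rewrite !mxE big_ord1 !mxE mulr1n.
Qed.

(** If the columns of B form a basis of the range of p then p = B C with
    C B = 1, whence the trace. *)
Lemma has_dim_img n (p : 'M[H]_n) (d : nat) : is_proj p ->
  has_dim (@qscale R n) (img p) d <-> tau p = d%:R.
Proof.
move=> pP; split=> [[b [bP bfree]]|pd].
  pose B : 'M[H]_(n, d) := \matrix_(i, j) b j i 0.
  have imgP v : img p v <-> exists c : 'cV[H]_d, v = B *m c.
    split=> [/bP[c ->]|[c ->]]; first by exists (\col_j c j); rewrite qscale_sum.
    apply/bP; exists (fun j => c j 0); rewrite qscale_sum; congr (_ *m _).
    by apply/colP => j; rewrite mxE.
  have Bfree (c : 'cV[H]_d) : B *m c = 0 -> c = 0.
    move=> Bc; apply/colP => j; rewrite mxE; apply: (bfree (fun j => c j 0)).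
    by rewrite qscale_sum -Bc; congr (_ *m _); apply/colP => k; rewrite mxE.
  have pB : p *m B = B.
    apply/matrixP => i j; have: img p (B *m delta_mx j 0) by apply/imgP; eexists.
    by rewrite /img /= mulmxA -!colE => /colP/(_ i); rewrite !mxE.
  have /choice[c cP] : forall k, exists c, col k p = B *m c.
    by move=> k; apply/imgP; rewrite /img /= colE mulmxA pP.2.
  pose C : 'M[H]_(d, n) := \matrix_(i, k) c k i 0.
  have pBC : p = B *m C.
    apply/matrixP => i k; have /colP/(_ i) := cP k; rewrite !mxE => ->.
    by apply: eq_bigr => l _; rewrite !mxE.
  have CB : C *m B = 1%:M.
    apply/eqP; rewrite -subr_eq0; apply/eqP/matrixP => i j.
    have /colP/(_ i) : col j (C *m B - 1%:M) = 0.
      by apply: Bfree; rewrite colE mulmxA mulmxBr mulmxA -pBC pB mulmx1 subrr mul0mx.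
    by rewrite !mxE.
  by rewrite pBC tauC CB tau1.
have [e [B [BB BB']]] := proj_orthobasis pP.
have ed : e = d by apply/eqP; rewrite -(eqr_nat R) -pd -BB' tauC BB tau1.
case: _ / ed.
exists (fun j => col j B).
have BE (c : 'I_e -> H) : \sum_i qscale (c i) (col i B) = B *m (\col_j c j).
  by rewrite qscale_sum; congr (_ *m _); apply/matrixP => i j; rewrite !mxE.
split=> [v|c].
  split=> [pv|[c ->]]; last by rewrite BE /img /= -BB' mulmxA -[B *m _ *m B]mulmxA BB mulmx1.
  exists (fun j => (qadj B *m v) j 0); rewrite BE -[LHS]pv -BB' -mulmxA; congr (_ *m _).
  by apply/colP => j; rewrite [RHS]mxE.
rewrite BE => Bc i; have := congr1 (mulmx (qadj B)) Bc.
by rewrite mulmxA BB mul1mx mulmx0 => /colP/(_ i); rewrite !mxE.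
Qed.

Lemma tau_proj_nat n (p : 'M[H]_n) : is_proj p -> exists d : nat, tau p = d%:R.
Proof.
move=> /proj_orthobasis[d [B [BB <-]]]; exists d.
by rewrite tauC BB tau1.
Qed.

Lemma img_inj n (p q : 'M[H]_n) : is_proj p -> is_proj q -> img p = img q -> p = q.
Proof.
move=> pP qP pq.
have sub (x y : 'M[H]_n) : x *m x = x -> img x = img y -> y *m x = x.
  move=> xx xy; apply/matrixP => i j.
  have : img y (col j x) by rewrite -xy /img /= colE mulmxA xx.
  by rewrite /img /= colE mulmxA -!colE => /colP/(_ i); rewrite !mxE.
have qp := sub _ _ pP.2 pq; have pq' := sub _ _ qP.2 (esym pq).
by rewrite -{1}qp -{1}pP.1 -{1}qP.1 -qadjM pq' qP.1.
Qed.

End Projections.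

Section Dimension.
Variables (R : realType) (n : nat).
Local Notation M := 'M[quat R]_n.

(** The matrix expressing one basis in the other is injective, hence invertible. *)
Lemma has_dim_sub (W1 W2 : set M) d :
  has_dim (@rscale R n n) W1 d -> has_dim (@rscale R n n) W2 d ->
  W1 `<=` W2 -> W2 `<=` W1.
Proof.
move=> [b1 [b1P free1]] [b2 [b2P free2]] W12.
have b1W i : W1 (b1 i).
  apply/b1P; exists (fun j => (j == i)%:R); rewrite (bigD1 i) //= eqxx big1 ?addr0.
    by rewrite rscaleE rmorph1 scale1r.
  by move=> j /negbTE ->; rewrite rscaleE rmorph0 scale0r.
have /choice[C CP] : forall i, exists c, b1 i = \sum_j rscale (c j) (b2 j).
  by move=> i; apply/b2P/W12.
pose A : 'M[R]_d := \matrix_(i, j) C i j.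
have comb (u : 'rV[R]_d) :
    \sum_i rscale (u 0 i) (b1 i) = \sum_j rscale ((u *m A) 0 j) (b2 j).
  under eq_bigr do rewrite CP rscaleE scaler_sumr.
  rewrite exchange_big; apply: eq_bigr => j _; rewrite rscaleE mxE raddf_sum scaler_suml.
  by apply: eq_bigr => i _; rewrite rscaleE scalerA -rmorphM mxE.
have Au : A \in unitmx.
  rewrite -row_free_unit; apply: inj_row_free => u uA; apply/rowP => i; rewrite mxE.
  apply: (free1 (fun i => u 0 i)); rewrite comb uA big1 // => j _.
  by rewrite mxE rscaleE rmorph0 scale0r.
move=> v /b2P[c ->]; apply/b1P.
exists (fun i => (\row_j c j *m invmx A) 0 i).
by rewrite comb mulmxKV //; apply: eq_bigr => j _; rewrite mxE.
Qed.

End Dimension.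

(** * The commutant and its frame *)

Section Commutant.
Variables (R : realType) (n : nat).
Local Notation M := 'M[quat R]_n.
Implicit Types (G : set M) (X Y S : M).

Definition commutant G : set M := [set X | forall x, G x -> x *m X = X *m x].

(** What is used of the preimage in Sp(n) of a closed abelian subgroup F of
    Sp(n)/<-1> such that the Lie algebra of the centralizer of F is that of F:
    it is the last clause that encodes the condition on Lie algebras. *)
Record thick_pm_abelian G : Prop := ThickPmAbelian {
  pma_1 : G 1%:M;
  pma_M : forall x y, G x -> G y -> G (x *m y);
  pma_adj : forall x, G x -> G (qadj x);
  pma_unitary : forall x, G x -> x *m qadj x = 1%:M;
  pma_pm : forall x y, G x -> G y -> exists b : bool, x *m y = (-1) ^+ b *: (y *m x);
  pma_exp : forall X, commutant G X -> qadj X = - X -> G (mxexp X)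
}.

Lemma commutant1 G : commutant G 1%:M.
Proof. by move=> x _; rewrite mulmx1 mul1mx. Qed.

Lemma commutantD G X Y : commutant G X -> commutant G Y -> commutant G (X + Y).
Proof. by move=> cX cY x Gx; rewrite mulmxDr mulmxDl cX ?cY. Qed.

Lemma commutantN G X : commutant G X -> commutant G (- X).
Proof. by move=> cX x Gx; rewrite mulmxN mulNmx cX. Qed.

Lemma commutantB G X Y : commutant G X -> commutant G Y -> commutant G (X - Y).
Proof. by move=> cX cY; apply: commutantD => //; exact: commutantN. Qed.

Lemma commutantM G X Y : commutant G X -> commutant G Y -> commutant G (X *m Y).
Proof. by move=> cX cY x Gx; rewrite mulmxA cX // -mulmxA cY // mulmxA. Qed.

Lemma commutantZ G t X : commutant G X -> commutant G (rq t *: X).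
Proof. by move=> cX x Gx; rewrite rqmxAr -scalemxAl cX. Qed.

Lemma commutant_sum G (I : finType) (f : I -> M) :
  (forall i, commutant G (f i)) -> commutant G (\sum_i f i).
Proof. by move=> cf x Gx; rewrite mulmx_sumr mulmx_suml; apply: eq_bigr => i _; exact: cf. Qed.

Variable G : set M.
Hypothesis hG : thick_pm_abelian G.
Local Notation C := (commutant G).

Lemma pma_unitary_l x : G x -> qadj x *m x = 1%:M.
Proof. by move=> /(pma_unitary hG)/qmulmx1C. Qed.

Lemma commutant_adj X : C X -> C (qadj X).
Proof.
move=> cX x Gx; have := congr1 (@qadj _ _ _) (cX _ (pma_adj hG Gx)).
by rewrite !qadjM qadjK.
Qed.

(** The one-parameter group of X lies in G, so whatever commutes with G
    commutes with X. *)
Lemma skew_central X Y : C X -> qadj X = - X -> C Y -> Y *m X = X *m Y.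
Proof.
move=> cX skX cY; have [->|Y0] := eqVneq Y 0; first by rewrite mul0mx mulmx0.
apply: comm_mxexp => // t; exists false; rewrite expr0 scale1r.
apply/esym/cY; rewrite rscaleE; apply: (pma_exp hG); first exact: commutantZ.
by rewrite qadjZ skX scalerN.
Qed.

(** The commutator K of two Hermitian elements is skew, hence central, and then
    K^2 = K S T - K T S is a commutator too and has trace 0. *)
Lemma herm_commute S T : C S -> C T -> qadj S = S -> qadj T = T -> S *m T = T *m S.
Proof.
move=> cS cT Sh Th; pose K := S *m T - T *m S.
have Ksk : qadj K = - K by rewrite /K raddfB /= !qadjM Sh Th opprB.
have cK : C K by apply: commutantB; apply: commutantM.
have SK := skew_central cK Ksk cS.
suff /eqP: K = 0 by rewrite subr_eq0 => /eqP.
apply: tau_eq0; rewrite Ksk mulmxN raddfN /= {2}/K mulmxBr raddfB /=.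
by rewrite mulmxA -SK -mulmxA tauC -[K *m T *m S]mulmxA subrr oppr0.
Qed.

Lemma commutant_commute X Y : C X -> C Y -> X *m Y = Y *m X.
Proof.
move=> cX cY; have cX' := commutant_adj cX; have cY' := commutant_adj cY.
have herm (Z : M) : qadj (Z + qadj Z) = Z + qadj Z by rewrite raddfD /= qadjK addrC.
have skew (Z : M) : qadj (Z - qadj Z) = - (Z - qadj Z) by rewrite raddfB /= qadjK opprB.
have hY Z : C Z -> (X - qadj X) *m Z = Z *m (X - qadj X).
  by move=> cZ; rewrite (skew_central _ (skew X) cZ) //; exact: commutantB.
have hX Z : C Z -> Z *m (Y - qadj Y) = (Y - qadj Y) *m Z.
  by move=> cZ; rewrite (skew_central _ (skew Y) cZ) //; exact: commutantB.
have hh := herm_commute (commutantD cX cX') (commutantD cY cY') (herm X) (herm Y).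
have e2 (Z : M) : Z + Z = (Z + qadj Z) + (Z - qadj Z) by rewrite addrACA subrr addr0.
have e4 : (X + X) *m (Y + Y) = (Y + Y) *m (X + X).
  have hX1 := hX _ (commutantD cX cX'); have hYY := hY _ (commutantD cY cY).
  move: hh hX1 hYY; rewrite (e2 X) (e2 Y); set c := (Y + qadj Y) + _.
  move: (X + qadj X) (X - qadj X) => a b ac1 ac2 bc.
  by rewrite mulmxDl [RHS]mulmxDr bc; congr (_ + _); rewrite /c mulmxDr mulmxDl ac1 ac2.
apply/eqP; rewrite -subr_eq0; apply/eqP/qmx_double_eq0/qmx_double_eq0.
have DD (P Q : M) : (P - Q) + (P - Q) = (P + P) - (Q + Q) by rewrite addrACA opprD.
by move: e4; rewrite !mulmxDr !mulmxDl !DD => ->; rewrite subrr.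
Qed.

(** This is minimality among the nonzero projections of the commutant: a Hermitian
    element with two eigenvalues on the range of p would split p. *)
Definition minimal p := [/\ is_proj p, p != 0, C p &
  forall S, C S -> qadj S = S -> exists l : R, S *m p = rq l *: p].

(** If q is not minimal, some Hermitian element of the commutant has an
    eigenprojection strictly below q; the trace, an integer, bounds the number of
    such splittings. *)
Lemma minimal_decomposition q : is_proj q -> C q ->
  exists ps : seq M, [/\ forall p, p \in ps -> minimal p /\ p *m q = p,
    pairwise (fun x y => x *m y == 0) ps & \sum_(p <- ps) p = q].
Proof.
move=> qP; have [d] := tau_proj_nat qP.
elim/ltn_ind: d q qP => d IH q qP qd cq.
have [q0|q_neq0] := eqVneq q 0; first by exists [::]; rewrite big_nil q0.
have [qmin|] := pselect (minimal q).
  exists [:: q]; split=> //; last by rewrite big_seq1.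
  by move=> p; rewrite inE => /eqP ->; rewrite qP.2.
move=> nmin; have [S [cS Sh Sq]] :
    exists S, [/\ C S, qadj S = S & forall l : R, S *m q <> rq l *: q].
  apply: contrapT => nS; apply: nmin; split=> // S cS Sh.
  by apply: contrapT => nl; apply: nS; exists S; split=> // l Sl; apply: nl; exists l.
have [l [r [rP r0 rq' Sr rC]]] :=
  herm_eigenprojection qP q_neq0 Sh (commutant_commute cS cq).
have cr : C r by move=> x Gx; apply: rC; [exact: cS|exact: cq].
have qr_neq0 : q - r != 0.
  by apply/eqP => /eqP; rewrite subr_eq0 => /eqP qr; apply: (Sq l); rewrite qr.
have r1P := proj_diff qP rP rq'.
have [d1 rd1] := tau_proj_nat rP; have [d2 rd2] := tau_proj_nat r1P.
have dE : d = (d1 + d2)%N.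
  apply/eqP; rewrite -(eqr_nat R) -qd natrD -rd1 -rd2 raddfB /=.
  by rewrite addrC subrK.
have d_gt0 (p : M) e : is_proj p -> p != 0 -> tau p = e%:R -> (0 < e)%N.
  move=> pP p0 pe; rewrite lt0n; apply: contra_neq p0 => e0.
  by apply: tau_proj_eq0; rewrite // pe e0.
have d1_gt0 := d_gt0 _ _ rP r0 rd1; have d2_gt0 := d_gt0 _ _ r1P qr_neq0 rd2.
have [|ps1 [ps1P ps1o ps1s]] := IH d1 _ r rP rd1 cr; first by rewrite dE -addn1 leq_add2l.
have [|ps2 [ps2P ps2o ps2s]] := IH d2 _ (q - r) r1P rd2 (commutantB cq cr).
  by rewrite dE -add1n leq_add2r.
have qr := proj_sub qP rP rq'.
exists (ps1 ++ ps2); split.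
- move=> p; rewrite mem_cat => /orP[/ps1P|/ps2P] [pm pr]; split=> //.
    by rewrite -pr -mulmxA rq'.
  by rewrite -pr -mulmxA mulmxBl qP.2 rq'.
- rewrite pairwise_cat ps1o ps2o !andbT; apply/allrelP => x y /ps1P[_ xr] /ps2P[[yP _ _ _] yr].
  have yr' := proj_sub r1P yP yr.
  rewrite -yr' -xr mulmxA -[x *m r *m _]mulmxA mulmxBr rq' rP.2 subrr mulmx0 mul0mx //.
- by rewrite big_cat /= ps1s ps2s addrC subrK.
Qed.

(** The commutant is the product of copies of the field of real numbers
    (J i = 0) and of the field of complex numbers with imaginary unit J i. *)
Record frame (s : nat) (p J : 'I_s -> M) : Prop := Frame {
  fr_proj : forall i, is_proj (p i);
  fr_orth : forall i j, i != j -> p i *m p j = 0;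
  fr_sum : \sum_i p i = 1%:M;
  fr_neq0 : forall i, p i != 0;
  fr_comm : forall i, C (p i);
  fr_Jcomm : forall i, C (J i);
  fr_skew : forall i, qadj (J i) = - J i;
  fr_Jp : forall i, J i *m p i = J i;
  fr_sq : forall i, J i = 0 \/ J i *m J i = - p i;
  fr_span : forall X i, C X -> exists al be : R, X *m p i = rq al *: p i + rq be *: J i
}.

(** For K skew with K p nonzero, the Hermitian K K^* is a positive multiple of p,
    and J is K p normalized. Any other skew element X is determined by the
    Hermitian, hence scalar, element X J. *)
Lemma minimal_imaginary p : minimal p -> exists J : M,
  [/\ C J, qadj J = - J, J *m p = J, J = 0 \/ J *m J = - p &
   forall X, C X -> exists al be : R, X *m p = rq al *: p + rq be *: J].
Proof.
move=> [pP p0 cp pmin].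
have span J : C J -> (forall K, C K -> qadj K = - K -> exists be : R, K *m p = rq be *: J) ->
    forall X, C X -> exists al be : R, X *m p = rq al *: p + rq be *: J.
  move=> cJ Jspan X cX; have cX' := commutant_adj cX.
  have [|al alP] := pmin _ (commutantD cX cX'); first by rewrite raddfD /= qadjK addrC.
  have [|be beP] := Jspan _ (commutantB cX cX'); first by rewrite raddfB /= qadjK opprB.
  exists (al / 2), (be / 2); apply/eqP; rewrite -subr_eq0; apply/eqP/qmx_double_eq0.
  rewrite addrACA -opprD addrACA -!scalerDl -!rmorphD -!splitr -alP -beP.
  by rewrite -!mulmxDl addrACA subrr addr0 subrr.
have [[K [cK Ksk Kp]]|nK] :=
  pselect (exists K, [/\ C K, qadj K = - K & K *m p != 0]); last first.
  exists 0; split; [by move=> x _; rewrite mul0mx mulmx0 | by rewrite raddf0 oppr0 |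
    by rewrite mul0mx | by left |].
  apply: span; first by move=> x _; rewrite mul0mx mulmx0.
  move=> K cK Ksk; exists 0; rewrite scaler0; apply: contrapT => Kp.
  by apply: nK; exists K; split=> //; apply/eqP.
set L := K *m p in Kp.
have cL : C L by exact: commutantM.
have Lsk : qadj L = - L.
  by rewrite qadjM Ksk pP.1 mulmxN (commutant_commute cp cK).
have Lp : L *m p = L by rewrite /L -mulmxA pP.2.
have [||l lP] := pmin (L *m qadj L); [by apply: commutantM => //; exact: commutant_adj |
  by rewrite qadjM qadjK |].
have LLp : L *m qadj L *m p = L *m qadj L.
  by rewrite Lsk mulmxN mulNmx -mulmxA Lp.
rewrite LLp in lP.
have l0 : 0 < l.
  have : 0 < tau (L *m qadj L).
    by rewrite lt_def tau_ge0 andbT; apply: contra Kp => /eqP/tau_eq0 ->.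
  by rewrite lP tauZ; have := tau_proj_ge0 pP; nra.
pose J := rq (Num.sqrt l)^-1 *: L.
have JJ : J *m J = - p.
  rewrite /J rqmxAr -scalemxAl -[L *m L]opprK -mulmxN -Lsk lP !scalerN !scalerA -!rmorphM.
  by rewrite -invfM -expr2 sqr_sqrtr ?(ltW l0) // mulVf ?gt_eqF // rmorph1 scale1r.
have cJ : C J by exact: commutantZ.
have Jsk : qadj J = - J by rewrite /J qadjZ Lsk scalerN.
have Jp : J *m p = J by rewrite /J -scalemxAl Lp.
exists J; split=> //; first by right.
apply: span => // X cX Xsk.
have [||m mP] := pmin (X *m J); [exact: commutantM |
  by rewrite qadjM Jsk Xsk mulNmx mulmxN opprK (commutant_commute cJ cX) |].
exists (- m); rewrite -[p]opprK -JJ mulmxN mulmxA -[X *m J]/(X *m J).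
have -> : X *m J *m J = X *m J *m p *m J by rewrite -!mulmxA (commutant_commute cp cJ) Jp.
by rewrite mP -scalemxAl (commutant_commute cp cJ) Jp rmorphN scaleNr.
Qed.

Lemma frame_exists : exists s, exists p J : 'I_s -> M, frame p J.
Proof.
have P1 : is_proj (1%:M : M) by split; rewrite ?qadj1 ?mulmx1.
have [ps [psP pso pss]] := minimal_decomposition P1 (@commutant1 G).
exists (size ps); pose p (i : 'I_(size ps)) := nth 0 ps i.
have pmin i : minimal (p i) by have [] := psP _ (mem_nth 0 (ltn_ord i)).
have /choice[J JP] : forall i, exists J : M, _ := fun i => minimal_imaginary (pmin i).
have ho (i j : 'I_(size ps)) : (i < j)%N -> p i *m p j = 0.
  by move=> ij; apply/eqP/(pairwiseP 0 pso) => //; rewrite inE.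
exists p, J; split=> //.
- by move=> i; case: (pmin i).
- move=> i j; rewrite neq_ltn => /orP[/ho//|/ho pij].
  have [[ph _] _ _ _] := pmin i; have [[ph' _] _ _ _] := pmin j.
  by rewrite -ph -ph' -qadjM pij raddf0.
- by rewrite -[RHS]pss (big_nth 0) big_mkord.
- by move=> i; case: (pmin i).
- by move=> i; case: (pmin i).
- by move=> i; case: (JP i).
- by move=> i; case: (JP i).
- by move=> i; case: (JP i).
- by move=> i; case: (JP i).
- by move=> X i; case: (JP i) => _ _ _ _; apply.
Qed.

End Commutant.

Lemma unit_angle (R : realType) (x y : R) : x ^+ 2 + y ^+ 2 = 1 ->
  exists t : R, cos t = x /\ sin t = y.
Proof.
move=> xy1.
have x1 : x \in `[-1, 1].
  rewrite in_itv /= -ler_norml -[leRHS]sqrtr1 -sqrtr_sqr ler_wsqrtr // -xy1.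
  by rewrite lerDl sqr_ge0.
have [y0|y0] := leP 0 y.
  exists (acos x); rewrite acosK //; split=> //.
  rewrite sin_acos; last by move: x1; rewrite in_itv.
  by rewrite -xy1 addrC addKr sqrtr_sqr ger0_norm.
exists (- acos x); rewrite cosN sinN acosK //; split=> //.
rewrite sin_acos; last by move: x1; rewrite in_itv.
by rewrite -xy1 addrC addKr sqrtr_sqr ltr0_norm // opprK.
Qed.

(** * Generators and intertwiners *)

Section Intertwiner.
Variables (R : realType) (n r : nat).
Local Notation M := 'M[quat R]_n.

(** Averaging over one generator at a time: one of Y + A' Y A^* and
    Y - A' Y A^* is nonzero, and it intertwines A and A' up to sign. *)
Lemma sign_intertwiner (A A' : 'I_r -> M) (P : M -> Prop) (Y0 : M) :
  (forall l, A l *m qadj (A l) = 1%:M) ->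
  (forall l m, exists b : bool, A l *m A m = (-1) ^+ b *: (A m *m A l) /\
     A' l *m A' m = (-1) ^+ b *: (A' m *m A' l)) ->
  (forall Y l (b : bool), P Y -> P (Y + (-1) ^+ b *: (A' l *m Y *m qadj (A l)))) ->
  (forall Y l, P Y -> A' l *m A' l *m Y = Y *m (A l *m A l)) ->
  P Y0 -> Y0 != 0 ->
  exists Y, [/\ P Y, Y != 0 &
    exists e : 'I_r -> bool, forall l, A' l *m Y = (-1) ^+ e l *: (Y *m A l)].
Proof.
move=> AU Asign Pstep Psq PY0 Y0_neq0.
have AU' l : qadj (A l) *m A l = 1%:M by apply: qmulmx1C.
suff: forall m, (m <= r)%N -> exists Y, [/\ P Y, Y != 0 &
    exists e : 'I_r -> bool, forall l : 'I_r, (l < m)%N ->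
      A' l *m Y = (-1) ^+ e l *: (Y *m A l)].
  move=> /(_ r (leqnn r)) [Y [PY Y_neq0 [e eP]]].
  by exists Y; split=> //; exists e => l; apply: eP.
elim=> [_|m IH mr]; first by exists Y0; split=> //; exists (fun=> false).
have [Y [PY Y_neq0 [e eP]]] := IH (ltnW mr).
pose k := Ordinal mr; pose T (b : bool) := Y + (-1) ^+ b *: (A' k *m Y *m qadj (A k)).
have [b Tb] : exists b, T b != 0.
  apply: contrapT => /forallNP T0; case/negP: Y_neq0; apply/eqP.
  have T0' b : T b = 0 by apply/eqP; have /negP := T0 b; rewrite negbK.
  apply: qmx_double_eq0; rewrite -[RHS]addr0 -{1}(T0' true) -(T0' false) /T.
  by rewrite /= expr0 expr1 scale1r scaleN1r addrACA addNr addr0.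
exists (T b); split=> //; first exact: Pstep.
exists (fun l => if l == k then b else e l) => l; rewrite ltnS leq_eqVlt.
case: (eqVneq l k) => [-> _|lk].
  rewrite /T mulmxDr mulmxDl signmxAr -scalemxAl !mulmxA (Psq _ _ PY) scalerDr.
  rewrite -!mulmxA AU' AU !mulmx1 addrC; congr (_ + _).
  by rewrite scalerA -expr2 sqrr_sign scale1r.
rewrite -(inj_eq val_inj) /= in lk; rewrite (negbTE lk) /= => lm.
have [c [Ac A'c]] := Asign l k.
have Ac' : qadj (A k) *m A l = (-1) ^+ c *: (A l *m qadj (A k)).
  have := congr1 (fun X => qadj (A k) *m X *m qadj (A k)) Ac.
  by rewrite signmxAr -scalemxAl !mulmxA AU' mul1mx -!mulmxA AU mulmx1.
rewrite /T mulmxDr mulmxDl scalerDr (eP _ lm) signmxAr -scalemxAl; congr (_ + _).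
rewrite !mulmxA A'c -!scalemxAl -[A' k *m A' l *m Y]mulmxA (eP _ lm) signmxAr -!scalemxAl.
rewrite -[_ *m qadj (A k) *m A l]mulmxA Ac' signmxAr !mulmxA !scalerA; congr (_ *: _).
rewrite -!exprD; congr (_ ^+ _); ring.
Qed.

End Intertwiner.

(** * The centre of the group in terms of a frame *)

Section Centre.
Variables (R : realType) (n : nat).
Local Notation M := 'M[quat R]_n.
Variables (G : set M) (hG : thick_pm_abelian G).
Local Notation C := (commutant G).
Variables (s : nat) (p J : 'I_s -> M) (fr : frame G p J).

Lemma fr_pJ i : p i *m J i = J i.
Proof.
by rewrite (commutant_commute hG (fr_comm fr i) (fr_Jcomm fr i)) (fr_Jp fr).
Qed.

Lemma fr_pp i : p i *m p i = p i. Proof. exact: (fr_proj fr i).2. Qed.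
Lemma fr_ph i : qadj (p i) = p i. Proof. exact: (fr_proj fr i).1. Qed.

Lemma fr_Jp0 i j : i != j -> J i *m p j = 0.
Proof. by move=> ij; rewrite -(fr_Jp fr) -mulmxA (fr_orth fr) // mulmx0. Qed.

Lemma fr_JJ0 i j : i != j -> J i *m J j = 0.
Proof. by move=> ij; rewrite -(fr_pJ j) mulmxA fr_Jp0 // mul0mx. Qed.

Lemma fr_cube i : J i *m J i *m J i = - J i.
Proof.
by case: (fr_sq fr i) => [->|->]; rewrite ?mul0mx ?oppr0 // mulNmx fr_pJ.
Qed.

Lemma fr_decomp (m : nat) (X : 'M[quat R]_(n, m)) : X = \sum_i p i *m X.
Proof. by rewrite -mulmx_suml (fr_sum fr) mul1mx. Qed.

Lemma fr_ext (m : nat) (X Y : 'M[quat R]_(m, n)) :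
  (forall i, X *m p i = Y *m p i) -> X = Y.
Proof.
move=> XY; rewrite -[X]mulmx1 -[Y]mulmx1 -(fr_sum fr) !mulmx_sumr.
exact: eq_bigr.
Qed.

Lemma rotation_G th : G (rotation J th).
Proof.
rewrite -exp_rotation; [|exact: fr_JJ0|exact: fr_cube].
apply: (pma_exp hG); first by apply: commutant_sum => i; apply/commutantZ/(fr_Jcomm fr).
rewrite raddf_sum /= -sumrN; apply: eq_bigr => i _.
by rewrite qadjZ (fr_skew fr) scalerN.
Qed.

Lemma rotation_C th : C (rotation J th).
Proof.
apply: commutantD; first exact: commutant1.
apply: commutant_sum => i; apply: commutantD; apply: commutantZ; first exact: (fr_Jcomm fr).
by apply: commutantM; exact: (fr_Jcomm fr).
Qed.

Lemma rotation_p th i : rotation J th *m p i =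
  p i + (rq (sin (th i)) *: J i + rq (1 - cos (th i)) *: (J i *m J i)).
Proof.
rewrite /rotation mulmxDl mul1mx mulmx_suml (bigD1 i) //= [X in _ + (_ + X)]big1 ?addr0.
  by rewrite mulmxDl -!scalemxAl -[J i *m J i *m p i]mulmxA (fr_Jp fr).
move=> j ji; rewrite mulmxDl -!scalemxAl -[J j *m J j *m p i]mulmxA.
by rewrite fr_Jp0 // mulmx0 !scaler0 addr0.
Qed.

Lemma rotation_p_real th i : J i = 0 -> rotation J th *m p i = p i.
Proof. by move=> J0; rewrite rotation_p J0 mulmx0 !scaler0 !addr0. Qed.

Lemma rotation_p_complex th i : J i *m J i = - p i ->
  rotation J th *m p i = rq (cos (th i)) *: p i + rq (sin (th i)) *: J i.
Proof.
move=> JJ; rewrite rotation_p JJ rmorphB rmorph1 scalerBl scale1r scalerN opprK.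
by rewrite addrCA addNKr addrC.
Qed.

Lemma rotationD th th' i :
  rotation J th *m rotation J th' *m p i = rotation J (fun j => th j + th' j) *m p i.
Proof.
case: (fr_sq fr i) => JJ.
  by rewrite -mulmxA !(rotation_p_real _ JJ).
rewrite -mulmxA !(rotation_p_complex _ JJ) mulmxDr !rqmxAr.
have -> : rotation J th *m J i = rq (cos (th i)) *: J i - rq (sin (th i)) *: p i.
  rewrite -(fr_pJ i) mulmxA (rotation_p_complex _ JJ) mulmxDl -!scalemxAl fr_pJ JJ.
  by rewrite scalerN.
rewrite (rotation_p_complex _ JJ) !scalerDr scalerN !scalerA -!rmorphM cosD sinD.
rewrite [X in _ + X]addrC addrACA -scalerBl -scalerDl -rmorphD -rmorphB.
by rewrite ![cos (th' i) * _]mulrC ![sin (th' i) * _]mulrC.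
Qed.

Lemma fr_tau_gt0 i : 0 < tau (p i).
Proof.
rewrite lt_def tau_proj_ge0 ?andbT; last exact: (fr_proj fr).
by apply: contra (fr_neq0 fr i) => /eqP/(tau_proj_eq0 (fr_proj fr i)) ->.
Qed.

Lemma fr_herm_span X i : C X -> qadj X = X -> exists al : R, X *m p i = rq al *: p i.
Proof.
move=> cX Xh; have [al [be Xp]] := fr_span fr i cX; exists al.
have J0 : rq be *: J i = 0.
  have := congr1 (@qadj _ _ _) Xp.
  rewrite qadjM Xh fr_ph (commutant_commute hG (fr_comm fr i) cX) Xp raddfD /= !qadjZ.
  rewrite fr_ph (fr_skew fr) scalerN => /addrI/eqP; rewrite -subr_eq0 opprK => /eqP.
  exact: qmx_double_eq0.
by rewrite Xp J0 addr0.
Qed.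

(** The scalar by which a unitary Hermitian element acts on a block is real of
    square 1. *)
Lemma herm_p b i : G b -> C b -> qadj b = b ->
  exists e : bool, b *m p i = (-1) ^+ e *: p i.
Proof.
move=> Gb cb bh; have [al bal] := fr_herm_span i cb bh.
have : rq (al ^+ 2) *: p i = p i.
  rewrite expr2 rmorphM -scalerA -bal -rqmxAr -bal mulmxA -{2}bh (pma_unitary hG) //.
  by rewrite mul1mx.
move=> /(congr1 (@tau _ _)); rewrite tauZ -[RHS]mul1r.
move=> /(mulIf (lt0r_neq0 (fr_tau_gt0 i)))/eqP.
rewrite sqrf_eq1 => /orP[]/eqP al1; rewrite bal al1.
  by exists false; rewrite rmorph1 expr0.
by exists true; rewrite rmorphN1 expr1.
Qed.

Lemma centre_angles z : G z -> C z -> exists th : 'I_s -> R, forall i,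
  J i = 0 \/ J i *m J i = - p i /\ z *m p i = rq (cos (th i)) *: p i + rq (sin (th i)) *: J i.
Proof.
move=> Gz cz.
have /choice[th thP] : forall i, exists t : R, J i = 0 \/
    J i *m J i = - p i /\ z *m p i = rq (cos t) *: p i + rq (sin t) *: J i; last by exists th.
move=> i; have [J0|JJ] := fr_sq fr i; first by exists 0; left.
have [al [be zp]] := fr_span fr i cz.
have : qadj (z *m p i) *m (z *m p i) = p i.
  by rewrite qadjM fr_ph -mulmxA [qadj z *m _]mulmxA (pma_unitary_l hG) // mul1mx fr_pp.
rewrite zp [qadj _]raddfD /= !qadjZ fr_ph (fr_skew fr) mulmxDl !mulmxDr -!scalemxAl !rqmxAr.
rewrite !mulNmx JJ opprK fr_pp fr_pJ (fr_Jp fr) !scalerN !scalerA -!rmorphM.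
rewrite [be * al]mulrC addrA addrK -scalerDl -rmorphD.
move=> /(congr1 (@tau _ _)); rewrite tauZ -[RHS]mul1r => /(mulIf (lt0r_neq0 (fr_tau_gt0 i))).
rewrite -!expr2 => /unit_angle[t [<- <-]].
by exists t; right.
Qed.

(** On a complex block a unitary scalar is a rotation by some angle. Taking these
    rotations off leaves an element acting by a sign on each block. *)
Lemma centre_split z : G z -> C z ->
  exists th b, [/\ G b, C b, qadj b = b & z = b *m rotation J th].
Proof.
move=> Gz cz; have [th thP] := centre_angles Gz cz; set u := rotation J th.
have Gu : G u := rotation_G th; have cu : C u := rotation_C th.
have bu : z *m qadj u *m u = z by rewrite -mulmxA (pma_unitary_l hG) // mulmx1.
exists th, (z *m qadj u); split=> //.
- by apply: (pma_M hG) => //; exact: (pma_adj hG).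
- by apply: commutantM => //; exact: (commutant_adj hG).
have cb : C (z *m qadj u) by apply: commutantM => //; exact: (commutant_adj hG).
apply: fr_ext => i.
suff [l bp] : exists l : R, z *m qadj u *m p i = rq l *: p i.
  have cb' := commutant_adj hG cb.
  rewrite bp -(commutant_commute hG (fr_comm fr i) cb') -{1}(fr_ph i) -qadjM bp.
  by rewrite qadjZ fr_ph.
have [J0|[JJ zp]] := thP i.
  have [al [be zp]] := fr_span fr i cz; exists al.
  rewrite -mulmxA -(commutant_commute hG (fr_comm fr i) (commutant_adj hG cu)).
  rewrite -{1}(fr_ph i) -qadjM rotation_p_real // fr_ph zp.
  by rewrite J0 scaler0 addr0.
exists 1; rewrite rmorph1 scale1r.
have uz : u *m p i = z *m p i by rewrite zp rotation_p_complex.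
have cu' := commutant_adj hG cu.
rewrite -mulmxA -(commutant_commute hG (fr_comm fr i) cu') mulmxA -uz.
by rewrite -mulmxA (commutant_commute hG (fr_comm fr i) cu') mulmxA (pma_unitary hG) // mul1mx.
Qed.

Lemma centre_p_real z i : G z -> C z -> J i = 0 ->
  exists e : bool, z *m p i = (-1) ^+ e *: p i.
Proof.
move=> Gz cz J0; have [th [b [Gb cb bh ->]]] := centre_split Gz cz.
by rewrite -mulmxA rotation_p_real //; exact: herm_p.
Qed.

End Centre.

Lemma sign_scale_inj (R : realType) (m n : nat) (w : 'M[quat R]_(m, n)) (e e' : bool) :
  w != 0 -> (-1) ^+ e *: w = (-1) ^+ e' *: w -> e = e'.
Proof.
move=> /negP w0; case: e e' => [] [] //; rewrite !(expr0, expr1, scale1r, scaleN1r).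
  by move=> /esym/eqP; rewrite -addr_eq0 => /eqP/qmx_double_eq0/eqP/w0.
by move=> /eqP; rewrite -addr_eq0 => /eqP/qmx_double_eq0/eqP/w0.
Qed.

Lemma sign_int_inj (e e' : bool) : (-1) ^+ e = (-1) ^+ e' :> int -> e = e'.
Proof. by case: e e' => [] []. Qed.

Section Generators.
Variables (R : realType) (n : nat).
Local Notation M := 'M[quat R]_n.
Implicit Type (G : set M).

(** What is used of a basis of G modulo its centre for the commutator form:
    together with the centre it has the same commutant as G, and the commutation
    signs with its members can be prescribed. *)
Record generators G (r : nat) (b : 'I_r -> M) : Prop := Generators {
  gen_in : forall l, G (b l);
  gen_comm : forall X, (forall l, b l *m X = X *m b l) ->
    (forall z, G z -> commutant G z -> z *m X = X *m z) -> commutant G X;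
  gen_sign : forall e : 'I_r -> bool, exists x, G x /\
    forall l, x *m b l = (-1) ^+ e l *: (b l *m x)
}.

Variables (G : set M) (hG : thick_pm_abelian G).
Local Notation C := (commutant G).

Lemma pma_square x : G x -> C (x *m x).
Proof.
move=> Gx y Gy; have [b yx] := pma_pm hG Gy Gx.
rewrite mulmxA yx -scalemxAl -mulmxA yx signmxAr scalerA -expr2 sqrr_sign scale1r.
by rewrite mulmxA.
Qed.

Lemma pma_anticommute x : G x -> ~ C x -> exists2 y, G y & x *m y = - (y *m x).
Proof.
move=> Gx ncx; apply: contrapT => ny; apply: ncx => y Gy.
have [[] xy] := pma_pm hG Gx Gy; last by rewrite xy expr0 scale1r.
by case: ny; exists y; rewrite // xy expr1 scaleN1r.
Qed.

Variables (r : nat) (b : 'I_r -> M) (hb : generators G b).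

(** Signs being adjustable by an element of G, a nonzero Y leads to an element
    of the commutant. *)
Lemma commutant_intertwiner (P : M -> Prop) (Y0 : M) :
  (forall Y l (c : bool), P Y -> P (Y + (-1) ^+ c *: (b l *m Y *m qadj (b l)))) ->
  (forall Y, P Y -> forall z, G z -> C z -> z *m Y = Y *m z) ->
  P Y0 -> Y0 != 0 ->
  exists Y x, [/\ P Y, Y != 0, G x & C (Y *m x)].
Proof.
move=> Pstep PZ PY0 Y0_neq0; have Gb := gen_in hb.
have [|l m|Y l PY|Y [PY Y_neq0 [e eP]]] := sign_intertwiner _ _ Pstep _ PY0 Y0_neq0.
- by move=> l; exact: (pma_unitary hG).
- by have [c bc] := pma_pm hG (Gb l) (Gb m); exists c.
- by apply: PZ => //; [exact: (pma_M hG)|exact: pma_square].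
have [x [Gx xP]] := gen_sign hb e.
exists Y, x; split=> //; apply: (gen_comm hb) => [l|z Gz cz].
  by rewrite mulmxA eP -mulmxA xP signmxAr -scalemxAl mulmxA.
by rewrite mulmxA (PZ _ PY) // -!mulmxA (cz _ Gx).
Qed.

Variables (s : nat) (p J : 'I_s -> M) (fr : frame G p J).

(** A matrix between two real blocks on which the centre acts by the same signs
    would yield a nonzero element of the commutant between these blocks, but the
    commutant is commutative. *)
Lemma block_separation i j : i != j -> exists z (e : bool),
  [/\ G z, C z, qadj z = z, z *m p i = (-1) ^+ e *: p i &
      z *m p j = (-1) ^+ (~~ e) *: p j].
Proof.
move=> ij.
have complex_sep k l : k != l -> J k *m J k = - p k -> exists z,
    [/\ G z, C z, qadj z = z, z *m p k = - p k & z *m p l = p l].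
  move=> kl JJ; pose th m : R := if m == k then pi else 0; exists (rotation J th).
  (* the half turn in the block k *)
  have zk m : rotation J th *m p m = if m == k then - p m else p m.
    have [-> |mk] := eqVneq m k.
      rewrite (rotation_p_complex fr) // /th eqxx cospi sinpi rmorphN1 rmorph0.
      by rewrite scaleN1r scale0r addr0.
    by rewrite (rotation_p fr) /th (negbTE mk) cos0 sin0 subrr rmorph0 !scale0r !addr0.
  split; [exact: (rotation_G hG fr) | exact: (rotation_C fr) | | by rewrite zk eqxx | ].
    apply: (fr_ext fr) => m; have cz := rotation_C fr th.
    rewrite -(commutant_commute hG (fr_comm fr m) (commutant_adj hG cz)).
    rewrite -{1}(fr_ph fr m) -qadjM zk.
    by case: ifP => _; rewrite ?raddfN /= (fr_ph fr).
  by rewrite zk eq_sym (negbTE kl).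
have [Ji|JJ] := fr_sq fr i; last first.
  have [z [Gz cz zh zi zj]] := complex_sep _ _ ij JJ.
  by exists z, true; split; rewrite ?expr1 ?scaleN1r ?expr0 ?scale1r.
have [Jj|JJ] := fr_sq fr j; last first.
  rewrite eq_sym in ij; have [z [Gz cz zh zi zj]] := complex_sep _ _ ij JJ.
  by exists z, false; split; rewrite ?expr1 ?scaleN1r ?expr0 ?scale1r.
apply: contrapT => nsep.
have same z : G z -> C z ->
    exists e : bool, z *m p i = (-1) ^+ e *: p i /\ z *m p j = (-1) ^+ e *: p j.
  move=> Gz cz; have [th [c [Gc cc ch ->]]] := centre_split hG fr Gz cz.
  have [e ce] := herm_p hG fr i Gc cc ch; have [e' ce'] := herm_p hG fr j Gc cc ch.
  rewrite -!mulmxA !(rotation_p_real fr) //; exists e; split=> //; rewrite ce'.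
  have [-> //|ee] := eqVneq e' e.
  have e'E : e' = ~~ e by case: (e) (e') ee => [] [].
  by case: nsep; exists c, e; rewrite -e'E.
(* H has no zero divisors *)
have [k [l Y0]] : exists k l, p j *m delta_mx k l *m p i != 0.
  apply: contrapT => /forallNP Y0.
  have [k [a pa]] : exists k a, p j k a != 0.
    apply: contrapT => /forallNP pz; case/negP: (fr_neq0 fr j).
    apply/eqP/matrixP => k a; rewrite mxE; apply/eqP/negPn/negP => pa.
    by case: (pz k); exists a.
  have [c [l pc]] : exists c l, p i c l != 0.
    apply: contrapT => /forallNP pz; case/negP: (fr_neq0 fr i).
    apply/eqP/matrixP => c l; rewrite mxE; apply/eqP/negPn/negP => pc.
    by case: (pz c); exists l.
  case: (Y0 a); exists c; apply/negP => /eqP/matrixP/(_ k l).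
  rewrite mxE (bigD1 c) //= big1 ?addr0 => [|d dc].
    rewrite mxE (bigD1 a) //= big1 ?addr0 => [|d da].
      rewrite !mxE !eqxx mulr1 => /qmul_eq0[] /eqP; exact/negP.
    by rewrite mxE (negbTE da) mulr0.
  by rewrite mxE big1 ?mul0r // => e _; rewrite mxE (negbTE dc) andbF mulr0.
pose P (Y : M) := p j *m Y = Y /\ Y *m p i = Y.
have PY0 : P (p j *m delta_mx k l *m p i).
  by split; rewrite ?mulmxA ?(fr_pp fr) // -mulmxA (fr_pp fr).
have Pstep Y m (c : bool) : P Y -> P (Y + (-1) ^+ c *: (b m *m Y *m qadj (b m))).
  move=> [pY Yp]; have Gb := gen_in hb m; have Gb' := pma_adj hG Gb.
  split; rewrite ?mulmxDr ?mulmxDl ?signmxAr -?scalemxAl.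
    by rewrite pY !mulmxA -(fr_comm fr j Gb) -[b m *m p j *m Y]mulmxA pY.
  by rewrite Yp -!mulmxA (fr_comm fr i Gb') [Y *m (_ *m _)]mulmxA Yp.
have PZ Y : P Y -> forall z, G z -> C z -> z *m Y = Y *m z.
  move=> [pY Yp] z Gz cz; have [e [zi zj]] := same z Gz cz.
  rewrite -{1}pY mulmxA zj -scalemxAl pY -{2}Yp -mulmxA.
  by rewrite (commutant_commute hG (fr_comm fr i) cz) zi signmxAr Yp.
have [Y [x [[pY Yp] Y_neq0 Gx cYx]]] := commutant_intertwiner Pstep PZ PY0 Y0.
case/negP: Y_neq0; apply/eqP.
have : Y *m x = 0.
  rewrite -pY -mulmxA (commutant_commute hG (fr_comm fr j) cYx) -{1}Yp -!mulmxA.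
  by rewrite [x *m p j](fr_comm fr j Gx) [p i *m (_ *m _)]mulmxA (fr_orth fr) // mul0mx mulmx0.
move=> /(congr1 (fun X => X *m qadj x)).
by rewrite -mulmxA (pma_unitary hG) // mulmx1 mul0mx.
Qed.

(** A component of v in some block is nonzero, which makes chi the character of
    that block; no other block has the same character. *)
Lemma block_of_character (chi : M -> bool) (v : 'cV[quat R]_n) : v != 0 ->
  (forall z, G z -> C z -> qadj z = z -> z *m v = (-1) ^+ chi z *: v) ->
  exists i, [set w | forall z, G z -> C z -> qadj z = z -> z *m w = (-1) ^+ chi z *: w]
    = img (p i).
Proof.
move=> v0 vchi.
have [i pv] : exists i, p i *m v != 0.
  apply: contrapT => /forallNP pv; case/negP: v0; apply/eqP.
  rewrite (fr_decomp fr v) big1 // => i _.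
  by apply/eqP; have /negP := pv i; rewrite negbK.
have chip (w : 'cV[quat R]_n) k :
    (forall z, G z -> C z -> qadj z = z -> z *m w = (-1) ^+ chi z *: w) ->
    p k *m w != 0 -> forall z, G z -> C z -> qadj z = z -> z *m p k = (-1) ^+ chi z *: p k.
  move=> wchi pw z Gz cz zh; have [e ze] := herm_p hG fr k Gz cz zh.
  suff -> : chi z = e by [].
  apply: (sign_scale_inj pw).
  rewrite -signmxAr -wchi // mulmxA (commutant_commute hG (fr_comm fr k) cz) ze.
  by rewrite -scalemxAl.
exists i; apply/seteqP; split=> w /= wP; last first.
  move=> z Gz cz zh; rewrite -wP mulmxA (chip v i) // -scalemxAl //.
rewrite /img /= [RHS](fr_decomp fr w) (bigD1 i) //= big1 ?addr0 // => j ji.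
apply/eqP/negPn/negP => pw.
have [z [e [Gz cz zh zj zi]]] := block_separation ji.
have := chip _ _ wP pw z Gz cz zh; rewrite zj => /(sign_scale_inj (fr_neq0 fr j)) e1.
have := chip _ _ vchi pv z Gz cz zh; rewrite zi => /(sign_scale_inj (fr_neq0 fr i)).
by rewrite -e1; case: (e).
Qed.

Lemma character_of_block i : exists chi : M -> bool,
  [set w | forall z, G z -> C z -> qadj z = z -> z *m w = (-1) ^+ chi z *: w]
    = img (p i).
Proof.
have /choice[chi chiP] : forall z, exists e : bool, G z -> C z -> qadj z = z ->
    z *m p i = (-1) ^+ e *: p i.
  move=> z; have [[Gz cz zh]|nz] := pselect [/\ G z, C z & qadj z = z].
    by have [e ze] := herm_p hG fr i Gz cz zh; exists e.
  by exists false => Gz cz zh; case: nz.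
exists chi; apply/seteqP; split=> w /= wP; last first.
  by move=> z Gz cz zh; rewrite -wP mulmxA chiP // -scalemxAl.
rewrite /img /= [RHS](fr_decomp fr w) (bigD1 i) //= big1 ?addr0 // => j ji.
apply/eqP/negPn/negP => pw.
have [z [e [Gz cz zh zj zi]]] := block_separation ji.
have : (-1) ^+ chi z *: p i = (-1) ^+ (~~ e) *: p i by rewrite -chiP.
move=> /(sign_scale_inj (fr_neq0 fr i)) chiE.
have : (-1) ^+ e *: (p j *m w) = (-1) ^+ chi z *: (p j *m w).
  by rewrite -[RHS]signmxAr -wP // mulmxA (commutant_commute hG (fr_comm fr j) cz) zj -scalemxAl.
by move=> /(sign_scale_inj pw); rewrite chiE; case: (e).
Qed.

End Generators.

(** * Dimension of the blocks *)

Section Bessel.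
Variables (R : realType) (n : nat).
Local Notation H := (quat R).
Local Notation M := 'M[H]_n.

Definition qunit (c : 'I_4) : H := (delta_mx 0 c : 'rV[R]_4).

Lemma qunitE (c : 'I_4) :
  qunit c = mkquat (c == 0)%:R (c == 1)%:R (c == 2%:R)%:R (c == 3%:R)%:R.
Proof.
by apply/quatP; rewrite !mkquatE /qre /qi /qj /qk /qunit !mxE eqxx /= eq_sym.
Qed.

Lemma qre_unit_conj c q : qre (qunit c * qconj q) = (q : 'rV[R]_4) 0 c.
Proof.
by rewrite quatME /qmul qunitE /qconj !mkquatE; case: (ord4P c) => ->;
   rewrite /= !(mul0r, mul1r, subr0, sub0r, opprK, oppr0, addr0).
Qed.

Lemma sum_qunit_conj q : \sum_c qunit c * q * qconj (qunit c) = rq (4 * qre q).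
Proof.
have [e0 e1] : qunit ord0 = mkquat 1 0 0 0 /\ qunit (lift ord0 ord0) = mkquat 0 1 0 0.
  by rewrite !qunitE.
have [e2 e3] : qunit (lift ord0 (lift ord0 ord0)) = mkquat 0 0 1 0 /\
    qunit (lift ord0 (lift ord0 (lift ord0 ord0))) = mkquat 0 0 0 1.
  by rewrite !qunitE.
have s1 : mkquat 0 1 0 0 * q = mkquat (- qi q) (qre q) (- qk q) (qj q).
  by apply/quatP; rewrite quatME /qmul !mkquatE; ring.
have s2 : mkquat 0 0 1 0 * q = mkquat (- qj q) (qk q) (qre q) (- qi q).
  by apply/quatP; rewrite quatME /qmul !mkquatE; ring.
have s3 : mkquat 0 0 0 1 * q = mkquat (- qk q) (- qj q) (qi q) (qre q).
  by apply/quatP; rewrite quatME /qmul !mkquatE; ring.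
rewrite !big_ord_recl big_ord0 addr0 e0 e1 e2 e3 s1 s2 s3 (_ : mkquat 1 0 0 0 = 1) //.
rewrite mul1r qconj1 mulr1.
by apply/quatP; rewrite !quatDE !quatME /qmul /qconj /rq !mkquatE; ring.
Qed.

Definition qunit_mx (x : 'I_n * 'I_n * 'I_4) : M := qunit x.2 *: delta_mx x.1.1 x.1.2.

Lemma mul_qunit_mx (A : M) a b c i k :
  (A *m qunit_mx (a, b, c)) i k = A i a * qunit c *+ (k == b).
Proof.
rewrite mxE (bigD1 a) //= big1 ?addr0 => [|j ja].
  by rewrite !mxE eqxx /= mulrA mulr_natr.
by rewrite !mxE (negbTE ja) /= !mulr0.
Qed.

Lemma mul_qunit_mx_adj (A : M) a b c i k :
  (A *m qadj (qunit_mx (a, b, c))) i k = A i b * qconj (qunit c) *+ (k == a).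
Proof.
rewrite mxE (bigD1 b) //= big1 ?addr0 => [|j jb].
  by rewrite !mxE eqxx andbT; case: (k == a); rewrite /= ?mulr1 ?mulr0 ?qconj0 ?mulr0.
by rewrite !mxE (negbTE jb) andbF mulr0 qconj0 mulr0.
Qed.

Lemma tau_qunit_mx x (Q : M) : tau (qunit_mx x *m qadj Q) = qcoord x.1.1 x.1.2 x.2 Q.
Proof.
case: x => [[a b] c]; rewrite tauC /tau /mxtrace (bigD1 b) //= big1 ?addr0 => [|j jb].
  by rewrite mul_qunit_mx eqxx !mxE qreC qre_unit_conj.
by rewrite mul_qunit_mx (negbTE jb).
Qed.

Lemma parseval (Q : M) : \sum_x tau (qunit_mx x *m qadj Q) ^+ 2 = tau (Q *m qadj Q).
Proof.
rewrite tau_mul_adj pair_bigA /= -(pair_bigA _ (fun ab c => tau (qunit_mx (ab, c) *m qadj Q) ^+ 2)) /=.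
apply: eq_bigr => -[a b] _; rewrite /qnormsq.
under eq_bigr do rewrite tau_qunit_mx /qcoord /=.
rewrite !big_ord_recl big_ord0 addr0 /= !addrA /qre /qi /qj /qk.
by congr (_ ^+ 2 + _ ^+ 2 + _ ^+ 2 + _ ^+ 2); congr (fun_of_matrix _ _ _); exact: val_inj.
Qed.

(** The sum of u q u^* over the four units u is 4 Re q. *)
Lemma casimir (A B : M) :
  \sum_x tau (A *m qunit_mx x *m (B *m qadj (qunit_mx x))) = 4 * tau A * tau B.
Proof.
have trE x : tau (A *m qunit_mx x *m (B *m qadj (qunit_mx x))) =
    qre (A x.1.1 x.1.1 * (qunit x.2 * B x.1.2 x.1.2 * qconj (qunit x.2))).
  case: x => [[a b] c]; rewrite /tau /mxtrace (bigD1 a) //= big1 ?addr0 => [|i ia].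
    rewrite mxE (bigD1 b) //= big1 ?addr0 => [|j jb].
      by rewrite mul_qunit_mx mul_qunit_mx_adj !eqxx /= !mulr1n !mulrA.
    by rewrite mul_qunit_mx (negbTE jb) mul0r.
  by rewrite mxE big1 // => j _; rewrite mul_qunit_mx_adj (negbTE ia) mulr0.
under eq_bigr do rewrite trE.
rewrite -(pair_bigA _ (fun ab c => qre (A ab.1 ab.1 * (qunit c * B ab.2 ab.2 * qconj (qunit c))))) /=.
under eq_bigr do rewrite -raddf_sum -mulr_sumr sum_qunit_conj -rqC /= qre_rqM.
rewrite -(pair_bigA _ (fun a b => 4 * qre (B b b) * qre (A a a))) /=.
rewrite /tau /mxtrace !raddf_sum /= -mulrA mulr_suml mulr_sumr; apply: eq_bigr => a _.
by rewrite 2!mulr_sumr; apply: eq_bigr => b _; ring.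
Qed.

Lemma tau_adjC (X Y : M) : tau (X *m qadj Y) = tau (Y *m qadj X).
Proof. by rewrite -tau_adj qadjM qadjK. Qed.

Lemma tau_normB (X Z : M) : tau ((X - Z) *m qadj (X - Z)) =
  tau (X *m qadj X) - 2 * tau (X *m qadj Z) + tau (Z *m qadj Z).
Proof.
have tB (A B : M) : tau (A - B) = tau A - tau B by exact: raddfB.
have -> : qadj (X - Z) = qadj X - qadj Z by exact: raddfB.
rewrite mulmxBr (mulmxBl X Z (qadj X)) (mulmxBl X Z (qadj Z)).
move: (tau_adjC X Z); move: (X *m qadj X) (X *m qadj Z) (Z *m qadj X) (Z *m qadj Z).
by move=> A B B' D BB; rewrite !tB -BB; move: (tau A) (tau B) (tau D) => u v w; ring.
Qed.

(** Bessel's inequality for the projections p E p of the standard basis, in the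
    real Euclidean space p M p, whose dimension is thus 4 tau(p)^2; equality
    holds when the orthogonal family is complete. *)
Lemma bessel (p : M) (T : finType) (Q : T -> M) :
  is_proj p -> 0 < tau p -> (forall t, p *m Q t = Q t) -> (forall t, Q t *m p = Q t) ->
  (forall t u, tau (Q t *m qadj (Q u)) = if t == u then tau p else 0) ->
  #|T|%:R <= 4 * tau p ^+ 2 /\
  ((forall Y, p *m Y = Y -> Y *m p = Y -> (forall t, tau (Y *m qadj (Q t)) = 0) -> Y = 0) ->
    4 * tau p ^+ 2 = #|T|%:R).
Proof.
move=> [ph pp]; set d := tau p => d0 pQ Qp QQ.
pose Y x := p *m qunit_mx x *m p.
pose c x t := tau (Y x *m qadj (Q t)) / d.
pose S x := \sum_t rq (c x t) *: Q t.
have cE x t : tau (Y x *m qadj (Q t)) = c x t * d by rewrite /c divfK ?gt_eqF.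
have BS x (X : M) : tau (X *m qadj (S x)) = \sum_t c x t * tau (X *m qadj (Q t)).
  rewrite /S raddf_sum mulmx_sumr raddf_sum /=; apply: eq_bigr => t _.
  by rewrite qadjZ rqmxAr tauZ.
have SQ x u : tau (S x *m qadj (Q u)) = c x u * d.
  rewrite tau_adjC BS (bigD1 u) //= QQ eqxx big1 ?addr0 // => t tu.
  by rewrite QQ eq_sym (negbTE tu) mulr0.
have norm_r x : tau ((Y x - S x) *m qadj (Y x - S x)) =
    tau (Y x *m qadj (Y x)) - d * \sum_t c x t ^+ 2.
  have YS : tau (Y x *m qadj (S x)) = d * \sum_t c x t ^+ 2.
    by rewrite BS mulr_sumr; apply: eq_bigr => t _; rewrite cE; ring.
  have SS : tau (S x *m qadj (S x)) = d * \sum_t c x t ^+ 2.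
    by rewrite BS mulr_sumr; apply: eq_bigr => t _; rewrite SQ; ring.
  by rewrite tau_normB YS SS; ring.
have YQ x t : tau (Y x *m qadj (Q t)) = tau (qunit_mx x *m qadj (Q t)).
  have Qp' : qadj (Q t) *m p = qadj (Q t) by rewrite -{1}ph -qadjM pQ.
  have pQ' : p *m qadj (Q t) = qadj (Q t) by rewrite -{1}ph -qadjM Qp.
  by rewrite /Y -!mulmxA pQ' tauC -mulmxA Qp'.
have sum_c t : \sum_x c x t ^+ 2 = d^-1.
  under eq_bigr do rewrite /c exprMn YQ.
  by rewrite -mulr_suml parseval QQ eqxx exprVn expr2 invfM mulrA divff ?mul1r ?gt_eqF.
have sum_Y : \sum_x tau (Y x *m qadj (Y x)) = 4 * d ^+ 2.
  rewrite expr2 mulrA -casimir; apply: eq_bigr => x _.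
  rewrite /Y !qadjM ph !mulmxA -[_ *m p *m p *m qadj _]mulmxA tauC !mulmxA pp.
  by rewrite -!mulmxA [p *m (p *m _)]mulmxA pp.
have sum_r : \sum_x tau ((Y x - S x) *m qadj (Y x - S x)) = 4 * d ^+ 2 - #|T|%:R.
  under eq_bigr do rewrite norm_r.
  rewrite sumrB sum_Y -mulr_sumr exchange_big /=.
  by under eq_bigr do rewrite sum_c; rewrite sumr_const mulrnAr divff ?gt_eqF.
split=> [|complete].
  by rewrite -subr_ge0 -sum_r; apply: sumr_ge0 => x _; exact: tau_ge0.
apply/eqP; rewrite -subr_eq0 -sum_r big1 // => x _.
rewrite (complete (Y x - S x)) ?mul0mx ?raddf0 //.
- rewrite mulmxBr /Y !mulmxA pp /S mulmx_sumr; congr (_ - _).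
  by apply: eq_bigr => t _; rewrite rqmxAr pQ.
- rewrite mulmxBl /Y -!mulmxA pp /S mulmx_suml; congr (_ - _).
  by apply: eq_bigr => t _; rewrite -scalemxAl Qp.
- by move=> t; rewrite mulmxBl raddfB /= SQ cE subrr.
Qed.

End Bessel.

Section BlockDimension.
Variables (R : realType) (n : nat).
Local Notation M := 'M[quat R]_n.

Record coset_transversal (G : set M) (T : finType) (A : T -> M) : Prop := Transversal {
  tr_in : forall t, G (A t);
  tr_inj : forall t u, commutant G (A t *m qadj (A u)) -> t = u;
  tr_cover : forall x, G x -> exists t z, [/\ G z, commutant G z & x = A t *m z]
}.

Variables (G : set M) (hG : thick_pm_abelian G).
Local Notation C := (commutant G).
Variables (r : nat) (b : 'I_r -> M) (hb : generators G b).
Variables (T : finType) (A : T -> M) (hA : coset_transversal G A).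
Variables (s : nat) (p J : 'I_s -> M) (fr : frame G p J).

(** A noncentral element is conjugate to its opposite. *)
Lemma tau_noncentral x X : G x -> ~ C x -> C X -> tau (x *m X) = 0.
Proof.
move=> Gx ncx cX; have [y Gy xy] := pma_anticommute hG Gx ncx.
have : tau (x *m X) = - tau (x *m X).
  rewrite -raddfN /= -mulNmx -{1}[x]mulmx1 -(pma_unitary hG Gy) mulmxA xy.
  rewrite 3!mulNmx !raddfN /=; congr (- _).
  rewrite -!mulmxA (cX _ (pma_adj hG Gy)) tauC -!mulmxA.
  by rewrite (pma_unitary_l hG Gy) mulmx1.
lra.
Qed.

Lemma tau_transversal t u X : C X ->
  tau (A t *m qadj (A u) *m X) = if t == u then tau X else 0.
Proof.
move=> cX; have GAt := tr_in hA t; have GAu := tr_in hA u.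
case: eqVneq => [->|tu]; first by rewrite (pma_unitary hG) // mul1mx.
apply: tau_noncentral => //; first by apply: (pma_M hG) => //; exact: (pma_adj hG).
by move=> /(tr_inj hA) tu'; rewrite tu' eqxx in tu.
Qed.

Lemma transversal_gram (K L : M) t u : C K -> C L ->
  tau ((A t *m K) *m qadj (A u *m L)) = if t == u then tau (K *m qadj L) else 0.
Proof.
move=> cK cL; have cL' := commutant_adj hG cL; have GAu := tr_in hA u.
rewrite qadjM -mulmxA [K *m _]mulmxA -(commutantM cK cL') ?mulmxA.
  by rewrite -[_ *m K *m qadj L]mulmxA tau_transversal //; exact: commutantM.
exact: (pma_adj hG).
Qed.

(** The A t p are orthogonal, and complete: a nonzero Y orthogonal to all of them
    would lead to a nonzero element of the commutant supported on the block, that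
    is a multiple of p, orthogonal to p. *)
Lemma real_block_dim i : J i = 0 -> 4 * tau (p i) ^+ 2 = #|T|%:R.
Proof.
move=> J0; have pC := fr_comm fr i.
have zp z : G z -> C z -> exists l : R, z *m p i = rq l *: p i.
  move=> Gz cz; have [al [be ->]] := fr_span fr i cz.
  by exists al; rewrite J0 scaler0 addr0.
have [] := @bessel _ _ (p i) T (fun t => A t *m p i) (fr_proj fr i) (fr_tau_gt0 fr i).
- by move=> t /=; rewrite mulmxA -(pC _ (tr_in hA t)) -mulmxA (fr_pp fr).
- by move=> t /=; rewrite -mulmxA (fr_pp fr).
- by move=> t u; rewrite transversal_gram // (fr_ph fr) (fr_pp fr).
move=> _; apply=> Y0 pY0 Y0p Y0A.
apply/eqP/negPn/negP => Y0_neq0.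
pose P (Y : M) := [/\ p i *m Y = Y, Y *m p i = Y & forall x, G x -> tau (Y *m x) = 0].
have PY0 : P Y0.
  split=> // x Gx; have [t [z [Gz cz xE]]] := tr_cover hA (pma_adj hG Gx).
  have [l zl] := zp _ (pma_adj hG Gz) (commutant_adj hG cz).
  have -> : x = qadj z *m qadj (A t) by rewrite -qadjM -xE qadjK.
  have cz' := commutant_adj hG cz.
  rewrite -{1}Y0p -!mulmxA [p i *m _]mulmxA (commutant_commute hG pC cz') zl.
  rewrite -scalemxAl rqmxAr tauZ.
  have := Y0A t; rewrite qadjM (fr_ph fr) => ->; exact: mulr0.
have Pstep Y m (c : bool) : P Y -> P (Y + (-1) ^+ c *: (b m *m Y *m qadj (b m))).
  move=> [pY Yp Yx]; have Gb := gen_in hb m; have Gb' := pma_adj hG Gb.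
  split; rewrite ?mulmxDr ?mulmxDl ?signmxAr -?scalemxAl.
  - by rewrite pY !mulmxA -(pC _ Gb) -[b m *m p i *m Y]mulmxA pY.
  - by rewrite Yp -!mulmxA (pC _ Gb') [Y *m (_ *m _)]mulmxA Yp.
  - move=> x Gx; rewrite mulmxDl raddfD /= -scalemxAl tau_sign Yx // add0r.
    rewrite -!mulmxA tauC -!mulmxA Yx ?mulr0 //.
    by apply: (pma_M hG) => //; apply: (pma_M hG).
have PZ Y : P Y -> forall z, G z -> C z -> z *m Y = Y *m z.
  move=> [pY Yp _] z Gz cz; have [l zl] := zp z Gz cz.
  rewrite -{1}pY mulmxA zl -scalemxAl pY -{2}Yp -mulmxA.
  by rewrite (commutant_commute hG pC cz) zl rqmxAr Yp.
have [Y [x [[pY Yp Yx] Y_neq0 Gx cYx]]] := commutant_intertwiner hG hb Pstep PZ PY0 Y0_neq0.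
have [al [be]] := fr_span fr i cYx.
rewrite J0 scaler0 addr0 -mulmxA (pC _ Gx) mulmxA Yp => YxE.
have := Yx _ Gx; rewrite YxE tauZ => /eqP.
rewrite mulf_eq0 (gt_eqF (fr_tau_gt0 fr i)) orbF => /eqP al0.
case/negP: Y_neq0; apply/eqP.
have := congr1 (fun X => X *m qadj x) YxE.
by rewrite al0 rmorph0 scale0r mul0mx -mulmxA (pma_unitary hG) // mulmx1.
Qed.

(** With A t J the orthogonal family is twice as large. It is not complete, but
    the inequality suffices to tell complex blocks from real ones. *)
Lemma complex_block_dim i : J i <> 0 -> (2 * #|T|)%:R <= 4 * tau (p i) ^+ 2.
Proof.
move=> J0; have pC := fr_comm fr i; have JC := fr_Jcomm fr i.
have JJ : J i *m J i = - p i by case: (fr_sq fr i).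
pose K (e : bool) := if e then p i else J i.
have KC e : C (K e) by case: e.
have pK e : p i *m K e = K e by case: e; rewrite /K ?(fr_pp fr) ?(fr_pJ hG fr).
have Kp e : K e *m p i = K e by case: e; rewrite /K ?(fr_pp fr) ?(fr_Jp fr).
have tauJ : tau (J i) = 0 by have := tau_adj (J i); rewrite (fr_skew fr) raddfN /=; lra.
have KK e f : tau (K e *m qadj (K f)) = if e == f then tau (p i) else 0.
  case: e f => [] []; rewrite /K /= ?(fr_ph fr) ?(fr_skew fr) ?mulmxN ?(fr_pp fr) //.
  - by rewrite (fr_pJ hG fr) raddfN /= tauJ oppr0.
  - by rewrite (fr_Jp fr).
  - by rewrite JJ opprK.
have [] := @bessel _ _ (p i) (bool * T)%type (fun et => A et.2 *m K et.1)
  (fr_proj fr i) (fr_tau_gt0 fr i).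
- by move=> [e t] /=; rewrite mulmxA -(pC _ (tr_in hA t)) -mulmxA pK.
- by move=> [e t] /=; rewrite -mulmxA Kp.
- move=> [e t] [f u] /=; rewrite transversal_gram // KK xpair_eqE andbC.
  by case: (t == u); case: (e == f).
by rewrite card_prod card_bool.
Qed.

End BlockDimension.

(** * Conjugacy of two groups with the same invariants *)

Section Normalization.
Variables (R : realType) (n : nat).
Local Notation M := 'M[quat R]_n.
Variables (G : set M) (hG : thick_pm_abelian G).
Local Notation C := (commutant G).
Variables (r : nat) (b : 'I_r -> M) (hb : generators G b).
Variables (s : nat) (p J : 'I_s -> M) (fr : frame G p J).

(** On a complex block the square of a generator is a rotation; half of it can
    be taken off the generator without touching the real blocks. *)
Lemma normalize_generators : exists b1 : 'I_r -> M, [/\ generators G b1,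
  forall l, exists u, [/\ G u, C u, b1 l = b l *m u & forall i, J i = 0 -> u *m p i = p i] &
  forall i l, J i <> 0 -> b1 l *m b1 l *m p i = p i].
Proof.
have Gb := gen_in hb.
have /choice[th thP] : forall l, exists th : 'I_s -> R, forall i, J i = 0 \/
    J i *m J i = - p i /\
    b l *m b l *m p i = rq (cos (th i)) *: p i + rq (sin (th i)) *: J i.
  move=> l; apply: (centre_angles hG fr); first exact: (pma_M hG).
  exact: pma_square.
pose u l := rotation J (fun i => - (th l i / 2)).
have Gu l : G (u l) := rotation_G hG fr _; have Cu l : C (u l) := rotation_C fr _.
exists (fun l => b l *m u l); split.
- split=> [l|X bX ZX|e]; first exact: (pma_M hG).
    apply: (gen_comm hb) => // l.
    have bE : b l = b l *m u l *m qadj (u l).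
      by rewrite -mulmxA (pma_unitary hG) // mulmx1.
    have Zu := ZX _ (pma_adj hG (Gu l)) (commutant_adj hG (Cu l)).
    have bX' : b l *m u l *m X = X *m (b l *m u l) := bX l.
    by rewrite bE -[LHS]mulmxA Zu [LHS]mulmxA bX' [RHS]mulmxA.
  have [x [Gx xP]] := gen_sign hb e; exists x; split=> // l.
  by rewrite mulmxA xP -scalemxAl -!mulmxA (Cu l _ Gx).
- move=> l; exists (u l); split=> // i J0; exact: (rotation_p_real fr).
- move=> i l J0; have [//|[JJ bp]] := thP l i.
  have -> : b l *m u l *m (b l *m u l) *m p i = b l *m b l *m (u l *m u l *m p i).
    by rewrite -!mulmxA [u l *m (b l *m _)]mulmxA -(Cu l _ (Gb l)) -!mulmxA.
  rewrite (rotationD hG fr).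
  have -> : rotation J (fun j => - (th l j / 2) + - (th l j / 2)) *m p i =
      rotation J (fun j => - th l j) *m p i.
    by rewrite !(rotation_p fr) -opprD -splitr.
  rewrite -(commutant_commute hG (fr_comm fr i) (rotation_C fr _)) mulmxA bp.
  rewrite -(rotation_p_complex fr) // -mulmxA.
  rewrite (commutant_commute hG (fr_comm fr i) (rotation_C fr _)) mulmxA (rotationD hG fr).
  by rewrite (rotation_p fr) subrr cos0 sin0 subrr rmorph0 !scale0r !addr0.
Qed.

End Normalization.

Section Conjugacy.
Variables (R : realType) (n : nat).
Local Notation M := 'M[quat R]_n.
Variables (G G' : set M) (hG : thick_pm_abelian G) (hG' : thick_pm_abelian G').
Local Notation C := (commutant G).
Local Notation C' := (commutant G').
Variables (r : nat) (b b' : 'I_r -> M) (hb : generators G b) (hb' : generators G' b').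
Hypothesis b_sign : forall l m, exists c : bool,
  b l *m b m = (-1) ^+ c *: (b m *m b l) /\ b' l *m b' m = (-1) ^+ c *: (b' m *m b' l).
Variables (s s' : nat) (p J : 'I_s -> M) (p' J' : 'I_s' -> M).
Variables (fr : frame G p J) (fr' : frame G' p' J').
Variables (a : M) (aU : a *m qadj a = 1%:M) (idx : 'I_s -> 'I_s').
Hypothesis idxP : forall i, p' (idx i) = a *m p i *m qadj a.
Hypothesis idxJ : forall i, J i = 0 <-> J' (idx i) = 0.

Let aU' : qadj a *m a = 1%:M := qmulmx1C aU.

Lemma idx_pa i : p' (idx i) *m a = a *m p i.
Proof. by rewrite idxP -mulmxA aU' mulmx1. Qed.

Section OneBlock.
Variable i : 'I_s.
Hypothesis b_square : forall l, exists e : bool,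
  b l *m b l *m p i = (-1) ^+ e *: p i /\
  b' l *m b' l *m p' (idx i) = (-1) ^+ e *: p' (idx i).

(** A nonzero intertwiner T from the block i to its translate by a, also
    compatible with the complex structures up to sign; T^* T is a positive
    scalar on the block since it lies in the commutant. *)
Lemma block_intertwiner : exists g : M,
  [/\ g *m p i = g, p' (idx i) *m g = g, qadj g *m g = p i,
      forall l, b' l *m g = g *m b l &
      exists d : bool, J' (idx i) *m g = (-1) ^+ d *: (g *m J i)].
Proof.
set q := p' (idx i); set K := J' (idx i).
have Gb := gen_in hb; have Gb' := gen_in hb'.
have pC := fr_comm fr i; have qC : C' q := fr_comm fr' _.
have JC := fr_Jcomm fr i; have KC : C' K := fr_Jcomm fr' _.
have qa : q *m a = a *m p i := idx_pa i.
(* One of these two intertwines J and J' up to the sign d, their sum being 2 a p. *)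
pose Y d := a *m p i + (-1) ^+ d *: (K *m (a *m p i) *m qadj (J i)).
have [d Yd] : exists d : bool, Y d != 0.
  apply: contrapT => /forallNP Y0; case/negP: (fr_neq0 fr i); apply/eqP.
  have Y0' (d : bool) : Y d = 0 by apply/eqP; have /negP := Y0 d; rewrite negbK.
  have : a *m p i = 0.
    apply: qmx_double_eq0; rewrite -[RHS]addr0 -{1}(Y0' true) -(Y0' false) /Y.
    by rewrite /= expr0 expr1 scale1r scaleN1r addrACA addNr addr0.
  by move=> /(congr1 (mulmx (qadj a))); rewrite mulmxA aU' mul1mx mulmx0.
pose P (Z : M) := [/\ q *m Z = Z, Z *m p i = Z & K *m Z = (-1) ^+ d *: (Z *m J i)].
have PY : P (Y d).
  split; rewrite /Y.
  - rewrite mulmxDr signmxAr; congr (_ + _ *: _).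
      by rewrite mulmxA qa -mulmxA (fr_pp fr).
    by rewrite !mulmxA (fr_pJ hG' fr' (idx i)).
  - rewrite mulmxDl -scalemxAl -!mulmxA (fr_pp fr); congr (_ + _ *: (_ *m (_ *m _))).
    by rewrite (fr_skew fr) mulNmx (fr_Jp fr).
  - rewrite mulmxDr mulmxDl scalerDr signmxAr -scalemxAl scalerA -expr2 sqrr_sign scale1r.
    rewrite addrC; apply: (congr2 +%R).
      have [J0|JJ] := fr_sq fr i.
        by rewrite J0 raddf0 !mulmx0 // !scaler0.
      have KK : K *m K = - q.
        case: (fr_sq fr' (idx i)) => // K0.
        have J0 := (idxJ i).2 K0; move: JJ; rewrite J0 mulmx0 => /eqP.
        by rewrite eq_sym oppr_eq0 (negbTE (fr_neq0 fr i)).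
      congr (_ *: _); rewrite !mulmxA KK (fr_skew fr) !mulNmx mulmxN opprK qa.
      by rewrite -[a *m p i *m p i]mulmxA (fr_pp fr).
    have [J0|JJ] := fr_sq fr i.
      by have K0 : K = 0 := (idxJ i).1 J0; rewrite K0 !mul0mx.
    by rewrite -!mulmxA (fr_skew fr) mulNmx JJ opprK (fr_pp fr).
have Pstep Z m (c : bool) : P Z -> P (Z + (-1) ^+ c *: (b' m *m Z *m qadj (b m))).
  move=> [qZ Zp KZ]; have Gbm' := pma_adj hG (Gb m).
  split; rewrite ?mulmxDr ?mulmxDl ?signmxAr -?scalemxAl.
  - by rewrite qZ !mulmxA -(qC _ (Gb' m)) -[b' m *m q *m Z]mulmxA qZ.
  - by rewrite Zp -!mulmxA (pC _ Gbm') [Z *m (_ *m _)]mulmxA Zp.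
  - rewrite scalerDr KZ; congr (_ + _).
    rewrite !mulmxA -(KC _ (Gb' m)) -[b' m *m K *m Z]mulmxA KZ signmxAr -!scalemxAl.
    by rewrite -!mulmxA -(JC _ Gbm') !scalerA -!exprD addnC.
have Psq Z l : P Z -> b' l *m b' l *m Z = Z *m (b l *m b l).
  move=> [qZ Zp _]; have [e [be be']] := b_square l.
  rewrite -{1}qZ mulmxA be' -scalemxAl qZ -{2}Zp -mulmxA.
  by rewrite -(pC _ (pma_M hG (Gb l) (Gb l))) be signmxAr Zp.
have [l|Z [[qZ Zp KZ] Z_neq0 [e eZ]]] := sign_intertwiner _ b_sign Pstep Psq PY Yd.
  exact: (pma_unitary hG).
have [x [Gx xb]] := gen_sign hb e.
pose T := Z *m x.
have T_neq0 : T != 0.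
  apply: contra Z_neq0 => /eqP T0; apply/eqP.
  have := congr1 (fun X => X *m qadj x) T0.
  by rewrite mul0mx -mulmxA (pma_unitary hG) // mulmx1.
have qT : q *m T = T by rewrite mulmxA qZ.
have Tp : T *m p i = T by rewrite -mulmxA (pC _ Gx) mulmxA Zp.
have KT : K *m T = (-1) ^+ d *: (T *m J i).
  by rewrite mulmxA KZ -scalemxAl -!mulmxA (JC _ Gx).
have bT l : b' l *m T = T *m b l.
  by rewrite mulmxA eZ -scalemxAl -!mulmxA xb signmxAr.
pose W := qadj T *m T.
have Wh : qadj W = W by rewrite qadjM qadjK.
have Wp : W *m p i = W by rewrite -mulmxA Tp.
have pW : p i *m W = W by rewrite -{1}(fr_ph fr i) mulmxA -qadjM Tp.
have JW : J i *m W = W *m J i.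
  have KT' : (-1) ^+ d *: (J i *m qadj T) = qadj T *m K.
    have := congr1 (@qadj _ _ _) KT; rewrite qadj_sign !qadjM (fr_skew fr).
    rewrite -[qadj K]/(qadj (J' (idx i))) (fr_skew fr') mulmxN mulNmx scalerN.
    by move/oppr_inj.
  have -> : J i *m W = (-1) ^+ d *: (qadj T *m K) *m T.
    by rewrite -KT' scalerA -expr2 sqrr_sign scale1r mulmxA.
  by rewrite -scalemxAl -mulmxA KT signmxAr scalerA -expr2 sqrr_sign scale1r mulmxA.
have CW : C W.
  apply: (gen_comm hb) => [l|z Gz cz].
    have bT' : b l *m qadj T = qadj T *m b' l.
      have := congr1 (@qadj _ _ _) (bT l); rewrite !qadjM => h.
      have := congr1 (fun X => b l *m X *m b' l) h.
      rewrite -!mulmxA (pma_unitary_l hG' (Gb' l)) mulmx1 => ->.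
      by rewrite !mulmxA (pma_unitary hG (Gb l)) mul1mx.
    by rewrite mulmxA bT' -mulmxA bT mulmxA.
  have [al [be zp]] := fr_span fr i cz.
  rewrite -{1}pW mulmxA zp -{2}Wp -mulmxA (commutant_commute hG pC cz) zp.
  by rewrite mulmxDl mulmxDr -!scalemxAl !rqmxAr pW Wp JW.
have [al Wal] := fr_herm_span hG fr i CW Wh; rewrite Wp in Wal.
have al0 : 0 < al.
  have : 0 < tau W.
    rewrite /W tauC lt_def tau_ge0 andbT.
    by apply: contra T_neq0 => /eqP/tau_eq0 ->.
  by rewrite Wal tauZ; have := fr_tau_gt0 fr i; nra.
exists (rq (Num.sqrt al)^-1 *: T); split.
- by rewrite -scalemxAl Tp.
- by rewrite rqmxAr qT.
- rewrite qadjZ rqmxAr -scalemxAl -/W Wal !scalerA -!rmorphM.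
  by rewrite -invfM -expr2 sqr_sqrtr ?(ltW al0) // mulVf ?gt_eqF // rmorph1 scale1r.
- by move=> l; rewrite rqmxAr bT -scalemxAl.
- exists d; rewrite rqmxAr KT -scalemxAl !scalerA; congr (_ *: _).
  by case: (d); rewrite ?expr0 ?expr1 ?mulr1 ?mul1r ?mulrN1 ?mulN1r.
Qed.

End OneBlock.

Hypothesis b_square : forall i l, exists e : bool,
  b l *m b l *m p i = (-1) ^+ e *: p i /\
  b' l *m b' l *m p' (idx i) = (-1) ^+ e *: p' (idx i).
Hypothesis conj_a : forall z, G z -> C z -> qadj z = z -> G' (a *m z *m qadj a).
Hypothesis conj_a' : forall z, G' z -> C' z -> qadj z = z -> G (qadj a *m z *m a).

Lemma idx_inj : injective idx.
Proof.
move=> i j ij; apply/eqP/negPn/negP => ij'.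
have := fr_pp fr' (idx i); rewrite {2}ij !idxP -!mulmxA [qadj a *m (a *m _)]mulmxA aU' mul1mx.
rewrite [p i *m (p j *m _)]mulmxA (fr_orth fr) // mul0mx mulmx0 => p0.
have : qadj a *m (a *m (p i *m qadj a)) *m a = 0 by rewrite -p0 mulmx0 mul0mx.
rewrite !mulmxA aU' mul1mx -mulmxA aU' mulmx1; exact/eqP/(fr_neq0 fr).
Qed.

(** The unitary sum of the block intertwiners conjugates the generators, the
    centre being generated by involutions, which it conjugates as a does, and
    by rotations. *)
Lemma conjugating_unitary : exists g : M, [/\ g *m qadj g = 1%:M,
  forall l, b' l *m g = g *m b l,
  forall z, G z -> C z -> G' (g *m z *m qadj g) &
  forall z, G' z -> C' z -> G (qadj g *m z *m g)].
Proof.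
have /choice[h hP] := fun i => block_intertwiner (b_square i).
have /choice[d dP] : forall i, exists d : bool,
    J' (idx i) *m h i = (-1) ^+ d *: (h i *m J i) by move=> i; case: (hP i).
pose g := \sum_i h i.
have hp i : h i *m p i = h i by case: (hP i).
have ph i : p' (idx i) *m h i = h i by case: (hP i).
have gp i : g *m p i = h i.
  rewrite /g mulmx_suml (bigD1 i) //= hp big1 ?addr0 // => j ji.
  by rewrite -(hp j) -mulmxA (fr_orth fr) // mulmx0.
have pg i : p' (idx i) *m g = h i.
  rewrite /g mulmx_sumr (bigD1 i) //= ph big1 ?addr0 // => j ji.
  by rewrite -(ph j) mulmxA (fr_orth fr') ?mul0mx // (inj_eq idx_inj) eq_sym.
have gg : qadj g *m g = 1%:M.
  apply: (fr_ext fr) => i; rewrite -mulmxA gp mul1mx /g raddf_sum mulmx_suml (bigD1 i) //=.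
  case: (hP i) => _ _ -> _ _; rewrite big1 ?addr0 // => j ji.
  rewrite -(ph j) -(ph i) qadjM (fr_ph fr') -mulmxA [p' _ *m _]mulmxA (fr_orth fr').
    by rewrite mul0mx mulmx0.
  by rewrite (inj_eq idx_inj).
have gg' : g *m qadj g = 1%:M by exact: qmulmx1C.
have rot_g th th' : (forall i, th' (idx i) = (-1) ^+ d i * th i) ->
    rotation J' th' *m g = g *m rotation J th.
  move=> thE; apply: (fr_ext fr) => i.
  have gJ : g *m J i = h i *m J i by rewrite -(fr_pJ hG fr i) mulmxA gp (fr_pJ hG fr).
  have JJh : J' (idx i) *m J' (idx i) *m h i = h i *m J i *m J i.
    by rewrite -mulmxA dP signmxAr mulmxA dP -scalemxAl scalerA -expr2 sqrr_sign scale1r.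
  have L : rotation J' th' *m h i = h i + (rq (sin (th' (idx i))) *: (J' (idx i) *m h i) +
      rq (1 - cos (th' (idx i))) *: (J' (idx i) *m J' (idx i) *m h i)).
    rewrite -{1}(ph i) mulmxA (rotation_p fr') mulmxDl ph mulmxDl.
    by rewrite -scalemxAl -scalemxAl.
  rewrite -[LHS]mulmxA gp L -[RHS]mulmxA (rotation_p fr) mulmxDr gp mulmxDr.
  rewrite rqmxAr rqmxAr [g *m (J i *m J i)]mulmxA gJ JJh dP thE.
  have -> : cos ((-1) ^+ d i * th i) = cos (th i).
    by case: (d i); rewrite ?expr0 ?expr1 ?mul1r ?mulN1r ?cosN.
  have sinE : rq (sin ((-1) ^+ d i * th i)) *: ((-1) ^+ d i *: (h i *m J i)) =
      rq (sin (th i)) *: (h i *m J i).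
    case: (d i); rewrite ?expr0 ?expr1 ?mul1r ?mulN1r ?scale1r //.
    by rewrite sinN rmorphN scaleNr scaleN1r scalerN opprK.
  rewrite sinE; reflexivity.
have inv_g z : (forall i, exists e : bool, z *m p i = (-1) ^+ e *: p i) ->
    g *m z = a *m z *m qadj a *m g.
  move=> zp; apply: (fr_ext fr) => i; have [e ze] := zp i.
  rewrite -[LHS]mulmxA ze signmxAr gp -[RHS]mulmxA gp -{2}(ph i) idxP.
  rewrite !mulmxA -[a *m z *m qadj a *m a]mulmxA aU' mulmx1 -[a *m z *m p i]mulmxA ze.
  by rewrite signmxAr -!scalemxAl -idxP ph.
exists g; split=> //.
- move=> l; rewrite /g mulmx_sumr mulmx_suml; apply: eq_bigr => i _.
  by case: (hP i).
- move=> z Gz cz; have [th [c [Gc cc ch zE]]] := centre_split hG fr Gz cz.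
  (* the angles th transported along the injection idx *)
  pose th' j := if [pick i | idx i == j] is Some i then (-1) ^+ d i * th i else 0.
  have th'E i : th' (idx i) = (-1) ^+ d i * th i.
    by rewrite /th'; case: pickP => [k /eqP/idx_inj ->|/(_ i)]; rewrite ?eqxx.
  rewrite zE mulmxA inv_g; last by move=> i; exact: (herm_p hG fr).
  rewrite -[_ *m g *m _]mulmxA -(rot_g _ _ th'E) -!mulmxA gg' mulmx1 !mulmxA.
  by apply: (pma_M hG'); [exact: conj_a | exact: (rotation_G hG' fr')].
- move=> z Gz cz; have [th' [c [Gc cc ch zE]]] := centre_split hG' fr' Gz cz.
  pose th i := (-1) ^+ d i * th' (idx i).
  have thE i : th' (idx i) = (-1) ^+ d i * th i.
    by rewrite /th mulrA -expr2 sqrr_sign mul1r.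
  rewrite zE -!mulmxA (rot_g _ _ thE) !mulmxA.
  have -> : c = a *m (qadj a *m c *m a) *m qadj a.
    by rewrite !mulmxA aU mul1mx -mulmxA aU mulmx1.
  rewrite -[qadj g *m _ *m g]mulmxA -inv_g => [|i].
    rewrite mulmxA gg mul1mx; apply: (pma_M hG); [exact: conj_a'|exact: (rotation_G hG fr)].
  have [e ce] := herm_p hG' fr' (idx i) Gc cc ch; exists e.
  rewrite -!mulmxA -idx_pa [c *m (_ *m _)]mulmxA ce -scalemxAl signmxAr.
  by rewrite idx_pa mulmxA aU' mul1mx.
Qed.

End Conjugacy.

Section ConjugacyOfInvariants.
Variables (R : realType) (n : nat).
Local Notation M := 'M[quat R]_n.

Lemma sign_mul_central (x y u v : M) (c : bool) :
  x *m y = (-1) ^+ c *: (y *m x) -> u *m v = v *m u ->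
  u *m y = y *m u -> v *m x = x *m v ->
  (x *m u) *m (y *m v) = (-1) ^+ c *: ((y *m v) *m (x *m u)).
Proof.
move=> xy uv uy vx.
rewrite -[LHS]mulmxA [u *m (y *m v)]mulmxA uy -!mulmxA [x *m (y *m _)]mulmxA xy uv.
by rewrite -scalemxAl -!mulmxA [v *m (x *m u)]mulmxA vx -!mulmxA.
Qed.

(** Normalization multiplies generators by central elements that are trivial on the
    real blocks, which changes neither their commutation signs nor their squares
    there, so that the normalized generators of G and G' still match. *)
Lemma conjugate_of_matching (G G' : set M)
  (hG : thick_pm_abelian G) (hG' : thick_pm_abelian G')
  (r : nat) (b b' : 'I_r -> M) (hb : generators G b) (hb' : generators G' b')
  (s s' : nat) (p J : 'I_s -> M) (p' J' : 'I_s' -> M)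
  (fr : frame G p J) (fr' : frame G' p' J')
  (a : M) (idx : 'I_s -> 'I_s') :
  a *m qadj a = 1%:M ->
  (forall l m, exists c : bool,
    b l *m b m = (-1) ^+ c *: (b m *m b l) /\
    b' l *m b' m = (-1) ^+ c *: (b' m *m b' l)) ->
  (forall i, p' (idx i) = a *m p i *m qadj a) ->
  (forall i, J i = 0 <-> J' (idx i) = 0) ->
  (forall i l, J i = 0 -> exists e : bool,
    b l *m b l *m p i = (-1) ^+ e *: p i /\
    b' l *m b' l *m p' (idx i) = (-1) ^+ e *: p' (idx i)) ->
  (forall z, G z -> commutant G z -> qadj z = z -> G' (a *m z *m qadj a)) ->
  (forall z, G' z -> commutant G' z -> qadj z = z -> G (qadj a *m z *m a)) ->
  exists g : M, [/\ g *m qadj g = 1%:M,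
    forall z, G z -> commutant G z -> G' (g *m z *m qadj g),
    forall z, G' z -> commutant G' z -> G (qadj g *m z *m g),
    forall l, G' (g *m b l *m qadj g) &
    forall l, G (qadj g *m b' l *m g)].
Proof.
move=> aU b_sign idxP idxJ b_square conj_a conj_a'.
have [b1 [hb1 /choice[u uP] b1c]] := normalize_generators hG hb fr.
have [b1' [hb1' /choice[u' uP'] b1c']] := normalize_generators hG' hb' fr'.
have Gb := gen_in hb; have Gb' := gen_in hb'.
have b1_sign l m : exists c : bool, b1 l *m b1 m = (-1) ^+ c *: (b1 m *m b1 l) /\
    b1' l *m b1' m = (-1) ^+ c *: (b1' m *m b1' l).
  have [c [bc bc']] := b_sign l m; exists c.
  have [[Gl cl -> _] [Gm cm -> _]] := (uP l, uP m).
  have [[Gl' cl' -> _] [Gm' cm' -> _]] := (uP' l, uP' m).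
  split.
    exact: (sign_mul_central bc (cm _ Gl) (esym (cl _ (Gb m))) (esym (cm _ (Gb l)))).
  exact: (sign_mul_central bc' (cm' _ Gl') (esym (cl' _ (Gb' m))) (esym (cm' _ (Gb' l)))).
have sq_real (K : set M) (v x q : M) : thick_pm_abelian K -> K v -> commutant K v -> K x ->
    v *m q = q -> x *m v *m (x *m v) *m q = x *m x *m q.
  move=> hK Kv cv Kx vq; rewrite -[x *m v *m (x *m v)]mulmxA [v *m (x *m v)]mulmxA -(cv _ Kx).
  by rewrite -!mulmxA vq vq.
have b1_square i l : exists e : bool, b1 l *m b1 l *m p i = (-1) ^+ e *: p i /\
    b1' l *m b1' l *m p' (idx i) = (-1) ^+ e *: p' (idx i).
  have [J0|J0] := pselect (J i = 0); last first.
    exists false; rewrite expr0 !scale1r b1c // b1c' // => J0'.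
    by apply/J0/idxJ.
  have [e [be be']] := b_square i l J0; exists e.
  have [[Gl cl -> ul] [Gl' cl' -> ul']] := (uP l, uP' l).
  rewrite (sq_real _ _ _ _ hG Gl cl (Gb l) (ul _ J0)).
  by rewrite (sq_real _ _ _ _ hG' Gl' cl' (Gb' l) (ul' _ ((idxJ i).1 J0))).
have [g [gg bg conj_g conj_g']] := conjugating_unitary hG hG' hb1 hb1' b1_sign fr fr' aU
  idxP idxJ b1_square conj_a conj_a'.
have gg' : qadj g *m g = 1%:M by exact: qmulmx1C.
exists g; split=> // l.
- have [Gl cl b1E _] := uP l.
  have -> : b l = b1 l *m qadj (u l) by rewrite b1E -mulmxA (pma_unitary hG) // mulmx1.
  have -> : g *m (b1 l *m qadj (u l)) *m qadj g = b1' l *m (g *m qadj (u l) *m qadj g).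
    by rewrite !mulmxA bg.
  apply: (pma_M hG'); first exact: (gen_in hb1').
  by apply: conj_g; [exact: (pma_adj hG)|exact: (commutant_adj hG)].
- have [Gl cl b1E _] := uP' l.
  have -> : b' l = b1' l *m qadj (u' l) by rewrite b1E -mulmxA (pma_unitary hG') // mulmx1.
  have -> : qadj g *m (b1' l *m qadj (u' l)) *m g = b1 l *m (qadj g *m qadj (u' l) *m g).
    have bg' : qadj g *m b1' l = b1 l *m qadj g.
      by rewrite -[LHS]mulmx1 -gg !mulmxA -[_ *m b1' l *m g]mulmxA bg !mulmxA gg' mul1mx.
    by rewrite !mulmxA bg'.
  apply: (pma_M hG); first exact: (gen_in hb1).
  by apply: conj_g'; [exact: (pma_adj hG')|exact: (commutant_adj hG')].
Qed.

End ConjugacyOfInvariants.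

(** * Subgroups of Sp(n)/<-1> and their preimages *)

Section Preimage.
Variables (R : realType) (n : nat).
Local Notation H := (quat R).
Local Notation M := 'M[H]_n.
Local Notation G := (PSp R n).
Implicit Types (F : set G) (A B : Sp R n) (x y : G).

Definition preim_mx F : set M := [set X | exists2 A, F (pi_Sp A) & spval A = X].

Lemma spval_inj : injective (@spval R n). Proof. exact: val_inj. Qed.

Lemma spvalM A B : spval (A * B)%g = spval A *m spval B. Proof. by []. Qed.
Lemma spvalV A : spval A^-1%g = qadj (spval A). Proof. by []. Qed.
Lemma spval1 : spval (1%g : Sp R n) = 1%:M. Proof. by []. Qed.

Lemma spval_unitary A : spval A *m qadj (spval A) = 1%:M.
Proof. exact/eqP/(spvalP A). Qed.

Lemma spval_unitary_l A : qadj (spval A) *m spval A = 1%:M.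
Proof. exact/qmulmx1C/spval_unitary. Qed.

Lemma preim_mxE F A : preim_mx F (spval A) <-> F (pi_Sp A).
Proof. by split=> [[B FB /spval_inj <-]|FA] //; exists A. Qed.

Lemma pi_Sp_eq A B : pi_Sp A = pi_Sp B -> exists c : bool, spval B = (-1) ^+ c *: spval A.
Proof.
move=> /pi_SpP/orP[]/eqP ->; first by exists false; rewrite expr0 scale1r.
by exists true; rewrite expr1 scaleN1r.
Qed.

Hypothesis n_gt0 : (0 < n)%N.

Lemma one_mx_neq0 : (1%:M : M) != 0.
Proof.
apply/eqP => /(congr1 (@tau _ _)); rewrite tau1 raddf0 => /eqP.
by rewrite pnatr_eq0; case: n n_gt0.
Qed.

Lemma spval_neq0 A : spval A != 0.
Proof.
apply/eqP => A0; have := spval_unitary A; rewrite A0 mul0mx => /esym/eqP.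
exact/negP/one_mx_neq0.
Qed.

Section ThickAbelian.
Variables (F : set G) (F_group : closed_abelian_subgroup F) (F_dim : dim_condition F).

Lemma preim_comm A B : F (pi_Sp A) -> F (pi_Sp B) ->
  exists c : bool, spval A *m spval B = (-1) ^+ c *: (spval B *m spval A).
Proof.
case: F_group => _ Fcomm _ FA FB; have := Fcomm _ _ FB FA.
rewrite -[LHS]pi_SpM -[RHS]pi_SpM => /pi_Sp_eq[c]; rewrite !spvalM => ->.
by exists c.
Qed.

(** Commuting up to sign with a one-parameter group is commuting with its
    generator, so the Lie algebra of F is contained in the fixed space, hence
    equal to it since the dimensions agree. *)
Lemma lie_fixed_subgroup : lie_fixed F `<=` lie_subgroup F.
Proof.
have [d [fixd subd]] := F_dim.
apply: (has_dim_sub subd fixd) => X [skX expX]; split=> // A FA.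
have : spval A *m X = X *m spval A.
  apply: comm_mxexp; first exact: spval_neq0.
  move=> t; have [B [BE FB]] := expX t.
  by have [c ABc] := preim_comm FA FB; exists c; rewrite -BE.
by move=> ->; rewrite -mulmxA spvalV spval_unitary mulmx1.
Qed.

Lemma preim_thick : thick_pm_abelian (preim_mx F).
Proof.
case: (F_group) => -[F1 FM FV] _ _; split.
- by exists 1%g.
- move=> _ _ [A FA <-] [B FB <-]; exists (A * B)%g => //.
  by rewrite pi_SpM; exact: FM.
- by move=> _ [A FA <-]; exists A^-1%g; rewrite ?pi_SpV //; exact: FV.
- by move=> _ [A FA <-]; exact: spval_unitary.
- by move=> _ _ [A FA <-] [B FB <-]; exact: preim_comm.
- move=> X cX skX; have : lie_fixed F X.
    split=> [|A FA]; first by rewrite /lie_G /= skX addrN.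
    rewrite cX; last by exists A.
    by rewrite -mulmxA spvalV spval_unitary mulmx1.
  move=> /lie_fixed_subgroup[_ /(_ 1)[A [AE FA]]].
  have X1 : rscale 1 X = X by rewrite rscaleE rmorph1 scale1r.
  by rewrite X1 in AE; exists A.
Qed.

End ThickAbelian.

Lemma sign_intr_mx (c : bool) : ((-1) ^+ c : int)%:~R%:M = (-1) ^+ c *: (1%:M : M).
Proof.
case: c; rewrite ?expr0 ?expr1 ?scale1r ?scaleN1r //.
by rewrite rmorphN1.
Qed.

Lemma sign_intr_mx_inj (l : int) (c : bool) : l = 1 \/ l = -1 ->
  l%:~R%:M = (-1) ^+ c *: (1%:M : M) -> l = (-1) ^+ c.
Proof.
move=> lP lc; have [d lE] : exists d : bool, l = (-1) ^+ d.
  by case: lP => ->; [exists false|exists true].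
by move: lc; rewrite lE sign_intr_mx => /(sign_scale_inj one_mx_neq0) ->.
Qed.

Lemma mformE A B (c : bool) : spval A *m spval B = (-1) ^+ c *: (spval B *m spval A) ->
  mform (pi_Sp A) (pi_Sp B) = (-1) ^+ c.
Proof.
move=> ABc.
have commE A' B' : pi_Sp A' = pi_Sp A -> pi_Sp B' = pi_Sp B ->
    spval (A' * B' * A'^-1 * B'^-1)%g = (-1) ^+ c *: 1%:M.
  move=> /esym/pi_Sp_eq[a A'E] /esym/pi_Sp_eq[b B'E].
  have AB' : spval A' *m spval B' = (-1) ^+ c *: (spval B' *m spval A').
    rewrite A'E B'E; case: (a); case: (b);
    by rewrite !(expr0, expr1, scale1r, scaleN1r) ?mulmxN ?mulNmx ABc ?scalerN.
  rewrite !spvalM AB' -!scalemxAl -[_ *m spval A' *m _]mulmxA !spvalV spval_unitary.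
  by rewrite mulmx1 spval_unitary.
apply: xget_unique.
  split; first by case: (c); [right|left].
  by move=> A' B' A'E B'E; rewrite sign_intr_mx commE.
move=> l [lP lE]; apply: sign_intr_mx_inj => //.
by rewrite -(lE A B) // commE.
Qed.

Section Invariants.
Variables (F : set G) (F_group : closed_abelian_subgroup F) (F_dim : dim_condition F).
Local Notation C := (commutant (preim_mx F)).

Lemma kermE A : kerm F (pi_Sp A) <-> preim_mx F (spval A) /\ C (spval A).
Proof.
split=> [[FA mA]|[/preim_mxE FA cA]].
  split; first by exists A.
  move=> _ [B FB <-]; have [c ABc] := preim_comm F_group FA FB.
  have := mA _ FB; rewrite (mformE ABc) => c1.
  by move: ABc c1; case: (c) => //; rewrite expr0 scale1r.
split=> // y; rewrite -(lift_SpK y) => FB.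
rewrite (@mformE _ _ false) ?expr0 // scale1r; apply/esym/cA.
by exists (lift_Sp y).
Qed.

Lemma BFE A : BF F (pi_Sp A) <->
  [/\ preim_mx F (spval A), C (spval A) & qadj (spval A) = spval A].
Proof.
split=> [[/kermE[GA cA] /(_ A erefl)/(congr1 (@spval _ _)) AA]|[GA cA Ah]].
  split=> //; move: AA; rewrite spvalM spval1 => AA.
  by rewrite -[LHS]mulmx1 -AA mulmxA spval_unitary_l mul1mx.
split; first exact/kermE.
move=> B /esym/pi_Sp_eq[c BE]; apply: spval_inj; rewrite spvalM BE.
rewrite signmxAr -scalemxAl scalerA -expr2 sqrr_sign scale1r.
by rewrite -{2}Ah spval_unitary.
Qed.

(** B_F is the group of central involutions, whose characters cut out the blocks. *)
Lemma eigenspacesE (W : set 'cV[H]_n) (r : nat) (b : 'I_r -> M) (s : nat) (p J : 'I_s -> M) :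
  generators (preim_mx F) b -> frame (preim_mx F) p J ->
  eigenspaces F W <-> exists i, W = img (p i).
Proof.
move=> hb fr; have hG := preim_thick F_group F_dim.
have charE (chi : M -> bool) : [set v : 'cV[H]_n | forall A : Sp R n, BF F (pi_Sp A) ->
      spval A *m v = (-1) ^+ chi (spval A) *: v] =
    [set v | forall z, preim_mx F z -> C z -> qadj z = z -> z *m v = (-1) ^+ chi z *: v].
  apply/seteqP; split=> v /= vP.
    by move=> _ [A FA <-] cA Ah; apply/vP/BFE; split=> //; exists A.
  by move=> A /BFE[GA cA Ah]; exact: vP.
split=> [[[chi WE] [v [Wv v0]]]|[i ->]].
  pose chi' X := chi (xget 1%g [set A | spval A = X]).
  have chiE A : chi' (spval A) = chi A.
    by congr chi; apply: xget_unique => // B /spval_inj.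
  have WE' : W = [set v | forall A : Sp R n, BF F (pi_Sp A) ->
      spval A *m v = (-1) ^+ chi' (spval A) *: v].
    by rewrite WE; apply/seteqP; split=> w /= wP A BA; move: (wP A BA); rewrite chiE.
  rewrite WE' charE in Wv *.
  exact: (block_of_character hG hb fr v0 Wv).
split.
  have [chi chiE] := character_of_block hG hb fr i.
  by exists (fun A => chi (spval A)); rewrite charE chiE.
exact: (img_neq0 (fr_proj fr i) (fr_neq0 fr i)).
Qed.

Lemma muE A (p : M) (c : bool) : is_proj p -> p != 0 ->
  spval A *m spval A *m p = (-1) ^+ c *: p -> mu (img p) (pi_Sp A) = (-1) ^+ c.
Proof.
move=> [ph pp] p0 Ap.
have sq (B : Sp R n) : pi_Sp B = pi_Sp A -> spval B *m spval B *m p = (-1) ^+ c *: p.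
  move=> /esym/pi_Sp_eq[d ->].
  suff -> : ((-1) ^+ d *: spval A) *m ((-1) ^+ d *: spval A) = spval A *m spval A by [].
  by rewrite signmxAr -scalemxAl scalerA -expr2 sqrr_sign scale1r.
have sign_vE (l : int) (e : bool) (v : 'cV[H]_n) :
    l = (-1) ^+ e -> l%:~R *: v = (-1) ^+ e *: v.
  by move=> ->; case: e; rewrite ?expr0 ?expr1 ?rmorphN1 ?rmorph1.
apply: xget_unique.
  split; first by case: (c); [right|left].
  move=> B BA v pv; rewrite (sign_vE _ c) // -{1}pv mulmxA mulmxA sq //.
  by rewrite -scalemxAl pv.
move=> l [lP lE]; have [d ld] : exists d : bool, l = (-1) ^+ d.
  by case: lP => ->; [exists false|exists true].
rewrite ld; congr (_ ^+ nat_of_bool _); apply: (sign_scale_inj p0).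
apply/matrixP => i j.
have pj : img p (col j p) by rewrite /img /= colE mulmxA pp.
have := lE A erefl _ pj; rewrite (sign_vE _ d) // mulmxA -[X in _ *m X]pj mulmxA Ap.
by rewrite -scalemxAl pj => /colP/(_ i); rewrite !mxE => ->.
Qed.

End Invariants.
End Preimage.

(** * Bases of F / ker m *)

Section Words.
Variables (R : realType) (n : nat).
Local Notation M := 'M[quat R]_n.
Local Notation G := (PSp R n).
Implicit Types (A B : Sp R n) (x y : G).

Definition word (r : nat) (b : 'I_r -> Sp R n) (e : {ffun 'I_r -> 'F_2}) : Sp R n :=
  \big[*%g/1%g]_(i < r) (b i ^+ e i)%g.

Lemma pi_SpMg A B : pi_Sp (A * B)%g = (pi_Sp A * pi_Sp B)%g.
Proof. exact: pi_SpM. Qed.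

Lemma pi_SpVg A : pi_Sp A^-1%g = (pi_Sp A)^-1%g.
Proof. exact: pi_SpV. Qed.

Lemma pi_SpX A k : pi_Sp (A ^+ k)%g = (pi_Sp A ^+ k)%g.
Proof.
elim: k => [|k IH]; first by rewrite !expg0.
by rewrite !expgS pi_SpMg IH.
Qed.

Lemma pi_Sp_word r (b : 'I_r -> G) e :
  pi_Sp (word (fun l => lift_Sp (b l)) e) = \big[*%g/1%g]_(i < r) (b i ^+ e i)%g.
Proof.
rewrite /word (big_morph (@pi_Sp R n) (id1 := 1%g) (op1 := *%g)) //.
  by apply: eq_bigr => i _; rewrite pi_SpX lift_SpK.
exact: pi_SpMg.
Qed.

Lemma word_ind r (b : 'I_r -> Sp R n) (P : Sp R n -> Prop) e : P 1%g ->
  (forall A B, P A -> P B -> P (A * B)%g) -> (forall l, P (b l)) -> P (word b e).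
Proof.
move=> P1 PM Pb; apply: big_ind => // i _; elim: (nat_of_ord (e i)) => [|k IH].
  by rewrite expg0.
by rewrite expgS; exact: PM.
Qed.

Variables (F : set G) (F_group : closed_abelian_subgroup F).
Local Notation K := (preim_mx F).
Local Notation C := (commutant K).
Hypothesis n_gt0 : (0 < n)%N.
Hypothesis F_dim : dim_condition F.

Let hK : thick_pm_abelian K := preim_thick n_gt0 F_group F_dim.

Lemma kerm1 : kerm F 1%g.
Proof.
apply/(kermE n_gt0 F_group 1%g); split; first exact: (pma_1 hK).
exact: commutant1.
Qed.

Lemma kermM x y : kerm F x -> kerm F y -> kerm F (x * y)%g.
Proof.
rewrite -(lift_SpK x) -(lift_SpK y).
move=> /(kermE n_gt0 F_group)[Kx cx] /(kermE n_gt0 F_group)[Ky cy].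
rewrite -pi_SpMg; apply/(kermE n_gt0 F_group); rewrite spvalM; split.
  exact: (pma_M hK).
exact: commutantM.
Qed.

Lemma kermV x : kerm F x -> kerm F x^-1%g.
Proof.
rewrite -(lift_SpK x) => /(kermE n_gt0 F_group)[Kx cx].
rewrite -pi_SpVg; apply/(kermE n_gt0 F_group); rewrite spvalV; split.
  exact: (pma_adj hK).
exact: commutant_adj.
Qed.

Lemma kcoset_mul x z : kerm F z -> kcoset F (x * z)%g = kcoset F x.
Proof.
move=> kz; apply/seteqP; split=> _ [w kw <-].
  by exists (z * w)%g; [exact: kermM|rewrite mulgA].
exists (z^-1 * w)%g; first by apply: kermM => //; exact: kermV.
by rewrite !mulgA -(mulgA x) mulgV mulg1.
Qed.

Lemma kcoset_eq x y : kcoset F x = kcoset F y -> exists2 z, kerm F z & x = (y * z)%g.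
Proof.
move=> xy; have : kcoset F x x by exists 1%g; [exact: kerm1|rewrite mulg1].
by rewrite xy => -[z kz <-]; exists z.
Qed.

Definition spans (r : nat) (b : 'I_r -> Sp R n) := (forall l, F (pi_Sp (b l))) /\
  forall A, F (pi_Sp A) -> exists e Z, kerm F (pi_Sp Z) /\ A = (word b e * Z)%g.

Lemma spans_ind r (b : 'I_r -> Sp R n) (P : Sp R n -> Prop) : spans b -> P 1%g ->
  (forall A B, P A -> P B -> P (A * B)%g) -> (forall l, P (b l)) ->
  (forall Z, K (spval Z) -> C (spval Z) -> P Z) -> forall A, F (pi_Sp A) -> P A.
Proof.
move=> [Fb bP] P1 PM Pb PZ A /bP[e [Z [/(kermE n_gt0 F_group)[KZ cZ] ->]]].
exact: (PM _ _ (word_ind e P1 PM Pb) (PZ _ KZ cZ)).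
Qed.

Lemma spans_commutant r (b : 'I_r -> Sp R n) X : spans b ->
  (forall l, spval (b l) *m X = X *m spval (b l)) ->
  (forall z, K z -> C z -> z *m X = X *m z) -> C X.
Proof.
move=> bP bX ZX _ [A FA <-].
apply: (spans_ind (P := fun A => spval A *m X = X *m spval A) bP _ _ bX _ FA).
- by rewrite spval1 mul1mx mulmx1.
- by move=> B D BX DX; rewrite spvalM -mulmxA DX mulmxA BX mulmxA.
- by move=> Z KZ cZ; exact: ZX.
Qed.

Lemma F_word r (b : 'I_r -> Sp R n) e : (forall l, F (pi_Sp (b l))) -> F (pi_Sp (word b e)).
Proof.
case: F_group => -[F1 FM _] _ _ Fb; apply: (word_ind (P := fun A => F (pi_Sp A))) => //.
by move=> A B FA FB; rewrite pi_SpMg; exact: FM.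
Qed.

Variables (r : nat) (b : 'I_r -> G) (Fb : forall l, F (b l)).
Hypothesis b_basis : forall x, F x -> exists! e : {ffun 'I_r -> 'F_2},
  kcoset F x = kcoset F (\big[*%g/1%g]_(i < r) (b i ^+ e i)%g).
Local Notation B := (fun l => lift_Sp (b l)).

Lemma basis_spans : spans B.
Proof.
split=> [l|A FA]; first by rewrite lift_SpK.
have [e [Ae _]] := b_basis FA.
have [z kz AE] := kcoset_eq Ae; exists e, ((word B e)^-1 * A)%g; split.
  by rewrite pi_SpMg AE -pi_Sp_word pi_SpVg mulgA mulVg mul1g.
by rewrite mulgA mulgV mul1g.
Qed.

Lemma word_inj e e' : C (spval (word B e) *m qadj (spval (word B e'))) -> e = e'.
Proof.
move=> cee; have FB l : F (pi_Sp (B l)) by rewrite lift_SpK.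
have Fe := F_word e FB; have Fe' := F_word e' FB.
have [e0 [_ e0P]] := b_basis Fe.
rewrite -(e0P e); last by rewrite -pi_Sp_word.
apply: e0P; rewrite -pi_Sp_word.
have Ke : K (spval (word B e)) by exists (word B e).
have Ke' : K (spval (word B e')) by exists (word B e').
pose Z := ((word B e')^-1 * word B e)%g.
have -> : word B e = (word B e' * Z)%g by rewrite mulgA mulgV mul1g.
rewrite pi_SpMg kcoset_mul //; apply/(kermE n_gt0 F_group).
rewrite spvalM spvalV; split; first by apply: (pma_M hK) => //; exact: (pma_adj hK).
have := cee _ Ke'; rewrite -mulmxA (pma_unitary_l hK Ke') mulmx1 mulmxA.
move=> /(congr1 (mulmx (qadj (spval (word B e'))))).
rewrite !mulmxA (pma_unitary_l hK Ke') mul1mx => eE.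
by rewrite -eE.
Qed.

Lemma basis_transversal : coset_transversal K (fun e => spval (word B e)).
Proof.
have FB l : F (pi_Sp (B l)) by rewrite lift_SpK.
split; [by move=> e; exists (word B e); [exact: F_word|]|exact: word_inj|].
move=> _ [A FA <-]; have [_ /(_ A FA)[e [Z [kZ AE]]]] := basis_spans.
have [KZ cZ] := (kermE n_gt0 F_group Z).1 kZ.
by exists e, (spval Z); split=> //; rewrite AE spvalM.
Qed.

(** The map sending an element to its commutation signs with the b l is
    injective on the 2^r cosets of the centre, hence onto. *)
Lemma basis_generators : generators K (fun l => spval (B l)).
Proof.
have Kb l : K (spval (B l)) by exists (B l); rewrite ?lift_SpK.
have tr := basis_transversal.
split=> //; first by move=> X; apply: spans_commutant; exact: basis_spans.
have /choice[sg sgP] : forall e : {ffun 'I_r -> 'F_2}, exists c : {ffun 'I_r -> bool},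
    forall l, spval (word B e) *m spval (B l) =
      (-1) ^+ c l *: (spval (B l) *m spval (word B e)).
  move=> e; have /choice[c cP] := fun l => pma_pm hK (tr_in tr e) (Kb l).
  by exists [ffun l => c l] => l; rewrite ffunE.
have sg_inj : injective sg.
  move=> e e' ee; apply: word_inj; apply: (spans_commutant basis_spans) => [l|z Kz cz].
    have h := sgP e' l; rewrite -ee in h.
    have h' : qadj (spval (word B e')) *m spval (B l) =
        (-1) ^+ sg e l *: (spval (B l) *m qadj (spval (word B e'))).
      have := congr1 (fun X => qadj (spval (word B e')) *m X *m qadj (spval (word B e'))) h.
      rewrite signmxAr -scalemxAl -!mulmxA (pma_unitary hK (tr_in tr e')) mulmx1.
      rewrite [qadj _ *m (_ *m _)]mulmxA (pma_unitary_l hK (tr_in tr e')) mul1mx => ->.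
      by rewrite scalerA -expr2 sqrr_sign scale1r.
    rewrite -[RHS]mulmxA h' signmxAr [spval (word B e) *m (_ *m _)]mulmxA sgP.
    by rewrite -scalemxAl scalerA -expr2 sqrr_sign scale1r mulmxA.
  have cz' := cz _ (pma_adj hK (tr_in tr e')); have cze := cz _ (tr_in tr e).
  by rewrite mulmxA -cze -!mulmxA cz'.
move=> c.
have /inj_card_onto : (#|{: {ffun 'I_r -> bool}}| <= #|{: {ffun 'I_r -> 'F_2}}|)%N.
  by rewrite !card_ffun card_bool card_Fp.
move=> /(_ _ sg_inj [ffun l => c l])/codomP[e eE].
exists (spval (word B e)); split=> [|l]; first exact: (tr_in tr).
by rewrite sgP -eE ffunE.
Qed.

End Words.

(** * Transport of blocks and bases *)

Section BlockTransport.
Variables (R : realType) (n : nat).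
Local Notation M := 'M[quat R]_n.

(** Conjugation by a carries the central involutions of G to those of G', so it
    carries their simultaneous eigenspaces, the blocks, to each other. *)
Lemma block_transport (G G' : set M)
  (hG : thick_pm_abelian G) (hG' : thick_pm_abelian G')
  (r r' : nat) (b : 'I_r -> M) (b' : 'I_r' -> M)
  (hb : generators G b) (hb' : generators G' b')
  (s s' : nat) (p J : 'I_s -> M) (p' J' : 'I_s' -> M)
  (fr : frame G p J) (fr' : frame G' p' J') (a : M) :
  a *m qadj a = 1%:M ->
  (forall z, G z -> commutant G z -> qadj z = z ->
     G' (a *m z *m qadj a) /\ commutant G' (a *m z *m qadj a)) ->
  (forall z, G' z -> commutant G' z -> qadj z = z ->
     G (qadj a *m z *m a) /\ commutant G (qadj a *m z *m a)) ->
  forall i, exists j, p' j = a *m p i *m qadj a.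
Proof.
move=> aU conj_a conj_a' i; have aU' := qmulmx1C aU.
have [chi chiE] := character_of_block hG hb fr i.
pose chi' z := chi (qadj a *m z *m a).
have [v [pv v0]] := img_neq0 (fr_proj fr i) (fr_neq0 fr i).
pose q := a *m p i *m qadj a.
have qP : is_proj q.
  split; first by rewrite /q !qadjM qadjK (fr_ph fr) mulmxA.
  rewrite /q -!mulmxA [qadj a *m (a *m _)]mulmxA aU' mul1mx.
  by rewrite [p i *m (p i *m _)]mulmxA (fr_pp fr).
have imgq w : img q w <-> img (p i) (qadj a *m w).
  rewrite /img /= /q; split=> [qw|aw].
    have := congr1 (mulmx (qadj a)) qw.
    by rewrite !mulmxA aU' mul1mx.
  by rewrite -mulmxA -mulmxA aw mulmxA aU mul1mx.
have W'E : [set w : 'cV[quat R]_n | forall z, G' z -> commutant G' z -> qadj z = z ->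
    z *m w = (-1) ^+ chi' z *: w] = img q.
  apply/seteqP; split=> w wP.
    apply/imgq; rewrite -chiE => z Gz cz zh.
    have [Gz' cz'] := conj_a z Gz cz zh.
    have zh' : qadj (a *m z *m qadj a) = a *m z *m qadj a.
      by rewrite !qadjM qadjK zh mulmxA.
    have chiz : chi' (a *m z *m qadj a) = chi z.
      by rewrite /chi' !mulmxA aU' mul1mx -mulmxA aU' mulmx1.
    have := congr1 (mulmx (qadj a)) (wP _ Gz' cz' zh').
    by rewrite chiz signmxAr !mulmxA aU' mul1mx.
  move=> z Gz cz zh; have [Gz' cz'] := conj_a' z Gz cz zh.
  have zh' : qadj (qadj a *m z *m a) = qadj a *m z *m a.
    by rewrite !qadjM qadjK zh mulmxA.
  have : img (p i) (qadj a *m w) by apply/imgq.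
  rewrite -chiE => /(_ _ Gz' cz' zh') h.
  have := congr1 (mulmx a) h; rewrite -/(chi' z) signmxAr !mulmxA aU mul1mx.
  by rewrite -[z *m a *m qadj a]mulmxA aU mulmx1 mul1mx.
have av0 : a *m v != 0.
  by apply: contra v0 => /eqP av; rewrite -[v]mul1mx -aU' -mulmxA av mulmx0.
have qav : img q (a *m v) by apply/imgq; rewrite mulmxA aU' mul1mx.
rewrite -W'E in qav.
have [j] := block_of_character hG' hb' fr' av0 qav; rewrite W'E => qj.
by exists j; apply: img_inj => //; exact: (fr_proj fr').
Qed.

End BlockTransport.

Section Main.
Variables (R : realType) (n : nat) (n_gt0 : (0 < n)%N).
Local Notation M := 'M[quat R]_n.
Local Notation G := (PSp R n).

(** With d the dimension of the block and 2 k the rank, 4 d^2 is 4^k for a real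
    block and at least 2 * 4^k for a complex one. *)
Lemma small_block_real (F : set G) (F_group : closed_abelian_subgroup F)
  (F_dim : dim_condition F) (k : nat) (F_k : half_rank F k)
  (s : nat) (p J : 'I_s -> M) (fr : frame (preim_mx F) p J) i :
  small_eigenspaces k F (img (p i)) <-> J i = 0.
Proof.
have hK := preim_thick n_gt0 F_group F_dim.
have [b [Fb b_basis]] := F_k.
have hb := basis_generators F_group n_gt0 F_dim Fb b_basis.
have tr := basis_transversal F_group n_gt0 F_dim Fb b_basis.
have cardT : #|{: {ffun 'I_(2 * k) -> 'F_2}}| = (2 ^ (2 * k))%N.
  by rewrite card_ffun card_Fp // card_ord.
have pP := fr_proj fr i.
split=> [[_ k_gt0 /(has_dim_img _ pP) pk]|J0].
  apply: contrapT => /(complex_block_dim hK tr fr); rewrite cardT pk.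
  rewrite -natrX -natrM ler_nat; case: k k_gt0 {F_k b Fb b_basis hb tr cardT pk} => // k _ /=.
  by rewrite -expnM [(k * 2)%N]mulnC mulnS expnD mulnA leq_pmul2r ?expn_gt0.
have [d pd] := tau_proj_nat pP.
have := real_block_dim hK hb tr fr J0; rewrite cardT pd -natrX -natrM => /eqP.
rewrite eqr_nat (_ : 4 * d ^ 2 = (2 * d) ^ 2)%N; last by rewrite expnMn.
rewrite [(2 * k)%N]mulnC expnM eqn_exp2r // => /eqP dk.
have k_gt0 : (0 < k)%N by move: dk; case: (k) => // /eqP; case: (d) => // m; rewrite mulnS.
split=> //; first by apply/(eigenspacesE n_gt0 F_group F_dim _ hb fr); exists i.
apply/(has_dim_img _ pP); rewrite pd; congr _%:R.
by move: dk; rewrite -{1}(prednK k_gt0) expnS => /eqP; rewrite eqn_pmul2l // => /eqP.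
Qed.

Lemma translate_img (a : Sp R n) (p q : M) :
  q = spval a *m p *m qadj (spval a) -> translate a (img p) = img q.
Proof.
move=> ->; have aU := spval_unitary a; have aU' := spval_unitary_l a.
apply/seteqP; split=> [_ [v pv <-]|w]; rewrite /img /=.
  by rewrite mulmxA -[_ *m _ *m spval a]mulmxA aU' mulmx1 -mulmxA pv.
move=> qw; exists (qadj (spval a) *m w); last by rewrite mulmxA aU mul1mx.
have := congr1 (mulmx (qadj (spval a))) qw.
by rewrite /img /= !mulmxA aU' mul1mx.
Qed.

Lemma translate_inj (a : Sp R n) : injective (@translate R n a).
Proof.
have inv (b c : Sp R n) W : (b * c = 1)%g -> translate b (translate c W) = W.
  move=> bc; have bc1 : spval b *m spval c = 1%:M by rewrite -spvalM bc.
  apply/seteqP; split=> [_ [_ [v Wv <-] <-]|v Wv]; first by rewrite mulmxA bc1 mul1mx.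
  by exists (spval c *m v); [exists v|rewrite mulmxA bc1 mul1mx].
by move=> W W' WW'; rewrite -(inv a^-1%g a W) ?mulVg // WW' inv // mulVg.
Qed.

End Main.

Section MatchingBases.
Variables (R : realType) (n : nat) (n_gt0 : (0 < n)%N).
Local Notation M := 'M[quat R]_n.
Local Notation G := (PSp R n).
Variables (F F' : set G).
Hypotheses (F_group : closed_abelian_subgroup F) (F'_group : closed_abelian_subgroup F').
Hypotheses (F_dim : dim_condition F) (F'_dim : dim_condition F').
Variable f : set G -> set G.

Definition related x x' := [/\ F x, F' x' & f (kcoset F x) = kcoset F' x'].

Hypothesis f_bij : set_bij (quo_kerm F) (quo_kerm F') f.
Hypothesis f_hom : forall x y x' y', related x x' -> related y y' ->
  f (kcoset F (x * y)%g) = kcoset F' (x' * y')%g /\ mform x' y' = mform x y.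

Lemma related_exists x : F x -> exists x', related x x'.
Proof.
case: f_bij => f_fun _ _ Fx; have : quo_kerm F (kcoset F x) by exists x.
by move=> /f_fun[x' F'x' x'E]; exists x'.
Qed.

Lemma relatedM x y x' y' : related x x' -> related y y' -> related (x * y)%g (x' * y')%g.
Proof.
move=> xx yy; have [fxy _] := f_hom xx yy; case: xx yy => Fx F'x _ [Fy F'y _].
have [[_ FM _] _ _] := F_group; have [[_ F'M _] _ _] := F'_group.
by split=> //; [exact: FM|exact: F'M].
Qed.

Lemma related1 : related 1%g 1%g.
Proof.
have [[F1 _ _] _ _] := F_group; have [[F'1 _ _] _ _] := F'_group.
have [x' xx] := related_exists F1; have [fxx _] := f_hom xx xx.
case: xx => _ F'x fx; split=> //; rewrite fx.
move: fxx; rewrite mulg1 fx => /esym/(kcoset_eq F'_group n_gt0 F'_dim)[z kz].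
move=> /mulgI ->; rewrite -{1}(mul1g z).
exact: (kcoset_mul F'_group n_gt0 F'_dim).
Qed.

(** The commutation sign of two elements is the value of the form m. *)
Lemma related_sign (A B A' B' : Sp R n) (c : bool) :
  related (pi_Sp A) (pi_Sp A') -> related (pi_Sp B) (pi_Sp B') ->
  spval A *m spval B = (-1) ^+ c *: (spval B *m spval A) ->
  spval A' *m spval B' = (-1) ^+ c *: (spval B' *m spval A').
Proof.
move=> AA BB ABc; have [_ mE] := f_hom AA BB.
case: AA BB => _ FA' _ [_ FB' _]; have [c' ABc'] := preim_comm F'_group FA' FB'.
move: mE; rewrite (mformE n_gt0 ABc) (mformE n_gt0 ABc').
by move=> /sign_int_inj <-.
Qed.

Variables (r : nat) (b b' : 'I_r -> G) (bb' : forall l, related (b l) (b' l)).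
Hypothesis b_basis : forall x, F x -> exists! e : {ffun 'I_r -> 'F_2},
  kcoset F x = kcoset F (\big[*%g/1%g]_(i < r) (b i ^+ e i)%g).
Local Notation B := (fun l => lift_Sp (b l)).
Local Notation B' := (fun l => lift_Sp (b' l)).

Lemma related_word e : related (pi_Sp (word B e)) (pi_Sp (word B' e)).
Proof.
rewrite !pi_Sp_word; apply: (big_ind2 related) => [||l _]; first exact: related1.
  by move=> x1 x2 y1 y2; exact: relatedM.
elim: (nat_of_ord (e l)) => [|k IH]; first by rewrite !expg0; exact: related1.
by rewrite !expgS; exact: relatedM.
Qed.

(** f carries the coset of a word in the b l to that of the same word in the b' l,
    and it is onto. *)
Lemma related_spans : spans F' B'.
Proof.
have Fb l : F (b l) by case: (bb' l).
have spanB := basis_spans F_group n_gt0 F_dim Fb b_basis.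
split=> [l|A' FA']; first by rewrite lift_SpK; case: (bb' l).
have [_ _ f_surj] := f_bij.
have [|_ [x Fx <-] fx] := f_surj (kcoset F' (pi_Sp A')); first by exists (pi_Sp A').
rewrite -(lift_SpK x) in Fx fx; have [_ /(_ _ Fx)[e [Z [kZ xE]]]] := spanB.
have [_ _ fe] := related_word e.
move: fx; rewrite xE pi_SpMg (kcoset_mul F_group n_gt0 F_dim) // fe.
move=> /esym/(kcoset_eq F'_group n_gt0 F'_dim)[z kz A'E].
exists e, ((word B' e)^-1 * A')%g; split; last by rewrite mulgA mulgV mul1g.
by rewrite pi_SpMg pi_SpVg A'E mulgA mulVg mul1g.
Qed.

(** An element with prescribed commutation signs is found in F and carried over
    by f, which preserves m. *)
Lemma related_generators : generators (preim_mx F') (fun l => spval (B' l)).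
Proof.
have Fb l : F (b l) by case: (bb' l).
have hb := basis_generators F_group n_gt0 F_dim Fb b_basis.
split=> [l|X bX ZX|e]; first by exists (B' l) => //; rewrite lift_SpK; case: (bb' l).
  exact: (spans_commutant F'_group n_gt0 related_spans).
have [_ [[A FA <-] Ae]] := gen_sign hb e.
have [x' xx] := related_exists FA; rewrite -(lift_SpK x') in xx.
have [_ F'x _] := xx.
exists (spval (lift_Sp x')); split=> [|l]; first by exists (lift_Sp x').
by apply: (related_sign xx) (Ae l); rewrite !lift_SpK.
Qed.

End MatchingBases.

(** * The conjugacy theorem *)

Theorem proposition4p2 (R : realType) (n : nat) (n_gt0 : (0 < n)%N)
  (F F' : set (PSp R n))
  (F_group : closed_abelian_subgroup F) (F'_group : closed_abelian_subgroup F')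
  (F_dim : dim_condition F) (F'_dim : dim_condition F')
  (k : nat) (F_k : half_rank F k) (F'_k : half_rank F' k)
  (a : Sp R n) (BF_conj : BF F' = conj_set (pi_Sp a) (BF F))
  (f : set (PSp R n) -> set (PSp R n))
  (sigma : set 'cV[quat R]_n -> set 'cV[quat R]_n)
  (struct_iso : multi_symplectic_iso k F F' f sigma)
  (sigma_a : forall W, small_eigenspaces k F W -> sigma W = translate a W) :
  exists g : PSp R n, F' = conj_set g F.
Proof.
have hK := preim_thick n_gt0 F_group F_dim.
have hK' := preim_thick n_gt0 F'_group F'_dim.
have [s [p [J fr]]] := frame_exists hK.
have [s' [p' [J' fr']]] := frame_exists hK'.
have [f_bij [sig_fun _ sig_surj] f_hom0 f_mu0] := struct_iso.
have f_hom x y x' y' : related F F' f x x' -> related F F' f y y' ->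
    f (kcoset F (x * y)%g) = kcoset F' (x' * y')%g /\ mform x' y' = mform x y.
  by move=> [Fx F'x fx] [Fy F'y fy]; exact: f_hom0.
have [b [Fb b_basis]] := F_k.
have /choice[b' bb'] := fun l => related_exists f_bij (Fb l).
have hb := basis_generators F_group n_gt0 F_dim Fb b_basis.
have hb' := related_generators n_gt0 F_group F'_group F_dim F'_dim f_bij f_hom bb' b_basis.
have b_sign l m : exists c : bool,
    spval (lift_Sp (b l)) *m spval (lift_Sp (b m)) =
      (-1) ^+ c *: (spval (lift_Sp (b m)) *m spval (lift_Sp (b l))) /\
    spval (lift_Sp (b' l)) *m spval (lift_Sp (b' m)) =
      (-1) ^+ c *: (spval (lift_Sp (b' m)) *m spval (lift_Sp (b' l))).
  have [c bc] := pma_pm hK (gen_in hb l) (gen_in hb m); exists c; split; first exact: bc.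
  by apply: (related_sign n_gt0 F'_group f_hom _ _ bc); rewrite !lift_SpK.
have conj_a z : preim_mx F z -> commutant (preim_mx F) z -> qadj z = z ->
    preim_mx F' (spval a *m z *m qadj (spval a)) /\
    commutant (preim_mx F') (spval a *m z *m qadj (spval a)).
  move=> [A FA <-] cA Ah.
  have : BF F' (pi_Sp (a * A * a^-1)%g).
    rewrite BF_conj; exists (pi_Sp A); last by rewrite !pi_SpMg pi_SpVg.
    by apply/(BFE n_gt0 F_group); split=> //; exists A.
  by move=> /(BFE n_gt0 F'_group)[].
have conj_a' z : preim_mx F' z -> commutant (preim_mx F') z -> qadj z = z ->
    preim_mx F (qadj (spval a) *m z *m spval a) /\
    commutant (preim_mx F) (qadj (spval a) *m z *m spval a).
  move=> [A FA <-] cA Ah.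
  have : BF F' (pi_Sp A) by apply/(BFE n_gt0 F'_group); split=> //; exists A.
  rewrite BF_conj => -[x Bx xE].
  have : BF F (pi_Sp (a^-1 * A * a)%g).
    rewrite !pi_SpMg pi_SpVg -xE !mulgA mulVg mul1g -mulgA mulVg mulg1.
    exact: Bx.
  by move=> /(BFE n_gt0 F_group)[].
have aU := spval_unitary a.
have /choice[idx idxP] := block_transport hK hK' hb hb' fr fr' aU conj_a conj_a'.
have small := small_block_real n_gt0 F_group F_dim F_k fr.
have small' := small_block_real n_gt0 F'_group F'_dim F'_k fr'.
have translate_p i : translate a (img (p i)) = img (p' (idx i)) by exact: translate_img.
have sigma_p i : J i = 0 -> sigma (img (p i)) = img (p' (idx i)).
  by move=> /small Wi; rewrite sigma_a.
(* The small eigenspaces are the real blocks, on which sigma is translation by a. *)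
have idxJ i : J i = 0 <-> J' (idx i) = 0.
  split=> [Ji|/small' /sig_surj[W Ws]].
    by apply/small'; rewrite -sigma_p //; apply: sig_fun; apply/small.
  rewrite sigma_a // -translate_p => /translate_inj WE.
  by apply/small; rewrite -WE.
(* The squares of the generators on a real block are the values of mu. *)
have b_square i l : J i = 0 -> exists e : bool,
    spval (lift_Sp (b l)) *m spval (lift_Sp (b l)) *m p i = (-1) ^+ e *: p i /\
    spval (lift_Sp (b' l)) *m spval (lift_Sp (b' l)) *m p' (idx i) = (-1) ^+ e *: p' (idx i).
  move=> Ji; have J'i := (idxJ i).1 Ji.
  have sq (K : set 'M[quat R]_n) (hh : thick_pm_abelian K) x : K x ->
      K (x *m x) /\ commutant K (x *m x).
    by move=> Kx; split; [exact: (pma_M hh)|exact: (pma_square hh)].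
  have [Kb cb] := sq _ hK _ (gen_in hb l); have [Kb' cb'] := sq _ hK' _ (gen_in hb' l).
  have [e be] := centre_p_real hK fr Kb cb Ji.
  have [e' be'] := centre_p_real hK' fr' Kb' cb' J'i.
  have [_ F'b fb] := bb' l.
  have mu_e : mu (img (p i)) (b l) = (-1) ^+ e.
    by rewrite -(lift_SpK (b l)); exact: (muE (fr_proj fr i) (fr_neq0 fr i) be).
  have mu_e' : mu (img (p' (idx i))) (b' l) = (-1) ^+ e'.
    by rewrite -(lift_SpK (b' l)); exact: (muE (fr_proj fr' _) (fr_neq0 fr' _) be').
  have := f_mu0 (img (p i)) (b l) (b' l) ((small i).2 Ji) (Fb l) F'b fb.
  rewrite sigma_p // mu_e mu_e' => /sign_int_inj ee.
  by exists e; split; [exact: be | rewrite -ee; exact: be'].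
have [g [gU gZ gZ' gb gb']] := conjugate_of_matching hK hK' hb hb' fr fr' aU b_sign idxP idxJ
  b_square (fun z Kz cz zh => (conj_a z Kz cz zh).1)
  (fun z Kz cz zh => (conj_a' z Kz cz zh).1).
have gU' := qmulmx1C gU.
pose h : Sp R n := MkSp (introT eqP gU).
have spanB := basis_spans F_group n_gt0 F_dim Fb b_basis.
have spanB' := related_spans n_gt0 F_group F'_group F_dim F'_dim f_bij f_hom bb' b_basis.
have conj_h A : F (pi_Sp A) -> F' (pi_Sp (h * A * h^-1)%g).
  move=> FA; apply/preim_mxE.
  apply: (spans_ind (P := fun A => preim_mx F' (spval (h * A * h^-1)%g))
    F_group n_gt0 spanB _ _ _ _ FA).
  - by rewrite mulg1 mulgV; exact: (pma_1 hK').
  - move=> D E hD hE.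
    have -> : (h * (D * E) * h^-1)%g = ((h * D * h^-1) * (h * E * h^-1))%g.
      by rewrite !mulgA -(mulgA _ h^-1%g h) mulVg mulg1.
    exact: (pma_M hK').
  - by move=> l; exact: gb.
  - by move=> Z KZ cZ; exact: gZ.
have conj_h' A : F' (pi_Sp A) -> F (pi_Sp (h^-1 * A * h)%g).
  move=> FA; apply/preim_mxE.
  apply: (spans_ind (P := fun A => preim_mx F (spval (h^-1 * A * h)%g))
    F'_group n_gt0 spanB' _ _ _ _ FA).
  - by rewrite mulg1 mulVg; exact: (pma_1 hK).
  - move=> D E hD hE.
    have -> : (h^-1 * (D * E) * h)%g = ((h^-1 * D * h) * (h^-1 * E * h))%g.
      by rewrite !mulgA -(mulgA _ h h^-1%g) mulgV mulg1.
    exact: (pma_M hK).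
  - by move=> l; exact: gb'.
  - by move=> Z KZ cZ; exact: gZ'.
exists (pi_Sp h); apply/seteqP; split=> [x'|_ [x Fx <-]].
  rewrite -(lift_SpK x') => /conj_h' Fx; exists (pi_Sp (h^-1 * lift_Sp x' * h)%g) => //.
  by rewrite !pi_SpMg pi_SpVg !mulgA mulgV mul1g -mulgA mulgV mulg1.
rewrite -(lift_SpK x) in Fx *.
by have := conj_h _ Fx; rewrite !pi_SpMg pi_SpVg.
Qed.
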